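(* Let $\alpha,\theta$ be nonconstant inner functions with $\alpha\leqslant\theta$. If $\varphi\in L^2$ and $A^{\theta,\alpha}_\varphi\in\mathcal{T}(\theta,\alpha)$, then the following equalities hold for $f\in K_\theta$: (1) $(A^{\theta,\alpha}_\varphi C_\theta-C_\theta A^{\alpha,\theta}_{\overline{\varphi}}P_\alpha)f=\big(\widetilde{H}_\alpha H_{\overline{\alpha}\varphi}C_{\frac{\theta}{\alpha}}P_{\frac{\theta}{\alpha}}\overline{\alpha}-\alpha\widetilde{H}_{\frac{\theta}{\alpha}}H_{\overline{\theta}\varphi}C_\theta P_\alpha\big)f$; (2) $(A^{\theta,\alpha}_\varphi C_{\alpha,\frac{\theta}{\alpha}}-C_{\alpha,\frac{\theta}{\alpha}}A^{\alpha,\theta}_{\overline{\varphi}}P_\alpha)f=\big(\widetilde{H}_\alpha H_\varphi C_\theta-\widetilde{H}_\theta H_\varphi C_\alpha P_\alpha\big)f$; (3) $\big(\tfrac{\theta}{\alpha}A^{\theta,\alpha}_\varphi C_\theta-C_\theta A^{\alpha,\theta}_{\overline{\varphi}}P_\alpha\tfrac{\overline{\theta}}{\overline{\alpha}}\big)f=\big(\widetilde{H}_\theta H_\varphi C_{\frac{\theta}{\alpha}}P_{\frac{\theta}{\alpha}}-\widetilde{H}_{\frac{\theta}{\alpha}}H_\varphi C_\theta\big)f$.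
   Context: $L^2=L^2(\mathbb{T},m)$ with $m$ normalized Lebesgue measure on the unit circle; $H^2\subset L^2$ is the Hardy space of the unit disc; $\overline{H^2_0}=L^2\ominus H^2$; $P$ and $P^-$ are the orthogonal projections of $L^2$ onto $H^2$ and $\overline{H^2_0}$. An inner function is $\theta\in H^\infty$ with $|\theta|=1$ a.e. on $\mathbb{T}$; $K_\theta=H^2\ominus\theta H^2$ ($=\{0\}$ if $\theta$ is constant), $P_\theta$ is the orthogonal projection of $L^2$ onto $K_\theta$, $K_\theta^\infty=K_\theta\cap H^\infty$ (dense in $K_\theta$). $\alpha\leqslant\theta$ means $\frac{\theta}{\alpha}$ is inner; then, orthogonally, $K_\theta=K_\alpha\oplus\alpha K_{\frac{\theta}{\alpha}}=K_{\frac{\theta}{\alpha}}\oplus\frac{\theta}{\alpha}K_\alpha$. For $\varphi\in L^2$, $A^{\theta,\alpha}_\varphi f=P_\alpha(\varphi f)$ on $\{f\in K_\theta:\varphi f\in L^2\}\supset K_\theta^\infty$; $A^{\theta,\alpha}_\varphi\in\mathcal{T}(\theta,\alpha)$ means that this operator is bounded, and then $A^{\theta,\alpha}_\varphi$ denotes its bounded extension $K_\theta\to K_\alpha$; in this case $(A^{\theta,\alpha}_\varphi)^*=A^{\alpha,\theta}_{\overline{\varphi}}\in\mathcal{T}(\alpha,\theta)$. $C_\theta f=\theta\bar z\bar f$ for $f\in L^2$; this is a conjugation preserving $K_\theta$. $C_{\alpha,\frac{\theta}{\alpha}}$ is the conjugation on $K_\theta$ given by $C_{\alpha,\frac{\theta}{\alpha}}(f_1+\alpha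 f_2)=C_\alpha f_1+\alpha C_{\frac{\theta}{\alpha}}f_2$, $f_1\in K_\alpha$, $f_2\in K_{\frac{\theta}{\alpha}}$. For $\varphi\in L^2$ the Hankel operator $H_\varphi$ is $H_\varphi f=P^-(\varphi f)\in\overline{H^2_0}$ for $f\in H^2$ with $\varphi f\in L^2$; for $\theta\in L^\infty$, $\widetilde{H}_\theta\colon\overline{H^2_0}\to H^2$, $\widetilde{H}_\theta f=P(\theta f)$. Function symbols such as $\overline{\alpha}$, $\alpha$, $\frac{\theta}{\alpha}$, $\frac{\overline{\theta}}{\overline{\alpha}}$ in operator products denote multiplication operators. Since $\varphi$ may be unbounded, the equalities are understood on a dense subspace of $K_\theta$ on which the Hankel expressions are defined ($K_\alpha^\infty+\alpha K_{\frac{\theta}{\alpha}}^\infty$ for (1) and (2), $K_{\frac{\theta}{\alpha}}^\infty+\frac{\theta}{\alpha}K_\alpha^\infty$ for (3)), the right-hand sides then being extended by continuity to $K_\theta$. *)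

(* Defs.v *)
From HB Require Import structures.
From mathcomp Require Import all_boot all_order all_algebra.
From mathcomp Require Import all_classical all_reals all_analysis.
From mathcomp Require Import measurable_realfun.
From mathcomp Require Export complex.

Set Implicit Arguments.
Unset Strict Implicit.
Unset Printing Implicit Defensive.

Import Order.TTheory GRing.Theory Num.Theory.
Import numFieldNormedType.Exports.

Local Open Scope classical_set_scope.
Local Open Scope ring_scope.
Local Open Scope complex_scope.

Section Circle.
Context {R : realType}.

Definition circle : Type := {z : R[i] | `|z| == 1}.

Fact circle1_subproof : `|1 : R[i]| == 1.
Proof. by rewrite normr1. Qed.

HB.instance Definition _ := Choice.on circle.
HB.instance Definition _ :=
  isPointed.Build circle (exist _ 1 circle1_subproof).

Definition circle_coord (w : circle) : R * R :=
  (complex.Re (val w), complex.Im (val w)).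

(* The sigma-algebra of the circle is the trace of the Borel sigma-algebra of
   R * R. *)
HB.instance Definition _ :=
  Measurable.copy circle (g_sigma_algebra_preimageType circle_coord).

Fact expi_subproof (t : R) : `|cos t +i* sin t| == 1.
Proof. by rewrite normc_def cos2Dsin2 sqrtr1. Qed.

Definition expi (t : measurableTypeR R) : circle :=
  exist _ (cos t +i* sin t) (expi_subproof t).

Fact measurable_expi : measurable_fun [set: measurableTypeR R] expi.
Proof.
move=> _ _ [B mB <-]; rewrite setTI.
have mcs : measurable_fun [set: R] (fun t : R => (cos t, sin t)).
  apply: measurable_fun_pair; apply: continuous_measurable_fun.
    exact: continuous_cos.
  exact: continuous_sin.
exact: mcs.
Qed.

HB.instance Definition _ :=
  isMeasurableFun.Build _ _ _ _ expi measurable_expi.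

Fact twopi_gt0 : 0 < 2 * pi :> R.
Proof. by rewrite mulr_gt0// pi_gt0. Qed.

Definition circle_measure := distribution (uniform_prob twopi_gt0) expi.

HB.instance Definition _ := Probability.on circle_measure.

End Circle.
Arguments circle R : clear implicits.
Arguments circle_measure R : clear implicits.

Section LebesgueSpaces.
Context {R : realType}.
Local Notation m := (circle_measure R).
Local Notation cfun := (circle R -> R[i]).
Implicit Types (f g h : cfun) (S D : set cfun) (T : cfun -> cfun) (p : \bar R).

Definition cconj f : cfun := fun w => (f w)^*.

Definition quot f g : cfun := fun w => f w / g w.

Definition cLnorm p f : \bar R :=
  ('N[m]_p[EFin \o (@Normc.normc R \o f)])%E.

(* Elements of L^p are represented by functions; two of them are the same
   element when they are equal almost everywhere. *)
Definition Lp p : set cfun :=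
  [set f : cfun |
    [/\ measurable_fun [set: circle R] (@complex.Re R \o f),
        measurable_fun [set: circle R] (@complex.Im R \o f) &
        (cLnorm p f < +oo)%E]].

Definition L2 : set cfun := Lp 2%:E.
Definition Linfty : set cfun := Lp +oo%E.

Definition L2dist f g : \bar R := cLnorm 2%:E (f \- g).

Definition cintegral f : R[i] :=
  (\int[m]_w complex.Re (f w)) +i* (\int[m]_w complex.Im (f w)).

Definition inner f g : R[i] := cintegral (f \* cconj g).

Definition is_orth_proj S f g : Prop :=
  [/\ L2 f, S g & forall h, S h -> inner (f \- g) h = 0].

(* A representative of the orthogonal projection of f onto S (the zero function
   when f is not in L^2). *)
Definition proj S f : cfun := xget (cst 0) [set g : cfun | is_orth_proj S f g].

(* g is the value at f of the extension by continuity of T from D to the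
   L^2-closure of D. *)
Definition is_cont_ext D T f g : Prop :=
  [/\ L2 f, L2 g,
      forall e : R, 0 < e ->
        exists2 h, D h & (L2dist h f < e%:E)%E &
      forall e : R, 0 < e -> exists2 d : R, 0 < d & forall h, D h ->
        (L2dist h f < d%:E)%E ->
        (L2dist (T h) g < e%:E)%E].

(* T1 = T2 almost everywhere on D, and T1 f is, for every f in K, the value at f
   of the extension by continuity of the restriction of T2 to D. *)
Definition eq_cont_ext (K D : set cfun) (T1 T2 : cfun -> cfun) : Prop :=
  (forall f, D f -> T1 f = T2 f %[ae m]) /\
  (forall f, K f -> is_cont_ext D T2 f (T1 f)).

End LebesgueSpaces.

Section HardySpaces.
Context {R : realType}.
Local Notation m := (circle_measure R).
Local Notation cfun := (circle R -> R[i]).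
Implicit Types (f g h alpha beta theta phi : cfun).

Definition zpow (n : int) : cfun := fun w => val w ^ n.

(* The boundary functions of the Hardy space of the disc: the functions in L^2
   whose Fourier coefficients of negative index vanish. *)
Definition H2 : set cfun :=
  [set f : cfun | L2 f /\ forall n : int, n < 0 -> inner f (zpow n) = 0].

Definition Hinfty : set cfun := H2 `&` Linfty.

Definition H2perp : set cfun :=
  [set f : cfun | L2 f /\ forall h, H2 h -> inner f h = 0].

Definition Pplus : cfun -> cfun := proj H2.
Definition Pminus : cfun -> cfun := proj H2perp.

Definition inner_function theta : Prop :=
  Hinfty theta /\ \forall w \ae m, `|theta w| = 1.

Definition nonconstant f : Prop := ~ exists c : R[i], f = cst c %[ae m].

Definition inner_le alpha theta : Prop := inner_function (quot theta alpha).

Definition model_space theta : set cfun :=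
  [set f : cfun | H2 f /\ forall h, H2 h -> inner f (theta \* h) = 0].

Definition model_space_infty theta : set cfun :=
  model_space theta `&` Hinfty.

Definition Pmodel theta : cfun -> cfun := proj (model_space theta).

(* The subspace K_alpha^infty + alpha K_beta^infty of K_(alpha beta). *)
Definition model_sum_infty alpha beta : set cfun :=
  [set f : cfun | L2 f /\ exists f1 f2,
    [/\ model_space_infty alpha f1, model_space_infty beta f2 &
        f = f1 \+ alpha \* f2 %[ae m]]].

Definition conjugation theta f : cfun :=
  fun w => theta w * (val w)^* * (f w)^*.

(* C_(alpha,beta) on K_(alpha beta) = K_alpha + alpha K_beta; the components
   (f1, f2) of f are unique up to equality almost everywhere. *)
Definition conjugation2 alpha beta f : cfun :=
  let f12 := xget (cst 0, cst 0)
    [set u : cfun * cfun | [/\ model_space alpha u.1, model_space beta u.2 &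
                               f = u.1 \+ alpha \* u.2 %[ae m]]] in
  conjugation alpha f12.1 \+ alpha \* conjugation beta f12.2.

Definition tto_dom theta phi : set cfun :=
  [set f : cfun | model_space theta f /\ L2 (phi \* f)].

Definition tto_pre alpha phi f : cfun := Pmodel alpha (phi \* f).

(* The operator A^(theta,alpha)_phi belongs to T(theta,alpha). *)
Definition tto_bounded theta alpha phi : Prop :=
  exists c : R, forall f, tto_dom theta phi f ->
    (cLnorm 2%:E (tto_pre alpha phi f) <= c%:E * cLnorm 2%:E f)%E.

(* The bounded extension of A^(theta,alpha)_phi to K_theta. *)
Definition tto theta alpha phi f : cfun :=
  xget (cst 0) [set g : cfun | model_space alpha g /\
    is_cont_ext (tto_dom theta phi) (tto_pre alpha phi) f g].

Definition hankel_dom phi : set cfun := [set f : cfun | H2 f /\ L2 (phi \* f)].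

Definition hankel phi f : cfun := Pminus (phi \* f).

Definition hankelt theta f : cfun := Pplus (theta \* f).

End HardySpaces.

(* Main.v *)
(** Everything rests on orthogonality in the Hilbert space L^2, complete by Riesz-Fischer.

    - Fourier uniqueness: the bounded real functions u such that multiplication by u
      preserves the functions with vanishing Fourier coefficients form an algebra
      closed under bounded pointwise limits.  It contains Re z and Im z, hence, by
      polynomial approximation of step functions, all indicators of measurable sets.
    - Consequently conj(z H^2) is orthogonal to H^2, so that C_theta preserves K_theta
      and commutes with P_theta; and K_theta^infty, which contains the backward shifts
      of theta, is dense in K_theta.
    - The Hankel products are projections: P(a P^-(h)) = P_a(a h), because
      h - P^-(h) lies in H^2.  Together with P_theta g = P_a g + a P_b(conj(a) g) for
      theta = a b, each equality becomes a linear identity between projections of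
      phi C_a f1 and phi C_b f2, where f1 and f2 are the components of f.
    - Both sides extend by continuity since A_phi and its adjoint are bounded. *)
Require Import Defs.
From mathcomp Require Import all_boot all_order all_algebra.
From mathcomp Require Import all_classical all_reals all_analysis.
From mathcomp Require Import measurable_realfun ess_sup_inf zify ring lra.

Set Implicit Arguments.
Unset Strict Implicit.
Unset Printing Implicit Defensive.

Import Order.TTheory GRing.Theory Num.Theory.
Import numFieldNormedType.Exports.

Local Open Scope classical_set_scope.
Local Open Scope ring_scope.
Local Open Scope complex_scope.

#[local] Arguments inner {R} f g : simpl never.
#[local] Arguments cLnorm {R} p f : simpl never.
#[local] Arguments conjc {R} x : simpl never.
#[local] Arguments cintegral {R} f : simpl never.

(** * Square integrable complex functions on the circle *)

Section ComplexValued.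
Context {R : realType}.
Local Notation m := (circle_measure R).
Local Notation cfun := (circle R -> R[i]).
Local Notation Re := (@complex.Re R).
Local Notation Im := (@complex.Im R).
Implicit Types (f g h u : cfun) (z : R[i]).

(** [H2] is defined only by the vanishing of its negative Fourier coefficients. Hence even the
    description of its orthogonal complement by coefficients, or its stability under multiplication
    by $H^\infty$, rests on the completeness of the trigonometric system; this is why uniqueness of
    Fourier coefficients comes before any Hardy space theory. The other obstacle is that [phi] may
    be unbounded: $\varphi f$ is certainly in $L^2$ only for bounded $f$. The identities are
    therefore proved for functions with bounded components, and duality is always tested on bounded
    functions. The right-hand sides need no estimate of their own: on a dense set they agree with
    the left-hand sides, which are Lipschitz on the whole model space. Elements of $L^2$ are
    functions and projections are chosen representatives, so identities hold almost everywhere; yet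
    functions equal almost everywhere have literally the same chosen projection, which permits
    rewriting inside projections. *)

Definition cmeas f : Prop :=
  measurable_fun [set: circle R] (Re \o f) /\
  measurable_fun [set: circle R] (Im \o f).

Definition cintegrable f : Prop :=
  m.-integrable setT (EFin \o (Re \o f)) /\
  m.-integrable setT (EFin \o (Im \o f)).

(** The squared modulus as an element of [R]: the norm of [R[i]] takes its values in [R[i]], and
    without square roots the pointwise estimates stay polynomial. *)
Definition sqn z : R := Re z ^+ 2 + Im z ^+ 2.

Lemma cReD (x y : R[i]) : Re (x + y) = Re x + Re y. Proof. by case: x; case: y. Qed.
Lemma cImD (x y : R[i]) : Im (x + y) = Im x + Im y. Proof. by case: x; case: y. Qed.
Lemma cReN (x : R[i]) : Re (- x) = - Re x. Proof. by case: x. Qed.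
Lemma cImN (x : R[i]) : Im (- x) = - Im x. Proof. by case: x. Qed.
Lemma cReM (x y : R[i]) : Re (x * y) = Re x * Re y - Im x * Im y.
Proof. by case: x; case: y. Qed.
Lemma cImM (x y : R[i]) : Im (x * y) = Re x * Im y + Im x * Re y.
Proof. by case: x; case: y. Qed.
Lemma cReJ (x : R[i]) : Re (conjc x) = Re x. Proof. by case: x. Qed.
Lemma cImJ (x : R[i]) : Im (conjc x) = - Im x. Proof. by case: x. Qed.
Lemma complex_inj z1 z2 : Re z1 = Re z2 -> Im z1 = Im z2 -> z1 = z2.
Proof. by case: z1; case: z2 => /= ? ? ? ? -> ->. Qed.

Lemma cmeas_cst (c : R[i]) : cmeas (cst c).
Proof. by split; exact: measurable_cst. Qed.

Lemma cmeasD f g : cmeas f -> cmeas g -> cmeas (f \+ g).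
Proof.
move=> [f1 f2] [g1 g2]; split.
  rewrite (_ : _ \o _ = (Re \o f) \+ (Re \o g)); first exact: measurable_funD.
  by apply/funext => w /=; rewrite cReD.
rewrite (_ : _ \o _ = (Im \o f) \+ (Im \o g)); first exact: measurable_funD.
by apply/funext => w /=; rewrite cImD.
Qed.

Lemma cmeasM f g : cmeas f -> cmeas g -> cmeas (f \* g).
Proof.
move=> [f1 f2] [g1 g2]; split.
  rewrite (_ : _ \o _ = ((Re \o f) \* (Re \o g)) \- ((Im \o f) \* (Im \o g))).
    by apply: measurable_funB; exact: measurable_funM.
  by apply/funext => w /=; rewrite cReM.
rewrite (_ : _ \o _ = ((Re \o f) \* (Im \o g)) \+ ((Im \o f) \* (Re \o g))).
  by apply: measurable_funD; exact: measurable_funM.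
by apply/funext => w /=; rewrite cImM.
Qed.

Lemma cmeasB f g : cmeas f -> cmeas g -> cmeas (f \- g).
Proof.
move=> mf mg; rewrite (_ : f \- g = f \+ (cst (-1) \* g)).
  by apply: cmeasD => //; apply: cmeasM => //; exact: cmeas_cst.
by apply/funext => w /=; rewrite mulN1r.
Qed.

Lemma cmeas_conj f : cmeas f -> cmeas (cconj f).
Proof.
move=> [f1 f2]; split.
  by rewrite (_ : _ \o _ = Re \o f)//; apply/funext => w /=; rewrite cReJ.
rewrite (_ : _ \o _ = \- (Im \o f)); first exact: measurable_funN.
by apply/funext => w /=; rewrite cImJ.
Qed.

Lemma measurable_sqn f : cmeas f -> measurable_fun setT (sqn \o f).
Proof.
move=> [f1 f2]; rewrite (_ : _ \o _ = (fun w => (Re \o f) w ^+ 2 + (Im \o f) w ^+ 2)) //.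
by apply: measurable_funD; exact: measurable_funX.
Qed.

Lemma sqn_ge0 z : 0 <= sqn z. Proof. by rewrite addr_ge0 ?sqr_ge0. Qed.

Lemma sqnM z1 z2 : sqn (z1 * z2) = sqn z1 * sqn z2.
Proof. by rewrite /sqn cReM cImM; ring. Qed.

Lemma sqnJ z : sqn (conjc z) = sqn z.
Proof. by rewrite /sqn cReJ cImJ sqrrN. Qed.

Lemma sqn_eq0 z : sqn z = 0 -> z = 0.
Proof.
move=> /eqP; rewrite paddr_eq0 ?sqr_ge0// !sqrf_eq0 => /andP[/eqP a /eqP b].
exact: complex_inj.
Qed.

Lemma normc_sqn z : Normc.normc z = Num.sqrt (sqn z).
Proof. by case: z. Qed.

Lemma integrable_real_bound (f : circle R -> R) (g : circle R -> R) :
  measurable_fun setT f -> (forall w, `|f w| <= g w) ->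
  m.-integrable setT (EFin \o g) -> m.-integrable setT (EFin \o f).
Proof.
move=> mf fg ig; apply: le_integrable ig => //; first exact/measurable_EFinP.
by move=> w _ /=; rewrite lee_fin (le_trans (fg w))// ler_norm.
Qed.

(** The exponent 1/2 in the norm preserves finiteness and infinity, so only the integral of the
    squared modulus decides. *)
Lemma L2P f : L2 f <-> cmeas f /\ m.-integrable setT (EFin \o (sqn \o f)).
Proof.
have H : cLnorm 2%:E f = ((\int[m]_w (sqn (f w))%:E) `^ (2^-1))%E.
  rewrite /cLnorm Lnorm.unlock; congr (_ `^ _)%E; apply: eq_integral => w _ /=.
  by rewrite normc_sqn ger0_norm ?sqrtr_ge0// powR_mulrn ?sqrtr_ge0//
    sqr_sqrtr ?sqn_ge0.
split.
  move=> [f1 f2]; rewrite H => f3; split => //.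
  apply/integrableP; split.
    by apply/measurable_EFinP; exact: measurable_sqn.
  under eq_integral do rewrite /= ger0_norm ?sqn_ge0//.
  rewrite ltey; apply: contraPneq f3 => ->.
  by rewrite poweRyr ?invr_eq0 ?pnatr_eq0// ltxx.
move=> [[f1 f2] /integrableP[_ f3]]; split => //; rewrite H.
apply: poweR_lty; apply: le_lt_trans f3.
by under eq_integral do rewrite -[sqn _]ger0_norm ?sqn_ge0//.
Qed.

End ComplexValued.

Section SquareIntegrable.
Context {R : realType}.
Local Notation m := (circle_measure R).
Local Notation cfun := (circle R -> R[i]).
Local Notation Re := (@complex.Re R).
Local Notation Im := (@complex.Im R).
Implicit Types (f g h u : cfun) (z : R[i]).

Lemma aeqP f g : (f = g %[ae m]) <-> \forall w \ae m, f w = g w.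
Proof. by split; apply: filterS => w //; apply. Qed.

Lemma circle_setT : m [set: circle R] = 1%E.
Proof. exact: probability_setT. Qed.

Lemma circle_setT_gt0 : (0 < m [set: circle R])%E.
Proof. by rewrite probability_setT. Qed.

Lemma L2_cmeas f : L2 f -> cmeas f. Proof. by move/L2P => []. Qed.

Lemma L2_le f (g : circle R -> R) : cmeas f ->
  (\forall w \ae m, sqn (f w) <= g w) -> m.-integrable setT (EFin \o g) -> L2 f.
Proof.
move=> mf fg ig; apply/L2P; split => //.
have mg := measurable_int _ ig.
apply/integrableP; split.
  by apply/measurable_EFinP; exact: measurable_sqn.
move/integrableP : (ig) => [_]; apply: le_lt_trans.
apply: ae_ge0_le_integral => //=.
- by apply/measurable_EFinP; apply: measurableT_comp => //; exact: measurable_sqn.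
- by apply/measurable_EFinP; apply: measurableT_comp => //; exact/measurable_EFinP.
- apply: filterS fg => w fgw _; rewrite lee_fin ger0_norm ?sqn_ge0//.
  by rewrite (le_trans fgw)// ler_norm.
Qed.

Lemma integrable_realZ (r : R) (g : circle R -> R) :
  m.-integrable setT (EFin \o g) -> m.-integrable setT (EFin \o (fun w => r * g w)).
Proof.
by move=> ig; apply: eq_integrable (integrableZl _ r ig) => // w _ /=; rewrite EFinM.
Qed.

Lemma integrable_realD (g1 g2 : circle R -> R) :
  m.-integrable setT (EFin \o g1) -> m.-integrable setT (EFin \o g2) ->
  m.-integrable setT (EFin \o (fun w => g1 w + g2 w)).
Proof.
by move=> i1 i2; apply: eq_integrable (integrableD _ i1 i2) => // w _ /=; rewrite EFinD.
Qed.

Lemma L2D f g : L2 f -> L2 g -> L2 (f \+ g).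
Proof.
move=> /L2P[mf If] /L2P[mg Ig].
apply: (@L2_le _ (fun w => 2 * (sqn (f w) + sqn (g w)))).
- exact: cmeasD.
- apply: aeW => w /=; rewrite /sqn cReD cImD.
  have := sqr_ge0 (Re (f w) - Re (g w)); have := sqr_ge0 (Im (f w) - Im (g w)).
  nra.
- by apply: integrable_realZ; exact: integrable_realD.
Qed.

Lemma LinftyP u : Linfty u <->
  cmeas u /\ exists2 c : R, 0 <= c & \forall w \ae m, sqn (u w) <= c.
Proof.
have H : cLnorm +oo%E u = ess_sup m (EFin \o (Num.sqrt \o (@sqn R \o u))).
  (* At exponent [+oo] the norm is an essential supremum only on a space of positive measure. *)
  rewrite /cLnorm Lnorm.unlock circle_setT_gt0; apply: eq_ess_sup; apply: aeW => w /=.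
  by rewrite normc_sqn ger0_norm ?sqrtr_ge0.
split.
  move=> [u1 u2]; rewrite H => u3; split => //.
  have := ess_sup_ge m (EFin \o (Num.sqrt \o (@sqn R \o u))).
  move: u3; set e := ess_sup _ _; move=> elty He.
  exists ((fine e) ^+ 2); first exact: sqr_ge0.
  apply: filterS He => w /= uw.
  have efin : e \is a fin_num.
    rewrite ge0_fin_numE// (le_trans _ uw)// lee_fin; exact: sqrtr_ge0.
  move: uw; rewrite -(fineK efin) lee_fin => uw.
  by rewrite -[leLHS]sqr_sqrtr ?sqn_ge0// lerXn2r ?nnegrE ?(le_trans _ uw)// sqrtr_ge0.
move=> [[u1 u2] [c c0 uc]]; split => //; rewrite H.
apply: (@le_lt_trans _ _ (Num.sqrt c)%:E); last exact: ltry.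
by apply/ess_supP; apply: filterS uc => w uw /=; rewrite lee_fin ler_wsqrtr.
Qed.

Lemma Linfty_cmeas u : Linfty u -> cmeas u. Proof. by move/LinftyP => []. Qed.

Lemma LinftyM u v : Linfty u -> Linfty v -> Linfty (u \* v).
Proof.
move=> /LinftyP[mu [c c0 uc]] /LinftyP[mv [d d0 vd]]; apply/LinftyP; split.
  exact: cmeasM.
exists (c * d); first exact: mulr_ge0.
apply: filterS2 uc vd => w uw vw /=.
by rewrite sqnM ler_pM ?sqn_ge0.
Qed.

Lemma LinftyD u v : Linfty u -> Linfty v -> Linfty (u \+ v).
Proof.
move=> /LinftyP[mu [c c0 uc]] /LinftyP[mv [d d0 vd]]; apply/LinftyP; split.
  exact: cmeasD.
exists (2 * (c + d)); first by rewrite mulr_ge0// addr_ge0.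
apply: filterS2 uc vd => w; rewrite /sqn /= cReD cImD => uw vw.
have := sqr_ge0 (Re (u w) - Re (v w)); have := sqr_ge0 (Im (u w) - Im (v w)).
nra.
Qed.

Lemma Linfty_cst (c : R[i]) : Linfty (cst c : cfun).
Proof.
apply/LinftyP; split; first exact: cmeas_cst.
by exists (sqn c); [exact: sqn_ge0|apply: aeW].
Qed.

Lemma Linfty_conj u : Linfty u -> Linfty (cconj u).
Proof.
move=> /LinftyP[mu [c c0 uc]]; apply/LinftyP; split; first exact: cmeas_conj.
by exists c => //; apply: filterS uc => w; rewrite /cconj sqnJ.
Qed.

Lemma Linfty_ae u v : cmeas v -> u = v %[ae m] -> Linfty u -> Linfty v.
Proof.
move=> mv /aeqP uv /LinftyP[mu [c c0 uc]]; apply/LinftyP; split=> //.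
by exists c => //; apply: filterS2 uc uv => w uw <-.
Qed.

Lemma L2M u f : Linfty u -> L2 f -> L2 (u \* f).
Proof.
move=> /LinftyP[mu [c c0 uc]] /L2P[mf If].
apply: (@L2_le _ (fun w => c * sqn (f w))); first exact: cmeasM.
  by apply: filterS uc => w uw /=; rewrite sqnM ler_wpM2r ?sqn_ge0.
exact: integrable_realZ.
Qed.

Lemma L2Z (c : R[i]) f : L2 f -> L2 (cst c \* f).
Proof. by apply: L2M; exact: Linfty_cst. Qed.

Lemma L2_conj f : L2 f -> L2 (cconj f).
Proof.
move=> /L2P[mf If]; apply: L2_le If; first exact: cmeas_conj.
by apply: aeW => w /=; rewrite /cconj sqnJ.
Qed.

Lemma Linfty_L2 u : Linfty u -> L2 u.
Proof.
move=> /LinftyP[mu [c c0 uc]]; apply: (@L2_le _ (cst c)) => //.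
exact: finite_measure_integrable_cst.
Qed.

Lemma L2_cst (c : R[i]) : L2 (cst c : cfun).
Proof. exact/Linfty_L2/Linfty_cst. Qed.

Lemma L2B f g : L2 f -> L2 g -> L2 (f \- g).
Proof.
move=> Lf Lg; rewrite (_ : f \- g = f \+ (cst (-1) \* g)).
  by apply: L2D => //; exact: L2Z.
by apply/funext => w /=; rewrite mulN1r.
Qed.

Lemma L2_cintegrableM f g : L2 f -> L2 g -> cintegrable (f \* g).
Proof.
move=> /L2P[mf If] /L2P[mg Ig]; have [m1 m2] := cmeasM mf mg.
have I : m.-integrable setT (EFin \o (fun w => sqn (f w) + sqn (g w))).
  exact: integrable_realD.
split; apply: integrable_real_bound I => // w /=.
  rewrite ler_norml /sqn cReM; move: (Re (f w)) (Im (f w)) (Re (g w)) (Im (g w)).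
  move=> a b c d; have := sqr_ge0 (a - c); have := sqr_ge0 (a + c).
  have := sqr_ge0 (b - d); have := sqr_ge0 (b + d).
  have := sqr_ge0 a; have := sqr_ge0 b; have := sqr_ge0 c; have := sqr_ge0 d.
  by move=> *; apply/andP; split; nra.
rewrite ler_norml /sqn cImM; move: (Re (f w)) (Im (f w)) (Re (g w)) (Im (g w)).
move=> a b c d; have := sqr_ge0 (a - d); have := sqr_ge0 (a + d).
have := sqr_ge0 (b - c); have := sqr_ge0 (b + c).
have := sqr_ge0 a; have := sqr_ge0 b; have := sqr_ge0 c; have := sqr_ge0 d.
by move=> *; apply/andP; split; nra.
Qed.

Lemma L2_cintegrable f : L2 f -> cintegrable f.
Proof.
move=> Lf; rewrite (_ : f = f \* cst 1); first exact/L2_cintegrableM/L2_cst.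
by apply/funext => w /=; rewrite mulr1.
Qed.

Lemma cintegralD f g : cintegrable f -> cintegrable g ->
  cintegral (f \+ g) = cintegral f + cintegral g.
Proof.
move=> [f1 f2] [g1 g2]; apply: complex_inj; rewrite ?cReD ?cImD /=.
  by rewrite -RintegralD//; apply: eq_Rintegral => w _; rewrite cReD.
by rewrite -RintegralD//; apply: eq_Rintegral => w _; rewrite cImD.
Qed.

Lemma cintegralZ (c : R[i]) f : cintegrable f ->
  cintegral (cst c \* f) = c * cintegral f.
Proof.
move=> [f1 f2].
have If (r : R) : m.-integrable setT (EFin \o (fun w => r * Re (f w))).
  exact: integrable_realZ.
have Ig (r : R) : m.-integrable setT (EFin \o (fun w => r * Im (f w))).
  exact: integrable_realZ.
apply: complex_inj; rewrite ?cReM ?cImM /=; rewrite -!RintegralZl//.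
  by rewrite -RintegralB//; apply: eq_Rintegral => w _; rewrite cReM.
by rewrite -RintegralD//; apply: eq_Rintegral => w _; rewrite cImM.
Qed.

Lemma cintegral_conj f : cintegrable f -> cintegral (cconj f) = conjc (cintegral f).
Proof.
move=> [f1 f2]; apply: complex_inj; rewrite ?cReJ ?cImJ /=.
  by apply: eq_Rintegral => w _; rewrite cReJ.
rewrite -[RHS]mulN1r -RintegralZl//.
by apply: eq_Rintegral => w _; rewrite cImJ mulN1r.
Qed.

Lemma cintegral_ae f g : cmeas f -> cmeas g -> f = g %[ae m] ->
  cintegral f = cintegral g.
Proof.
move=> [f1 f2] [g1 g2] fg.
by apply: complex_inj => /=; congr fine; apply: ae_eq_integral => //;
  do ?[exact/measurable_EFinP]; apply: filterS fg => w /[apply] ->.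
Qed.

Lemma inner_ae f f' g g' : L2 f -> L2 f' -> L2 g -> L2 g' ->
  f = f' %[ae m] -> g = g' %[ae m] -> inner f g = inner f' g'.
Proof.
move=> /L2_cmeas mf /L2_cmeas mf' /L2_cmeas mg /L2_cmeas mg' ff' gg'.
apply: cintegral_ae; do ?[by apply: cmeasM => //; exact: cmeas_conj].
by apply: filterS2 ff' gg' => w + + I; rewrite /cconj /= => -> // ->.
Qed.

Lemma inner_ael f f' g : L2 f -> L2 f' -> L2 g -> f = f' %[ae m] ->
  inner f g = inner f' g.
Proof. by move=> Lf Lf' Lg ff'; apply: inner_ae => //; exact: ae_eq_refl. Qed.

Lemma inner_aer f g g' : L2 f -> L2 g -> L2 g' -> g = g' %[ae m] ->
  inner f g = inner f g'.
Proof. by move=> Lf Lg Lg' gg'; apply: inner_ae => //; exact: ae_eq_refl. Qed.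

Lemma innerDl f g h : L2 f -> L2 g -> L2 h ->
  inner (f \+ g) h = inner f h + inner g h.
Proof.
move=> Lf Lg Lh; rewrite /inner -cintegralD; last 2 first.
- exact/L2_cintegrableM/L2_conj.
- exact/L2_cintegrableM/L2_conj.
by congr cintegral; apply/funext => w /=; rewrite mulrDl.
Qed.

Lemma innerZl (c : R[i]) f h : L2 f -> L2 h ->
  inner (cst c \* f) h = c * inner f h.
Proof.
move=> Lf Lh; rewrite /inner -cintegralZ; last exact/L2_cintegrableM/L2_conj.
by congr cintegral; apply/funext => w /=; rewrite mulrA.
Qed.

Lemma innerBl f g h : L2 f -> L2 g -> L2 h ->
  inner (f \- g) h = inner f h - inner g h.
Proof.
move=> Lf Lg Lh; rewrite (_ : f \- g = f \+ (cst (-1) \* g)).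
  by rewrite innerDl ?innerZl ?mulN1r//; exact: L2Z.
by apply/funext => w /=; rewrite mulN1r.
Qed.

Lemma inner_conj f g : L2 f -> L2 g -> inner f g = conjc (inner g f).
Proof.
move=> Lf Lg; rewrite /inner -cintegral_conj; last exact/L2_cintegrableM/L2_conj.
by congr cintegral; apply/funext => w; rewrite /cconj /= rmorphM /= conjcK mulrC.
Qed.

Lemma innerDr f g h : L2 f -> L2 g -> L2 h ->
  inner h (f \+ g) = inner h f + inner h g.
Proof.
move=> Lf Lg Lh; rewrite inner_conj//; last exact: L2D.
by rewrite innerDl// rmorphD/= -!inner_conj.
Qed.

Lemma innerBr f g h : L2 f -> L2 g -> L2 h ->
  inner h (f \- g) = inner h f - inner h g.
Proof.
move=> Lf Lg Lh; rewrite inner_conj//; last exact: L2B.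
by rewrite innerBl// rmorphB/= -!inner_conj.
Qed.

Lemma innerZr (c : R[i]) f h : L2 f -> L2 h ->
  inner h (cst c \* f) = conjc c * inner h f.
Proof.
move=> Lf Lh; rewrite inner_conj//; last exact: L2Z.
by rewrite innerZl// rmorphM/= -inner_conj.
Qed.

Lemma innerMl u f g : inner (u \* f) g = inner f (cconj u \* g).
Proof.
congr cintegral; apply/funext => w; rewrite /cconj /= rmorphM /= conjcK.
by rewrite mulrCA mulrA.
Qed.

Lemma innerMr u f g : inner f (u \* g) = inner (cconj u \* f) g.
Proof. by rewrite innerMl; congr inner; apply/funext => w; rewrite /cconj /= conjcK. Qed.

Lemma inner_cconj f g : inner (cconj f) (cconj g) = inner g f.
Proof.
by congr cintegral; apply/funext => w; rewrite /cconj /= conjcK mulrC.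
Qed.

End SquareIntegrable.

(** * The norm of $L^2$ and the Cauchy-Schwarz inequality *)

Section L2Norm.
Context {R : realType}.
Local Notation m := (circle_measure R).
Local Notation cfun := (circle R -> R[i]).
Local Notation Re := (@complex.Re R).
Local Notation Im := (@complex.Im R).
Implicit Types (f g h u : cfun) (z : R[i]).

Definition nsq f : R := Re (inner f f).
Definition nrm f : R := Num.sqrt (nsq f).

Lemma conjcR (x : R) : conjc x%:C = x%:C.
Proof. by apply: complex_inj; rewrite ?cReJ ?cImJ //= oppr0. Qed.

Lemma mulcJ z : z * conjc z = (sqn z)%:C.
Proof.
apply: complex_inj; rewrite ?cReM ?cImM cReJ cImJ /sqn /=; ring.
Qed.

Lemma inner_diag f : inner f f = (\int[m]_w sqn (f w))%:C.
Proof.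
rewrite /inner /cintegral; apply: complex_inj => /=.
  by apply: eq_Rintegral => w _; rewrite /cconj mulcJ.
rewrite (@eq_Rintegral _ _ _ _ _ (cst 0)) ?Rintegral_cst ?mul0r// => w _.
by rewrite /cconj mulcJ.
Qed.

Lemma nsqE f : nsq f = \int[m]_w sqn (f w).
Proof. by rewrite /nsq inner_diag. Qed.

Lemma innerff f : inner f f = (nsq f)%:C.
Proof. by rewrite nsqE inner_diag. Qed.

Lemma nsq_ge0 f : 0 <= nsq f.
Proof. by rewrite nsqE; apply: Rintegral_ge0 => w _; exact: sqn_ge0. Qed.

Lemma nrm_ge0 f : 0 <= nrm f. Proof. exact: sqrtr_ge0. Qed.

Lemma nrm_sqr f : nrm f ^+ 2 = nsq f.
Proof. by rewrite sqr_sqrtr// nsq_ge0. Qed.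

Lemma integral_sqn f : L2 f -> (\int[m]_w (sqn (f w))%:E = (nsq f)%:E)%E.
Proof.
by move=> /L2P[_ If]; rewrite nsqE /Rintegral fineK//; exact: integrable_fin_num If.
Qed.

Lemma cLnorm2 f : L2 f -> cLnorm 2%:E f = (nrm f)%:E.
Proof.
move=> Lf.
have -> : cLnorm 2%:E f = ((\int[m]_w (sqn (f w))%:E) `^ (2^-1))%E.
  rewrite /cLnorm Lnorm.unlock; congr (_ `^ _)%E; apply: eq_integral => w _ /=.
  by rewrite normc_sqn ger0_norm ?sqrtr_ge0// powR_mulrn ?sqrtr_ge0//
    sqr_sqrtr ?sqn_ge0.
by rewrite integral_sqn// poweR_EFin powR12_sqrt// nsq_ge0.
Qed.

Lemma nsq_eq0 f : L2 f -> nsq f = 0 -> f = cst 0 %[ae m].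
Proof.
move=> Lf f0; have [mf _] := (L2P f).1 Lf.
have : (\int[m]_w `|(sqn (f w))%:E| = 0)%E.
  by under eq_integral do rewrite abse_EFin ger0_norm ?sqn_ge0//; rewrite integral_sqn// f0.
move/(ae_eq_integral_abs _ measurableT) => H; apply: filterS (H _) => //=.
  by move=> w /[apply] -[] /sqn_eq0.
by apply/measurable_EFinP; exact: measurable_sqn.
Qed.

Lemma nrm_eq0 f : L2 f -> nrm f = 0 -> f = cst 0 %[ae m].
Proof.
by move=> Lf f0; apply: nsq_eq0 => //; rewrite -nrm_sqr f0 expr0n.
Qed.

Lemma nsq_ae f g : L2 f -> L2 g -> f = g %[ae m] -> nsq f = nsq g.
Proof. by move=> Lf Lg fg; congr Re; apply: inner_ae. Qed.

Lemma nrm_ae f g : L2 f -> L2 g -> f = g %[ae m] -> nrm f = nrm g.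
Proof. by move=> Lf Lg fg; congr Num.sqrt; exact: nsq_ae. Qed.

Lemma nrm_cst0 : nrm (cst 0) = 0.
Proof.
rewrite /nrm nsqE (@eq_Rintegral _ _ _ _ _ (cst 0)); last first.
  by move=> w _; rewrite /sqn /= expr0n addr0.
by rewrite Rintegral_cst// mul0r sqrtr0.
Qed.

Lemma nrmB_eq0 f g : L2 f -> L2 g -> nrm (f \- g) = 0 -> f = g %[ae m].
Proof.
move=> Lf Lg /nrm_eq0 => /(_ (L2B Lf Lg)); apply: filterS => w /[apply] /eqP.
by rewrite subr_eq0 => /eqP.
Qed.

Lemma nsqD f g : L2 f -> L2 g -> nsq (f \+ g) = nsq f + nsq g + 2 * Re (inner f g).
Proof.
move=> Lf Lg; rewrite /nsq innerDl ?innerDr//; try exact: L2D.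
rewrite (inner_conj Lg Lf) !cReD cReJ; ring.
Qed.

Lemma nsqB f g : L2 f -> L2 g -> nsq (f \- g) = nsq f + nsq g - 2 * Re (inner f g).
Proof.
move=> Lf Lg; rewrite /nsq innerBl ?innerBr//; try exact: L2B.
rewrite (inner_conj Lg Lf) !cReD !cReN !cReD !cReN cReJ; ring.
Qed.

Lemma nsqZ (c : R[i]) f : L2 f -> nsq (cst c \* f) = sqn c * nsq f.
Proof.
move=> Lf; rewrite /nsq innerZl ?innerZr//; last exact: L2Z.
by rewrite mulrA mulcJ innerff cReM /=; ring.
Qed.

(* Take [s = inner f g / (nsq g + 1)]: it is optimal up to the added 1, which keeps
   the quotient meaningful when [g] vanishes. *)
Lemma nsq_min_inner f g (e : R) : L2 f -> L2 g ->
  (forall s : R[i], nsq f - e <= nsq (f \- (cst s \* g))) ->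
  sqn (inner f g) <= e * (nsq g + 1).
Proof.
move=> Lf Lg H; set d := nsq g + 1.
have d0 : 0 < d by rewrite ltr_wpDl// nsq_ge0.
have := H ((d^-1)%:C * inner f g).
rewrite nsqB ?nsqZ ?innerZr//; last exact: L2Z.
set c := inner f g.
have -> : Re (conjc ((d^-1)%:C * c) * c) = d^-1 * sqn c.
  by rewrite /sqn !(cReM, cImM, cReJ, cImJ) /=; ring.
have -> : sqn ((d^-1)%:C * c) = d^-1 ^+ 2 * sqn c.
  by rewrite sqnM /sqn /= expr0n /= addr0.
move=> K.
have e1 : d^-1 * d = 1 by rewrite mulVf// gt_eqF.
have : d^-1 * sqn c <= e.
  have s0 := sqn_ge0 c; have n0 := nsq_ge0 g.
  have : d^-1 ^+ 2 * sqn c * nsq g <= d^-1 * sqn c.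
    rewrite expr2 -!mulrA ler_pM2l ?invr_gt0// (mulrC (sqn c)) mulrA.
    rewrite ler_piMl// -e1 ler_pM2l ?invr_gt0// lerDl//.
  lra.
by rewrite mulrC ler_pdivrMr.
Qed.

(** Taken with error [nsq f], the hypothesis of [nsq_min_inner] is just nonnegativity of squared
    norms. Its added 1 is made harmless by scaling [g] by $1/r$ with $r^2=e$: after multiplication
    by $e$ the bound is $\|f\|^2(\|g\|^2+e)$, and $e$ is arbitrary. *)
Lemma cauchy_schwarz f g : L2 f -> L2 g -> sqn (inner f g) <= nsq f * nsq g.
Proof.
move=> Lf Lg.
have K (e : R) : 0 < e -> sqn (inner f g) <= nsq f * (nsq g + e).
  move=> e0; pose r := Num.sqrt e.
  have r0 : 0 < r by rewrite sqrtr_gt0.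
  have re : r ^+ 2 = e by rewrite sqr_sqrtr// ltW.
  have := @nsq_min_inner f (cst (r^-1)%:C \* g) (nsq f) Lf (L2Z _ Lg).
  rewrite innerZr// nsqZ// conjcR sqnM /sqn /= expr0n /= addr0 -/(sqn _) => H.
  have {}H : r^-1 ^+ 2 * sqn (inner f g) <= nsq f * (r^-1 ^+ 2 * nsq g + 1).
    by apply: H => s; rewrite subrr nsq_ge0.
  have := ler_wpM2l (ltW (exprn_gt0 2 r0)) H.
  have rV : r ^+ 2 * r^-1 ^+ 2 = 1 by rewrite -exprMn mulfV ?gt_eqF// expr1n.
  by rewrite mulrA rV mul1r mulrCA mulrDr mulrA rV mul1r mulr1 re.
apply/ler_addgt0Pr => e e0.
have p : 0 < nsq f + 1 by rewrite ltr_wpDl// nsq_ge0.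
apply: (le_trans (K (e / (nsq f + 1)) _)); first by rewrite divr_gt0.
rewrite mulrDr lerD2l mulrCA ler_piMr ?(ltW e0)//.
by rewrite ler_pdivrMr// mul1r lerDl.
Qed.

Lemma Re_inner_le f g : L2 f -> L2 g -> Re (inner f g) <= nrm f * nrm g.
Proof.
move=> Lf Lg; apply: (le_trans (ler_norm _)).
rewrite -ler_sqr ?nnegrE ?mulr_ge0 ?nrm_ge0// exprMn !nrm_sqr real_normK ?num_real//.
rewrite (le_trans _ (cauchy_schwarz Lf Lg))// /sqn lerDl sqr_ge0//.
Qed.

Lemma nrmD f g : L2 f -> L2 g -> nrm (f \+ g) <= nrm f + nrm g.
Proof.
move=> Lf Lg; rewrite -ler_sqr ?nnegrE ?addr_ge0 ?nrm_ge0//.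
rewrite sqrrD !nrm_sqr nsqD//; have := Re_inner_le Lf Lg.
by rewrite mulr2n; lra.
Qed.

Lemma nrm_distC f g : nrm (f \- g) = nrm (g \- f).
Proof.
rewrite /nrm !nsqE; congr Num.sqrt; apply: eq_Rintegral => w _.
by rewrite /= -opprB /sqn cReN cImN !sqrrN.
Qed.

Lemma nrm_triangle g f h : L2 f -> L2 g -> L2 h ->
  nrm (f \- h) <= nrm (f \- g) + nrm (g \- h).
Proof.
move=> Lf Lg Lh; rewrite (_ : f \- h = (f \- g) \+ (g \- h)).
  by apply: nrmD; exact: L2B.
by apply/funext => w /=; rewrite addrA subrK.
Qed.

Lemma nrm_conj f : nrm (cconj f) = nrm f.
Proof.
by rewrite /nrm !nsqE; congr Num.sqrt; apply: eq_Rintegral => w _; rewrite /cconj sqnJ.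
Qed.

Lemma nrm_unimod u f : Linfty u -> (\forall w \ae m, sqn (u w) = 1) -> L2 f ->
  nrm (u \* f) = nrm f.
Proof.
move=> Lu u1 Lf; have Luf := L2M Lu Lf; rewrite /nrm; congr Num.sqrt.
apply/EFin_inj; rewrite -!integral_sqn//.
apply: ae_eq_integral => //.
- by apply/measurable_EFinP/measurable_sqn/L2_cmeas.
- by apply/measurable_EFinP/measurable_sqn/L2_cmeas.
by apply: filterS u1 => w u1 _ /=; rewrite sqnM u1 mul1r.
Qed.

Lemma L2dist_nrm f g : L2 f -> L2 g -> L2dist f g = (nrm (f \- g))%:E.
Proof. by move=> Lf Lg; rewrite /L2dist cLnorm2//; exact: L2B. Qed.

(** Cauchy-Schwarz between $|f|$ and the constant 1, whose norm is 1 on a probability space. This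
    controls the series of increments in the completeness proof. *)
Lemma integral_abs_le f : L2 f ->
  (\int[m]_w (Num.sqrt (sqn (f w)))%:E <= (nrm f)%:E)%E.
Proof.
move=> Lf; pose g : cfun := fun w => (Num.sqrt (sqn (f w)))%:C.
have mg : cmeas g.
  split; last exact: measurable_cst.
  apply: (measurableT_comp (continuous_measurable_fun (@sqrt_continuous R))).
  exact/measurable_sqn/L2_cmeas.
have sg w : sqn (g w) = sqn (f w).
  by rewrite /sqn /= expr0n /= addr0 sqr_sqrtr// sqn_ge0.
have Lg : L2 g.
  by apply: (L2_le mg _ ((L2P f).1 Lf).2); apply: aeW => w; rewrite sg.
have := Re_inner_le Lg (L2_cst 1).
rewrite (_ : nrm g = nrm f); last first.
  by rewrite /nrm !nsqE; congr Num.sqrt; apply: eq_Rintegral => w _.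
rewrite (_ : nrm (cst 1) = 1); last first.
  rewrite /nrm nsqE (@eq_Rintegral _ _ _ _ _ (cst 1)); last first.
    by move=> w _; rewrite /sqn /= expr1n expr0n /= addr0.
  rewrite Rintegral_cst// mul1r (_ : fine _ = 1) ?sqrtr1//.
  exact: (congr1 fine circle_setT).
have Ig : m.-integrable setT (EFin \o (fun w => Num.sqrt (sqn (f w)))).
  exact: (L2_cintegrable Lg).1.
rewrite mulr1 -(fineK (integrable_fin_num measurableT Ig)) lee_fin.
apply: le_trans; rewrite le_eqVlt; apply/orP; left; apply/eqP.
by apply: eq_Rintegral => w _; rewrite /cconj cReM cReJ cImJ /=; ring.
Qed.

End L2Norm.

(** * Completeness and orthogonal projections *)

Section Completeness.
Context {R : realType}.
Local Notation m := (circle_measure R).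
Local Notation cfun := (circle R -> R[i]).
Local Notation Re := (@complex.Re R).
Local Notation Im := (@complex.Im R).

Lemma cvg_summable_increments (x a : nat -> R) (M : R) :
  (forall k, `|x k.+1 - x k| <= a k) -> (forall n, \sum_(0 <= k < n) a k <= M) ->
  cvgn x.
Proof.
move=> xa aM.
have : cvgn (series (telescope x)).
  apply: normed_cvg; apply: nondecreasing_is_cvgn.
    by apply: nondecreasing_series => k _ _; exact: normr_ge0.
  exists M => _ [n _ <-]; apply: le_trans (aM n); rewrite /series /=.
  by apply: ler_sum => k _; exact: xa.
rewrite telescopeK => /cvg_ex[l xl]; apply/cvg_ex; exists (l + x 0%N).
rewrite [X in X @ _](_ : x = (fun n => [sequence x n - x 0%N]_n n + x 0%N)).
  by apply: cvgD; [exact: xl|exact: cvg_cst].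
by apply/funext => n /=; rewrite subrK.
Qed.

Lemma fine_limn_esup (x : nat -> R) : cvgn x ->
  x @ \oo --> fine (limn_esup (EFin \o x)).
Proof.
move=> cx; have : EFin \o x @ \oo --> (limn x)%:E.
  by apply: cvg_EFin => //; exact: nearW.
by move=> /cvg_limn_einf_sup[_ ->].
Qed.

(** A candidate limit built as a limit superior is measurable whether or not the sequence converges;
    [fine_limn_esup] identifies it with the limit where there is one. *)
Lemma measurable_fine_limn_esup (x : nat -> circle R -> R) :
  (forall n, measurable_fun setT (x n)) ->
  measurable_fun setT (fun w => fine (limn_esup (fun n => (x n w)%:E))).
Proof.
move=> mx; apply: measurableT_comp => //.
by apply: measurable_fun_limn_esup => n; exact/measurable_EFinP.
Qed.

Lemma limn_einf_le (u : nat -> \bar R) (c : \bar R) (N : nat) :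
  (forall n, (N <= n)%N -> (u n <= c)%E) -> (limn_einf u <= c)%E.
Proof.
move=> uc; apply: le_trans (limn_einf_sup u) _; rewrite limn_esup_lim.
apply: lime_le; first exact: is_cvg_esups.
exists N => // n /= Nn; apply: ge_ereal_sup => _ [k /= nk <-].
by apply: uc; exact: leq_trans nk.
Qed.

(** The sum of the $|v_{k+1}-v_k|$ has integral at most $\sum 2^{-k}$, so it is finite almost
    everywhere and [v] converges there. Fatou's lemma for $|v_j-v_k|^2$ as $j\to\infty$ hands the
    rate over to the limit. *)
Lemma L2_complete_fast (v : nat -> cfun) : (forall k, L2 (v k)) ->
  (forall j k, (k <= j)%N -> nrm (v j \- v k) <= (2 ^ k)%:R^-1) ->
  exists2 g, L2 g & forall k, nrm (g \- v k) <= (2 ^ k)%:R^-1.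
Proof.
move=> Lv vC.
pose a k w := Num.sqrt (sqn ((v k.+1 \- v k) w)).
have ma k : measurable_fun setT (fun w => (a k w)%:E).
  apply/measurable_EFinP.
  apply: (measurableT_comp (continuous_measurable_fun (@sqrt_continuous R))).
  exact/measurable_sqn/L2_cmeas/L2B.
pose S w := (\sum_(k <oo) (a k w)%:E)%E.
have mS : measurable_fun setT S.
  by apply: ge0_emeasurable_sum => // *; rewrite lee_fin sqrtr_ge0.
have S0 w : (0 <= S w)%E.
  by apply: nneseries_ge0 => *; rewrite lee_fin sqrtr_ge0.
have IS : m.-integrable setT S.
  apply/integrableP; split => //.
  under eq_integral do rewrite gee0_abs//.
  rewrite integral_nneseries//; last by move=> *; rewrite lee_fin sqrtr_ge0.
  (* The term $2/2^{k+1}$ is the rate $2^{-k}$ in the shape summed by [epsilon_trick0]. *)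
  apply: (@le_lt_trans _ _ (\sum_(k <oo) (2 / (2 ^ k.+1)%:R)%:E)%E); last first.
    by apply: le_lt_trans (@epsilon_trick0 _ 2 xpredT _) _ => //; exact: ltry.
  apply: lee_nneseries => [k _ _|k _].
    by apply: integral_ge0 => *; rewrite lee_fin sqrtr_ge0.
  apply: le_trans (integral_abs_le (L2B (Lv _) (Lv _))) _.
  rewrite lee_fin; apply: le_trans (vC _ _ (leqnSn k)) _.
  by rewrite expnS natrM invfM mulrA mulfV// mul1r.
pose gr w := fine (limn_esup (fun n => (Re (v n w))%:E)).
pose gi w := fine (limn_esup (fun n => (Im (v n w))%:E)).
pose g : cfun := fun w => gr w +i* gi w.
have mg : cmeas g.
  by split; apply: measurable_fine_limn_esup => n; have [] := L2_cmeas (Lv n).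
have gcvg : \forall w \ae m, (fun n => Re (v n w)) @ \oo --> Re (g w) /\
    (fun n => Im (v n w)) @ \oo --> Im (g w).
  have := integrable_ae measurableT IS; apply: filterS => w /(_ I) Sw.
  have aM n : \sum_(0 <= k < n) a k w <= fine (S w).
    rewrite -lee_fin fineK// -sumEFin; apply: nneseries_lim_ge => *.
    by rewrite lee_fin sqrtr_ge0.
  split; apply: fine_limn_esup; apply: cvg_summable_increments aM => k.
    rewrite -cReN -cReD /a -sqrtr_sqr ler_wsqrtr// /sqn lerDl sqr_ge0//.
  rewrite -cImN -cImD /a -sqrtr_sqr ler_wsqrtr// /sqn lerDr sqr_ge0//.
have key k : (\int[m]_w (sqn ((g \- v k) w))%:E <= ((2 ^ k)%:R^-1 ^+ 2)%:E)%E.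
  pose F j w := (sqn ((v j \- v k) w))%:E.
  have mF j : measurable_fun setT (F j).
    exact/measurable_EFinP/measurable_sqn/L2_cmeas/L2B.
  have F0 j w : [set: circle R] w -> (0 <= F j w)%E by rewrite lee_fin sqn_ge0.
  apply: le_trans (le_trans (fatou m measurableT mF F0) _).
    rewrite le_eqVlt; apply/orP; left; apply/eqP.
    apply: ae_eq_integral => //.
    - by apply/measurable_EFinP/measurable_sqn/cmeasB => //; exact: L2_cmeas.
    - rewrite /limn_einf; apply: measurableT_comp => //.
      by apply: measurable_fun_limn_esup => n; exact: measurableT_comp.
    apply: filterS gcvg => w [cr ci] _.
    suff H : F ^~ w @ \oo --> (sqn ((g \- v k) w))%:E by have [-> _] := cvg_limn_einf_sup H.
    apply: cvg_EFin; first exact: nearW.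
    rewrite /F /comp /= /sqn cReD cImD cReN cImN !expr2.
    under eq_fun do rewrite cReD cImD cReN cImN !expr2.
    by apply: cvgD; apply: cvgM; apply: cvgB => //; exact: cvg_cst.
  apply: (@limn_einf_le _ _ k) => j kj.
  by rewrite integral_sqn ?lee_fin -?nrm_sqr ?lerXn2r ?nnegrE ?nrm_ge0 ?vC//; exact: L2B.
have Lgv k : L2 (g \- v k).
  apply/L2P; split; first by apply: cmeasB => //; exact: L2_cmeas.
  apply/integrableP; split.
    by apply/measurable_EFinP/measurable_sqn/cmeasB => //; exact: L2_cmeas.
  under eq_integral do rewrite /= ger0_norm ?sqn_ge0//.
  by apply: le_lt_trans (key k) _; exact: ltry.
exists g.
  have -> : g = (g \- v 0%N) \+ v 0%N by apply/funext => w /=; rewrite subrK.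
  exact: L2D.
move=> k; have := key k; rewrite integral_sqn// lee_fin -nrm_sqr.
by rewrite ler_pXn2r ?nnegrE ?nrm_ge0.
Qed.

Definition L2cvg (u : nat -> cfun) (g : cfun) : Prop :=
  forall e : R, 0 < e -> exists N : nat, forall n, (N <= n)%N -> nrm (u n \- g) < e.

Lemma L2_complete (u : nat -> cfun) : (forall k, L2 (u k)) ->
  (forall e : R, 0 < e -> exists N : nat, forall i j, (N <= i)%N -> (N <= j)%N ->
     nrm (u i \- u j) < e) ->
  exists2 g, L2 g & L2cvg u g.
Proof.
move=> Lu uC.
have i0 k : 0 < (2 ^ k)%:R^-1 :> R by rewrite invr_gt0 ltr0n expn_gt0.
have /choice[N NP] k := uC _ (i0 k).
(* Summing the thresholds gives nondecreasing indices that stay above [N k], so the subsequence has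
   geometric speed. *)
pose s k := (\sum_(i < k.+1) N i)%N.
have sN k : (N k <= s k)%N by rewrite /s big_ord_recr /= leq_addl.
have sS j k : (k <= j)%N -> (s k <= s j)%N.
  move=> /subnK <-; elim: (j - k)%N => // n IH.
  by rewrite addSn (leq_trans IH)// /s [leqRHS]big_ord_recr leq_addr.
have [g Lg gv] : exists2 g, L2 g & forall k, nrm (g \- u (s k)) <= (2 ^ k)%:R^-1.
  apply: L2_complete_fast => // j k kj.
  by apply/ltW/NP => //; apply: leq_trans (sS _ _ kj).
exists g => // e e0.
have [k ke] : exists k, 2 * (2 ^ k)%:R^-1 < e.
  have := @cvg_geometric R 2 (2^-1); rewrite ger0_norm ?invr_ge0// invf_lt1 ?ltr1n//.
  move=> /(_ isT)/cvgrPdist_lt/(_ _ e0)[k _ /(_ k (leqnn k))] /=.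
  rewrite sub0r normrN ger0_norm ?mulr_ge0 ?exprn_ge0 ?invr_ge0// => H.
  by exists k; rewrite natrX -exprVn.
exists (N k) => n Nn.
apply: le_lt_trans (nrm_triangle (Lu n) (Lu (s k)) Lg) _.
apply: lt_le_trans (ltW ke); rewrite mulr_natl mulr2n.
by apply: ltr_leD; [exact: NP|rewrite nrm_distC].
Qed.

End Completeness.

(** * Projections, density and extension by continuity *)

Section HilbertSpace.
Context {R : realType}.
Local Notation m := (circle_measure R).
Local Notation cfun := (circle R -> R[i]).
Local Notation Re := (@complex.Re R).
Local Notation Im := (@complex.Im R).
Implicit Types (f g h : cfun) (S D : set cfun) (T : cfun -> cfun).

Definition lin_subspace S : Prop :=
  [/\ forall f, S f -> L2 f, S (cst 0),
      forall f g, S f -> S g -> S (f \+ g) &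
      forall (c : R[i]) f, S f -> S (cst c \* f)].

Definition L2closed S : Prop :=
  forall u g, (forall n, S (u n)) -> L2 g -> L2cvg u g -> S g.

Lemma subspaceB S f g : lin_subspace S -> S f -> S g -> S (f \- g).
Proof.
move=> [_ _ SD SZ] Sf Sg.
rewrite (_ : f \- g = f \+ (cst (-1) \* g)); first exact/SD/SZ.
by apply/funext => w /=; rewrite mulN1r.
Qed.

Lemma sqn_small_eq0 (z : R[i]) : (forall e : R, 0 < e -> sqn z <= e) -> z = 0.
Proof.
move=> H; apply: sqn_eq0; apply/eqP; rewrite eq_le sqn_ge0 andbT.
by apply/ler_addgt0Pr => e e0; rewrite add0r H.
Qed.

Lemma nrm_nsq_lt f (e : R) : 0 < e -> nrm f < Num.sqrt e -> nsq f < e.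
Proof.
move=> e0 fe; rewrite -nrm_sqr -[ltRHS]sqr_sqrtr ?(ltW e0)//.
by rewrite ltr_pXn2r ?nnegrE ?nrm_ge0 ?sqrtr_ge0.
Qed.

Lemma sqnD_le (x y : R[i]) : sqn (x + y) <= 2 * sqn x + 2 * sqn y.
Proof.
rewrite /sqn cReD cImD; have := sqr_ge0 (Re x - Re y); have := sqr_ge0 (Im x - Im y).
nra.
Qed.

(** Split $f-g=(f-u_n)+(u_n-g)$: the first term is small by hypothesis, the second by
    Cauchy-Schwarz. The quarters of [e] absorb the factor 2 of [sqnD_le]. *)
Lemma inner_L2cvg u g f h : (forall n, L2 (u n)) -> L2 g -> L2 f -> L2 h ->
  L2cvg u g ->
  (forall e : R, 0 < e -> exists N : nat, forall n, (N <= n)%N ->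
     sqn (inner (f \- u n) h) <= e) ->
  inner (f \- g) h = 0.
Proof.
move=> Lu Lg Lf Lh ug H; apply: sqn_small_eq0 => e e0.
have p0 : 0 < nsq h + 1 by rewrite ltr_wpDl// nsq_ge0.
have e4 : 0 < e / 4 by rewrite divr_gt0.
have [N1 N1P] := H _ e4.
have q0 : 0 < e / 4 / (nsq h + 1) by rewrite divr_gt0.
have [N2 N2P] : exists N : nat, forall n, (N <= n)%N ->
    nrm (u n \- g) < Num.sqrt (e / 4 / (nsq h + 1)).
  by apply: ug; rewrite sqrtr_gt0.
pose n := maxn N1 N2.
have -> : f \- g = (f \- u n) \+ (u n \- g) by apply/funext => w /=; rewrite addrA subrK.
rewrite innerDl//; [|exact: L2B|exact: L2B].
apply: le_trans (sqnD_le _ _) _.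
have a1 := N1P n (leq_maxl _ _).
have /(nrm_nsq_lt q0) a2 := N2P n (leq_maxr _ _).
have a3 : sqn (inner (u n \- g) h) <= e / 4.
  apply: le_trans (cauchy_schwarz (L2B (Lu n) Lg) Lh) _.
  have -> : e / 4 = e / 4 / (nsq h + 1) * (nsq h + 1) by rewrite mulfVK// gt_eqF.
  by apply: ler_pM; rewrite ?nsq_ge0 ?ltW// ltrDl.
lra.
Qed.

Lemma L2cvg_orth u g h : (forall n, L2 (u n)) -> L2 g -> L2 h -> L2cvg u g ->
  (forall n, inner (u n) h = 0) -> inner g h = 0.
Proof.
move=> Lu Lg Lh ug uh.
have : inner (cst 0 \- g) h = 0.
  apply: (@inner_L2cvg u) => //; first exact: L2_cst.
  move=> e e0; exists 0%N => n _; rewrite innerBl ?uh//; last exact: L2_cst.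
  rewrite (_ : cst 0 = cst 0 \* h); last by apply/funext => w /=; rewrite mul0r.
  by rewrite innerZl// mul0r subrr /sqn /= expr0n /= addr0 ltW.
rewrite innerBl//; last exact: L2_cst.
rewrite (_ : cst 0 = cst 0 \* h); last by apply/funext => w /=; rewrite mul0r.
by rewrite innerZl// mul0r add0r => /eqP; rewrite oppr_eq0 => /eqP.
Qed.

Lemma parallelogram f g : L2 f -> L2 g ->
  nsq (f \- g) + nsq (f \+ g) = 2 * nsq f + 2 * nsq g.
Proof. by move=> Lf Lg; rewrite nsqB// nsqD//; ring. Qed.

Lemma natSinv_lt (e : R) : 0 < e -> exists N : nat, forall n, (N <= n)%N -> n.+1%:R^-1 < e.
Proof.
move=> e0; have [N _ NP] := near_infty_natSinv_lt (PosNum e0).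
by exists N => n Nn; apply: NP.
Qed.

(** Nearest point argument: a minimizing sequence is Cauchy by the parallelogram identity, and
    near-minimality in every direction [h] forces orthogonality. The approximating sequence is kept
    in the conclusion, so that the result yields projections for closed subspaces and density
    statements for the others. *)
Theorem projection_closure S f : lin_subspace S -> L2 f ->
  exists g, [/\ L2 g, exists2 u, (forall n, S (u n)) & L2cvg u g &
    forall h, S h -> inner (f \- g) h = 0].
Proof.
move=> SS Lf; have [SL S0 SD SZ] := SS.
pose A := [set nsq (f \- h) | h in S].
have infA : has_inf A.
  split; first by exists (nsq (f \- cst 0)), (cst 0).
  by exists 0 => _ [h _ <-]; exact: nsq_ge0.
pose d := inf A.
have dP h : S h -> d <= nsq (f \- h) by move=> Sh; apply: ge_inf; [case: infA|exists h].
have n0 (n : nat) : 0 < n.+1%:R^-1 :> R by rewrite invr_gt0.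
have /choice[u uP] (n : nat) : exists h, S h /\ nsq (f \- h) < d + n.+1%:R^-1.
  by have [_ [h Sh <-] hlt] := inf_adherent (n0 n) infA; exists h.
have uS n : S (u n) by case: (uP n).
have uL n : L2 (u n) by exact: SL.
have uC i j : nsq (u i \- u j) <= 2 * (i.+1%:R^-1 + j.+1%:R^-1).
  have := parallelogram (L2B Lf (uL j)) (L2B Lf (uL i)).
  have -> : (f \- u j) \- (f \- u i) = u i \- u j.
    by apply/funext => w /=; ring.
  (* The midpoint of [u i] and [u j] is in [S], hence at squared distance at least [d] from [f];
     with the factor $2^2$ this cancels the $4d$ of the other side. *)
  have -> : (f \- u j) \+ (f \- u i) = cst 2 \* (f \- (cst (2^-1) \* (u i \+ u j))).
    by apply/funext => w /=; field.
  rewrite nsqZ; last by apply: L2B => //; apply: L2Z; exact: L2D.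
  have := dP _ (SZ 2^-1 _ (SD _ _ (uS i) (uS j))).
  rewrite (_ : sqn 2 = 4); last by rewrite /sqn /=; ring.
  have [_] := uP i; have [_] := uP j.
  move: (i.+1%:R^-1) (j.+1%:R^-1) (nsq (u i \- u j)) (nsq (f \- u i)) (nsq (f \- u j)) (nsq _).
  by move=> *; lra.
have [g Lg ug] : exists2 g, L2 g & L2cvg u g.
  apply: L2_complete => // e e0.
  have [N NP] := @natSinv_lt (e ^+ 2 / 4) (divr_gt0 (exprn_gt0 2 e0) (ltr0n _ 4)).
  exists N => i j Ni Nj.
  rewrite -ltr_sqr ?nnegrE ?nrm_ge0 ?ltW// nrm_sqr.
  apply: le_lt_trans (uC i j) _; have := NP _ Ni; have := NP _ Nj.
  move: (e ^+ 2) (i.+1%:R^-1) (j.+1%:R^-1) => a b c *; lra.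
exists g; split => //; first by exists u.
move=> h Sh; apply: (@inner_L2cvg u) => //; first exact: SL.
move=> e e0.
have p0 : 0 < nsq h + 1 by rewrite ltr_wpDl// nsq_ge0.
have [N NP] := @natSinv_lt (e / (nsq h + 1)) (divr_gt0 e0 p0).
exists N => n Nn.
(* No displacement of [u n] along [h] gains more than $1/(n+1)$, which is the hypothesis of
   [nsq_min_inner]. *)
apply: (@le_trans _ _ (n.+1%:R^-1 * (nsq h + 1))).
  apply: nsq_min_inner; [exact: L2B|exact: SL|].
  move=> s; have := dP _ (SD _ _ (uS n) (SZ s _ Sh)).
  have -> : f \- (u n \+ (cst s \* h)) = (f \- u n) \- (cst s \* h).
    by apply/funext => w /=; rewrite opprD addrA.
  have [_] := uP n; move: (nsq _) (nsq _) (n.+1%:R^-1) => a b c *; lra.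
by rewrite -ler_pdivlMr// ltW// NP.
Qed.

Lemma is_orth_proj_unique S f g g' : lin_subspace S ->
  is_orth_proj S f g -> is_orth_proj S f g' -> g = g' %[ae m].
Proof.
move=> SS [Lf Sg fg] [_ Sg' fg']; have [SL _ _ _] := SS.
have Sd := subspaceB SS Sg Sg'.
have [Lg Lg'] := (SL _ Sg, SL _ Sg').
apply: nrmB_eq0 => //; rewrite /nrm /nsq.
have -> : inner (g \- g') (g \- g') = inner (f \- g') (g \- g') - inner (f \- g) (g \- g').
  rewrite -innerBl; try exact: L2B.
  by congr inner; apply/funext => w /=; ring.
by rewrite fg' ?fg// subrr sqrtr0.
Qed.

Lemma proj_spec S f : lin_subspace S -> L2closed S -> L2 f -> is_orth_proj S f (Defs.proj S f).
Proof.
move=> SS SC Lf; have [g [Lg [u uS ug] gP]] := projection_closure SS Lf.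
apply: (@xgetPex _ (cst 0) [set g : cfun | is_orth_proj S f g]).
by exists g; split => //; apply: SC ug.
Qed.

(** Orthogonality to [S] sees only the class of the function, so both projections are chosen from
    the same set; hence an equality of functions, usable for rewriting. *)
Lemma proj_ae S f f' : L2 f -> L2 f' -> (forall h, S h -> L2 h) ->
  f = f' %[ae m] -> Defs.proj S f = Defs.proj S f'.
Proof.
move=> Lf Lf' SL ff'; congr xget; apply/seteqP.
split => g [_ Sg H]; split => // h Sh; have [Lg Lh] := (SL _ Sg, SL _ Sh);
  rewrite -(H _ Sh); apply: inner_ael => //; try exact: L2B;
  by apply: filterS ff' => w e1 /e1 e2; rewrite /= e2.
Qed.

(** The projection [g] of [f] onto the closure of [S] stays in [K]; then $f-g$ is in [K] and
    orthogonal to [S], hence null. *)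
Lemma dense_of_orth S (K : set cfun) f : lin_subspace S -> lin_subspace K -> L2closed K ->
  (forall h, S h -> K h) -> K f ->
  (forall g, K g -> (forall h, S h -> inner g h = 0) -> g = cst 0 %[ae m]) ->
  forall e : R, 0 < e -> exists2 h, S h & nrm (h \- f) < e.
Proof.
move=> SS KK KC SK Kf H e e0; have [KL _ _ _] := KK.
have [g [Lg [u uS ug] gP]] := projection_closure SS (KL _ Kf).
have Kg : K g by apply: KC ug => // n; exact: SK.
have fg0 := H _ (subspaceB KK Kf Kg) gP.
have fg : nrm (g \- f) = 0.
  rewrite nrm_distC -nrm_cst0; apply: nrm_ae => //; last exact: L2_cst.
  by apply: L2B => //; exact: KL.
have [N /(_ N (leqnn _)) NP] := ug _ e0.
exists (u N) => //; apply: le_lt_trans NP.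
have := nrm_triangle (KL _ (SK _ (uS N))) Lg (KL _ Kf).
by rewrite fg addr0.
Qed.

Lemma cont_extP D T f g : (forall h, D h -> L2 h /\ L2 (T h)) -> L2 f -> L2 g ->
  is_cont_ext D T f g <->
  (forall e : R, 0 < e -> exists2 h, D h & nrm (h \- f) < e) /\
  (forall e : R, 0 < e -> exists2 d : R, 0 < d &
    forall h, D h -> nrm (h \- f) < d -> nrm (T h \- g) < e).
Proof.
move=> DT Lf Lg; split.
  move=> [_ _ H1 H2]; split => e e0.
    have [h Dh] := H1 e e0; exists h => //; have [Lh _] := DT _ Dh.
    by rewrite -lte_fin -L2dist_nrm.
  have [d d0 dP] := H2 e e0; exists d => // h Dh hd; have [Lh LTh] := DT _ Dh.
  by rewrite -lte_fin -L2dist_nrm//; apply: dP => //; rewrite L2dist_nrm// lte_fin.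
move=> [H1 H2]; split => // e e0.
  have [h Dh] := H1 e e0; exists h => //; have [Lh _] := DT _ Dh.
  by rewrite L2dist_nrm.
have [d d0 dP] := H2 e e0; exists d => // h Dh; have [Lh LTh] := DT _ Dh.
by rewrite !L2dist_nrm// !lte_fin; exact: dP.
Qed.

Section Lipschitz.
Variables (D : set cfun) (T : cfun -> cfun) (c : R).
Hypothesis c0 : 0 <= c.
Hypothesis DT : forall h, D h -> L2 h /\ L2 (T h).
Hypothesis lipT : forall h k, D h -> D k -> nrm (T h \- T k) <= c * nrm (h \- k).

Let p0 : 0 < c + 1. Proof. by rewrite ltr_wpDl. Qed.

(** Approximate both points from [D]: two quarters of [e] are spent on the values and two on the
    arguments, with $c+1$ as divisor since [c] may vanish. For [f = f'] this is uniqueness of the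
    extension. *)
Lemma cont_ext_lip f f' g g' : L2 f -> L2 f' -> L2 g -> L2 g' ->
  is_cont_ext D T f g -> is_cont_ext D T f' g' -> nrm (g \- g') <= c * nrm (f \- f').
Proof.
move=> Lf Lf' Lg Lg' /(cont_extP DT Lf Lg)[H1 H2] /(cont_extP DT Lf' Lg')[H1' H2'].
suff key (e : R) : 0 < e -> nrm (g \- g') <= c * nrm (f \- f') + e by exact/ler_addgt0Pr.
move=> e0; have e4 : 0 < e / 4 by rewrite divr_gt0.
have q0 : 0 < e / 4 / (c + 1) by rewrite divr_gt0.
have [d d0 dP] := H2 _ e4; have [d' d'0 d'P] := H2' _ e4.
have [|h Dh] := H1 (Num.min d (e / 4 / (c + 1))).
  by rewrite lt_min d0 q0.
rewrite lt_min => /andP[hd hq].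
have [|h' Dh'] := H1' (Num.min d' (e / 4 / (c + 1))).
  by rewrite lt_min d'0 q0.
rewrite lt_min => /andP[hd' hq'].
have [[Lh LTh] [Lh' LTh']] := (DT Dh, DT Dh').
have b1 := dP _ Dh hd; have b2 := d'P _ Dh' hd'.
have b3 := lipT Dh Dh'.
have t1 := nrm_triangle Lg LTh Lg'; have t2 := nrm_triangle LTh LTh' Lg'.
have t3 := nrm_triangle Lh Lf Lh'; have t4 := nrm_triangle Lf Lf' Lh'.
rewrite (nrm_distC g (T h)) in t1; rewrite (nrm_distC f' h') in t4.
move: hq hq'; rewrite !ltr_pdivlMr// => hq hq'.
have := ler_wpM2l c0 (le_trans t3 (lerD (lexx _) t4)).
have := nrm_ge0 (h \- f); have := nrm_ge0 (h' \- f').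
move: t1 t2 b1 b2 b3 hq hq'.
move: (nrm _) (nrm _) (nrm _) (nrm _) (nrm _) (nrm _) (nrm _) (nrm _) (nrm _).
by move=> *; lra.
Qed.

Lemma cont_ext_self f : D f -> is_cont_ext D T f (T f).
Proof.
move=> Df; have [Lf LTf] := DT Df; apply/cont_extP => //; split => e e0.
  exists f => //; rewrite (_ : f \- f = cst 0 \* f).
    by rewrite /nrm nsqZ// /sqn /= expr0n addr0 mul0r sqrtr0.
  by apply/funext => w /=; rewrite subrr mul0r.
exists (e / (c + 1)); first by rewrite divr_gt0.
move=> h Dh; rewrite ltr_pdivlMr// => H; apply: le_lt_trans (lipT Dh Df) _.
by apply: le_lt_trans H; rewrite mulrC ler_wpM2l ?nrm_ge0// lerDl.
Qed.

(** The Lipschitz bound makes the values along an approximating sequence Cauchy. That sequence is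
    returned too, so that a closed subspace containing the values contains the extension. *)
Lemma cont_ext_exists f : L2 f ->
  (forall e : R, 0 < e -> exists2 h, D h & nrm (h \- f) < e) ->
  exists g, [/\ L2 g, exists2 u, (forall n, D (u n)) & L2cvg (fun n => T (u n)) g &
    is_cont_ext D T f g].
Proof.
move=> Lf Df.
have n0 (n : nat) : 0 < n.+1%:R^-1 :> R by rewrite invr_gt0.
have /choice[u uP] (n : nat) : exists h, D h /\ nrm (h \- f) < n.+1%:R^-1.
  by have [h Dh hf] := Df _ (n0 n); exists h.
have uD n : D (u n) by case: (uP n).
have uL n : L2 (u n) by case: (DT (uD n)).
have TuL n : L2 (T (u n)) by case: (DT (uD n)).
have [g Lg ug] : exists2 g, L2 g & L2cvg (fun n => T (u n)) g.
  apply: L2_complete => // e e0.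
  have q0 : 0 < e / 2 / (c + 1) by rewrite !divr_gt0.
  have [N NP] := natSinv_lt q0.
  exists N => i j Ni Nj; apply: le_lt_trans (lipT (uD i) (uD j)) _.
  have [_ a1] := uP i; have [_ a2] := uP j.
  have := ler_wpM2l c0 (nrm_triangle (uL i) Lf (uL j)); rewrite (nrm_distC f (u j)).
  have {a1} := lt_trans a1 (NP _ Ni); have {a2} := lt_trans a2 (NP _ Nj).
  rewrite !ltr_pdivlMr//.
  have := nrm_ge0 (u i \- f); have := nrm_ge0 (u j \- f); have := nrm_ge0 (u i \- u j).
  move: (nrm _) (nrm _) (nrm _) => x y z *; lra.
exists g; split => //; first by exists u.
apply/cont_extP => //; split => // e e0.
exists (e / 4 / (c + 1)); first by rewrite !divr_gt0.
move=> h Dh hd; have [Lh LTh] := DT Dh.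
have e4 : 0 < e / 4 by rewrite divr_gt0.
have q0 : 0 < e / 4 / (c + 1) by rewrite !divr_gt0.
have [N NP] := natSinv_lt q0; have [N' N'P] := ug _ e4.
pose n := maxn N N'.
have [_ a1] := uP n; have {}a1 := lt_trans a1 (NP n (leq_maxl _ _)).
have a2 := N'P n (leq_maxr _ _).
have t1 := nrm_triangle LTh (TuL n) Lg.
have t2 := ler_wpM2l c0 (nrm_triangle Lh Lf (uL n)); rewrite (nrm_distC f (u n)) in t2.
have t3 := lipT Dh (uD n).
move: hd a1; rewrite !ltr_pdivlMr//.
have := nrm_ge0 (h \- f); have := nrm_ge0 (u n \- f); have := nrm_ge0 (h \- u n).
move: t1 t2 t3 a2; move: (nrm _) (nrm _) (nrm _) (nrm _) (nrm _) (nrm _).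
by move=> x1 x2 x3 x4 x5 x6 *; lra.
Qed.

End Lipschitz.

End HilbertSpace.

(** * Fourier coefficients *)

Section FourierBasis.
Context {R : realType}.
Local Notation m := (circle_measure R).
Local Notation cfun := (circle R -> R[i]).
Local Notation Re := (@complex.Re R).
Local Notation Im := (@complex.Im R).
Implicit Types (f g h : cfun).

Lemma measurable_circle_coord : measurable_fun setT (@circle_coord R).
Proof. by move=> _ B mB; exists B => //; rewrite setTI. Qed.

Definition zvar : cfun := fun w => val w.

Lemma cmeas_zvar : cmeas zvar.
Proof.
split.
  exact: (measurableT_comp measurable_fst measurable_circle_coord).
exact: (measurableT_comp measurable_snd measurable_circle_coord).
Qed.

Lemma sqn_norm (z : R[i]) : `|z| = 1 -> sqn z = 1.
Proof.
rewrite normc_def => -[H]; rewrite -[LHS]sqr_sqrtr ?sqn_ge0//.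
by rewrite /sqn H expr1n.
Qed.

Lemma sqn_circle (w : circle R) : sqn (val w) = 1.
Proof. by apply: sqn_norm; apply/eqP; exact: (valP w). Qed.

Lemma mulcJ1 (z : R[i]) : sqn z = 1 -> z * conjc z = 1.
Proof. by rewrite mulcJ => ->. Qed.

Lemma circle_neq0 (w : circle R) : val w != 0.
Proof.
apply/eqP => w0; have := sqn_circle w; rewrite w0 /sqn /= expr0n addr0 => /eqP.
by rewrite eq_sym oner_eq0.
Qed.

Lemma zpowD (n k : int) : zpow (n + k) = zpow n \* (zpow k : cfun).
Proof. by apply/funext => w /=; rewrite /zpow expfzDr// circle_neq0. Qed.

Lemma zpow0 : zpow 0 = cst 1 :> cfun.
Proof. by apply/funext => w; rewrite /zpow expr0z. Qed.

Lemma zpow1 : zpow 1 = zvar.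
Proof. by apply/funext => w; rewrite /zpow expr1z. Qed.

Lemma sqn1 : sqn (1 : R[i]) = 1.
Proof. by rewrite /sqn /= expr1n expr0n addr0. Qed.

Lemma sqn_zpow (n : int) (w : circle R) : sqn (zpow n w) = 1.
Proof.
have nat_case k : sqn (val w ^+ k) = 1.
  elim: k => [|k IH]; first by rewrite expr0 sqn1.
  by rewrite exprS sqnM sqn_circle mul1r.
case: n => k; first exact: nat_case.
rewrite /zpow NegzE -invr_expz -[LHS]mul1r -{1}(nat_case k.+1) -sqnM mulfV ?sqn1//.
by rewrite expf_eq0 /= (negbTE (circle_neq0 w)).
Qed.

Lemma cconj_zpow (n : int) : cconj (zpow n) = zpow (- n) :> cfun.
Proof.
apply/funext => w; rewrite /cconj.
apply: (mulfI (expfz_neq0 n (circle_neq0 w))).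
rewrite [LHS](mulcJ1 (sqn_zpow n w)) /zpow -expfzDr ?circle_neq0//.
by rewrite subrr expr0z.
Qed.

Lemma Linfty_zvar : Linfty zvar.
Proof.
apply/LinftyP; split; first exact: cmeas_zvar.
by exists 1 => //; apply: aeW => w; rewrite /zvar sqn_circle.
Qed.

Lemma Linfty_zpow (n : int) : Linfty (zpow n : cfun).
Proof.
have nat_case (k : nat) : Linfty (zpow k : cfun).
  elim: k => [|k IH]; first by rewrite zpow0; exact: Linfty_cst.
  by rewrite -addn1 PoszD zpowD; apply: LinftyM => //; rewrite zpow1; exact: Linfty_zvar.
case: n => k; first exact: nat_case.
by rewrite NegzE -cconj_zpow; exact/Linfty_conj.
Qed.

Lemma L2_zpow (n : int) : L2 (zpow n : cfun).
Proof. exact/Linfty_L2/Linfty_zpow. Qed.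

Lemma expiX (n : nat) (t : R) : val (expi (n%:R * t)) = val (expi t) ^+ n.
Proof.
elim: n => [|n IH]; first by rewrite mul0r /= cos0 sin0 expr0.
rewrite -addn1 natrD mulrDl mul1r exprD -IH expr1 /= cosD sinD.
by apply: complex_inj; rewrite ?cReM ?cImM /= addrC// addrC.
Qed.

Lemma expi_2pi : val (expi (2 * pi : R)) = 1.
Proof.
rewrite (expiX 2) /= cospi sinpi expr2.
by apply: complex_inj; rewrite ?cReM ?cImM /=; ring.
Qed.

(** The measure is the image of the uniform law on $[0,2\pi]$, whence the factor $1/(2\pi)$. The
    change of variables is the one for nonnegative functions; sines and cosines are brought to that
    form by adding 1. *)
Lemma integral_circle_FTC (h : circle R -> R) (F : R -> R) :
  measurable_fun setT h -> (forall w, 0 <= h w) ->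
  continuous (h \o expi : R -> R) ->
  (forall t : R, is_derive t (1 : R) F (h (expi t))) ->
  (\int[m]_w (h w)%:E = ((2 * pi)^-1 * (F (2 * pi) - F 0))%:E)%E.
Proof.
move=> mh h0 ch dF.
rewrite ge0_integral_distribution//; last exact/measurable_EFinP.
rewrite integral_uniform//=; last 2 first.
- by apply/measurable_EFinP/measurableT_comp => //; exact: measurable_expi.
- by move=> t; rewrite lee_fin.
rewrite subr0 EFinM (@continuous_FTC2 _ (h \o expi) F)//.
- exact: twopi_gt0.
- exact: continuous_subspaceT.
- have cF t : {for t, continuous F}.
    by apply: differentiable_continuous; apply/derivable1_diffP; exact: ex_derive.
  split.
  + by move=> t _; exact: ex_derive.
  + exact/cvg_at_right_filter/cF.
  + exact/cvg_at_left_filter/cF.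
- by move=> t _; rewrite derive1E; exact: derive_val.
Qed.

Lemma cintegral_zpow (n : int) : n != 0 -> cintegral (zpow n : cfun) = 0.
Proof.
have nat_case (k : nat) : cintegral (zpow k.+1 : cfun) = 0.
  have k0 : k.+1%:R != 0 :> R by rewrite pnatr_eq0.
  have [m1 m2] := Linfty_cmeas (Linfty_zpow k.+1).
  have [i1 i2] := L2_cintegrable (L2_zpow k.+1).
  have b w := sqn_zpow k.+1 w.
  have zE t : zpow k.+1 (expi t) = cos (k.+1%:R * t) +i* sin (k.+1%:R * t) :> R[i].
    by rewrite /zpow -exprnP -expiX.
  have [c1 s1] : cos (k.+1%:R * (2 * pi)) = 1 :> R /\ sin (k.+1%:R * (2 * pi)) = 0 :> R.
    have := expiX k.+1 (2 * pi : R); rewrite expi_2pi expr1n => E.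
    by split; [exact: (congr1 Re E)|exact: (congr1 Im E)].
  have lin : continuous (fun t : R => k.+1%:R * t) by exact: mulrl_continuous.
  have dlin (t : R) : is_derive t (1 : R) (fun t : R => k.+1%:R * t) k.+1%:R.
    by rewrite -[X in is_derive _ _ _ X]mulr1; exact: is_deriveZ.
  (* The integrals computed below are those of $1+\cos$ and $1+\sin$; integrability allows the
     integral of 1 to be subtracted. *)
  have real_case (h : circle R -> R) : m.-integrable setT (EFin \o h) ->
      (\int[m]_w (1 + h w)%:E = 1)%E -> \int[m]_w h w = 0.
    move=> ih; rewrite /Rintegral.
    have i0 : m.-integrable setT (EFin \o cst (1 : R)).
      exact: finite_measure_integrable_cst.
    rewrite (_ : (\int[m]_w (1 + h w)%:E = 1 + \int[m]_w (h w)%:E)%E); last first.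
      transitivity (\int[m]_w ((EFin \o cst 1%R) w + (EFin \o h) w))%E.
        by apply: eq_integral => w _ /=; rewrite EFinD.
      by rewrite integralD//= integral_cst// mul1e; congr (_ + _)%E; exact: circle_setT.
    have := integrable_fin_num measurableT ih.
    by case: (integral _ _ _) => //= r _ [] H; lra.
  apply: complex_inj => /=; apply: real_case => //.
    have dF (t : R) : is_derive t (1 : R) (fun t => t + k.+1%:R^-1 * sin (k.+1%:R * t))
        (1 + Re (zpow k.+1 (expi t))).
      rewrite zE /=; apply: is_deriveD.
      rewrite -[X in is_derive _ _ _ X](mulKf k0) [X in _^-1 * X]mulrC.
      by apply: is_deriveZ; exact: is_derive1_comp.
    rewrite (integral_circle_FTC _ _ _ dF).
    - by rewrite s1 !mulr0 sin0 mulr0 !addr0 subr0 mulVf// gt_eqF// twopi_gt0.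
    - exact: measurable_funD.
    - move=> w; have := b w; rewrite /sqn => bw; nra.
    - rewrite (_ : _ \o _ = (fun t => 1 + cos (k.+1%:R * t))); last first.
        by apply/funext => t; exact: (congr1 (fun z => 1 + Re z) (zE t)).
      move=> t; apply: cvgD; first exact: cvg_cst.
      by apply: continuous_comp; [exact: lin|exact: continuous_cos].
  have dF (t : R) : is_derive t (1 : R) (fun t => t - k.+1%:R^-1 * cos (k.+1%:R * t))
      (1 + Im (zpow k.+1 (expi t))).
    rewrite zE /=; apply: is_deriveD.
    rewrite -[X in is_derive _ _ _ X]opprK -[X in is_derive _ _ _ (- X)](mulKf k0).
    rewrite [X in _^-1 * X]mulrC.
    by apply: is_deriveN; apply: is_deriveZ; exact: is_derive1_comp.
  rewrite (integral_circle_FTC _ _ _ dF).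
  - by rewrite c1 mulr0 cos0 sub0r opprK addrNK mulVf// gt_eqF// twopi_gt0.
  - exact: measurable_funD.
  - move=> w; have := b w; rewrite /sqn => bw; nra.
  - rewrite (_ : _ \o _ = (fun t => 1 + sin (k.+1%:R * t))); last first.
      by apply/funext => t; exact: (congr1 (fun z => 1 + Im z) (zE t)).
    move=> t; apply: cvgD; first exact: cvg_cst.
    by apply: continuous_comp; [exact: lin|exact: continuous_sin].
case: n => [[|k]|k] n0; [by rewrite eqxx in n0|exact: nat_case|].
rewrite NegzE -cconj_zpow cintegral_conj ?nat_case; last exact/L2_cintegrable/L2_zpow.
by apply: complex_inj; rewrite ?cReJ ?cImJ /= ?oppr0.
Qed.

Lemma inner_zpow (n k : int) : n != k -> inner (zpow n : cfun) (zpow k) = 0.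
Proof.
by move=> nk; rewrite /inner cconj_zpow -zpowD cintegral_zpow// subr_eq0.
Qed.

Lemma inner_zpow_diag (n : int) : inner (zpow n : cfun) (zpow n) = 1.
Proof.
rewrite inner_diag (@eq_Rintegral _ _ _ _ _ (cst 1)).
  by rewrite Rintegral_cst// mul1r (_ : fine _ = 1)//; exact: (congr1 fine circle_setT).
by move=> w _; rewrite sqn_zpow.
Qed.

End FourierBasis.

(** * Polynomial approximation of a step function *)

Section Steps.
Context {R : realType}.

Lemma bernoulli_ge (x : R) (n : nat) : 0 <= x -> 1 + n%:R * x <= (1 + x) ^+ n.
Proof.
move=> x0; elim: n => [|n IH]; first by rewrite mul0r addr0 expr0.
rewrite exprS; have : 1 + n.+1%:R * x <= (1 + x) * (1 + n%:R * x).
  rewrite -natr1; have := ler0n R n; move: (n%:R : R) => k k0.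
  have := mulr_ge0 k0 (mulr_ge0 x0 x0); nra.
by move=> /le_trans; apply; rewrite ler_wpM2l// addr_ge0.
Qed.

Lemma bernoulli_le (x : R) (n : nat) : 0 <= x <= 1 -> 1 - n%:R * x <= (1 - x) ^+ n.
Proof.
move=> /andP[x0 x1]; elim: n => [|n IH]; first by rewrite mul0r subr0 expr0.
rewrite exprS; have : 1 - n.+1%:R * x <= (1 - x) * (1 - n%:R * x).
  rewrite -natr1; have := ler0n R n; move: (n%:R : R) => k k0.
  have := mulr_ge0 k0 (mulr_ge0 x0 x0); nra.
by move=> /le_trans; apply; rewrite ler_wpM2l// subr_ge0.
Qed.

(** On $[0,1]$ these polynomials tend to 1 left of $1/2$ and to 0 from $1/2$ on. The exponent $2^n$
    alone, familiar from elementary proofs of the Stone-Weierstrass theorem, would give the limit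
    $1/e$ at $x=1/2$; the extra factor $n$ makes it 0. *)
Definition step_approx (n : nat) (x : R) : R := (1 - x ^+ n) ^+ (n * 2 ^ n)%N.

Lemma step_itv n (x : R) : 0 <= x <= 1 -> 0 <= step_approx n x <= 1.
Proof.
move=> /andP[x0 x1]; have y0 : 0 <= x ^+ n by rewrite exprn_ge0.
have y1 : x ^+ n <= 1 by rewrite exprn_ile1.
by rewrite exprn_ge0 ?subr_ge0//= exprn_ile1 ?subr_ge0// lerBlDr lerDl.
Qed.

(** With $r=s^2$, Bernoulli's inequality at $1/s$ bounds $ns^n$, and the remaining factor $s^n$
    tends to 0. *)
Lemma cvg_natX (r : R) : 0 <= r < 1 -> (fun n => n%:R * r ^+ n) @ \oo --> (0 : R).
Proof.
move=> /andP[r0 r1].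
have [->|rn0] := eqVneq r 0.
  rewrite (_ : (fun n => _) = cst 0); first exact: cvg_cst.
  by apply/funext => -[|n]; rewrite ?mul0r// expr0n mulr0.
have {}r0 : 0 < r by rewrite lt_def rn0.
pose s := Num.sqrt r.
have s0 : 0 < s by rewrite sqrtr_gt0.
have s1 : s < 1 by rewrite -sqrtr1 ltr_sqrt.
have d0 : 0 < s^-1 - 1 by rewrite subr_gt0 invf_gt1.
have H n : n%:R * s ^+ n <= (s^-1 - 1)^-1.
  have := bernoulli_ge n (ltW d0); rewrite (_ : 1 + (s^-1 - 1) = s^-1); last by ring.
  rewrite exprVn => B.
  rewrite -(ler_pM2r d0) mulVf ?gt_eqF// mulrAC -ler_pdivlMr ?exprn_gt0// mul1r.
  by apply: le_trans B; rewrite lerDr.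
have c : (fun n => (s^-1 - 1)^-1 * s ^+ n) @ \oo --> (0 : R).
  by apply: cvg_geometric; rewrite ger0_norm ?ltW.
apply: (squeeze_cvgr _ (cvg_cst (0 : R)) c); apply: nearW => n.
apply/andP; split; first by rewrite mulr_ge0// exprn_ge0// ltW.
have -> : r = s * s by rewrite -expr2 sqr_sqrtr ?ltW.
rewrite exprMn mulrA; apply: ler_wpM2r => //.
by rewrite exprn_ge0// ltW.
Qed.

(** Put $y=x^n$ and $N=n2^n$. Below $1/2$, $(1-y)^N\ge 1-Ny=1-n(2x)^n$. From $1/2$ on,
    $(1-y)^N(1+y)^N\le1$ while $(1+y)^N\ge1+n(2x)^n\ge1+n$. *)
Lemma step_cvg (x : R) : 0 <= x <= 1 ->
  (fun n => step_approx n x) @ \oo --> (if x < 2^-1 then 1 else 0 : R).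
Proof.
move=> x01; have /andP[x0 x1] := x01.
have y0 n : 0 <= x ^+ n by rewrite exprn_ge0.
have y1 n : x ^+ n <= 1 by rewrite exprn_ile1.
case: ltP => x2.
  have c : (fun n => 1 - n%:R * (2 * x) ^+ n) @ \oo --> (1 : R).
    rewrite -[X in _ --> X]subr0; apply: cvgB; first exact: cvg_cst.
    by apply: cvg_natX; rewrite mulr_ge0//= mulrC -ltr_pdivlMr// mul1r.
  apply: (squeeze_cvgr _ c (cvg_cst (1 : R))); apply: nearW => n.
  have /andP[_ ->] := step_itv n x01; rewrite andbT.
  apply: le_trans (bernoulli_le _ _); last by rewrite y0 y1.
  by rewrite natrM natrX exprMn mulrA.
have c : (fun n => n.+1%:R^-1) @ \oo --> (0 : R) by exact: cvg_harmonic.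
apply: (squeeze_cvgr _ (cvg_cst (0 : R)) c); apply: nearW => n.
have /andP[-> _] := step_itv n x01 => /=.
have N1 : n.+1%:R <= (1 + x ^+ n) ^+ (n * 2 ^ n) :> R.
  apply: le_trans (bernoulli_ge _ (y0 n)).
  rewrite -addn1 natrD addrC lerD2l natrM natrX -mulrA -exprMn ler_peMr//.
  by rewrite exprn_ege1// -ler_pdivrMl// mulr1.
rewrite -[leRHS]mul1r ler_pdivlMr//.
apply: (@le_trans _ _ (step_approx n x * (1 + x ^+ n) ^+ (n * 2 ^ n))).
  by rewrite ler_wpM2l//; have /andP[] := step_itv n x01.
rewrite -exprMn exprn_ile1//; have := y0 n; have := y1 n; nra.
Qed.

End Steps.

(** * Uniqueness of Fourier coefficients *)

Section FourierUniqueness.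
Context {R : realType}.
Local Notation m := (circle_measure R).
Local Notation cfun := (circle R -> R[i]).
Local Notation Re := (@complex.Re R).
Local Notation Im := (@complex.Im R).
Implicit Types (f g h : cfun) (u v : circle R -> R).

Definition fourier_null h : Prop :=
  L2 h /\ forall n : int, cintegral (h \* zpow n) = 0.

Definition rfun u : cfun := fun w => (u w)%:C.

(** Real values and a bound at every point make it possible to rescale [u] into $[0,1]$, where the
    step polynomials act. *)
Definition multiplier u : Prop :=
  [/\ measurable_fun setT u, exists c : R, forall w, `|u w| <= c &
      forall h, fourier_null h -> fourier_null (rfun u \* h)].

Lemma Linfty_rfun u (c : R) : measurable_fun setT u -> (forall w, `|u w| <= c) ->
  Linfty (rfun u).
Proof.
move=> mu uc; apply/LinftyP; split; first by split=> //; exact: measurable_cst.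
exists (c ^+ 2); first exact: sqr_ge0.
apply: aeW => w; rewrite /sqn /= expr0n addr0 -real_normK ?num_real//.
by rewrite lerXn2r ?nnegrE ?(le_trans _ (uc w)).
Qed.

Lemma fourier_nullD h k : fourier_null h -> fourier_null k -> fourier_null (h \+ k).
Proof.
move=> [Lh Hh] [Lk Hk]; split=> [|n]; first exact: L2D.
rewrite (_ : _ \* _ = (h \* zpow n) \+ (k \* zpow n)).
  rewrite cintegralD ?Hh ?Hk ?addr0//; apply: L2_cintegrableM => //; exact: L2_zpow.
by apply/funext => w /=; rewrite mulrDl.
Qed.

Lemma fourier_nullZ (c : R[i]) h : fourier_null h -> fourier_null (cst c \* h).
Proof.
move=> [Lh Hh]; split=> [|n]; first exact: L2Z.
rewrite (_ : _ \* _ = cst c \* (h \* zpow n)).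
  rewrite cintegralZ ?Hh ?mulr0//; apply: L2_cintegrableM => //; exact: L2_zpow.
by apply/funext => w /=; rewrite mulrA.
Qed.

Lemma fourier_null_zpow (k : int) h : fourier_null h -> fourier_null (zpow k \* h).
Proof.
move=> [Lh Hh]; split=> [|n]; first by apply: L2M => //; exact: Linfty_zpow.
by rewrite -(Hh (k + n)); congr cintegral; apply/funext => w /=; rewrite zpowD /=; ring.
Qed.

Lemma multiplier_cst (c : R) : multiplier (cst c).
Proof.
split; [exact: measurable_cst|by exists `|c| => w|].
by move=> h; exact: (@fourier_nullZ c%:C).
Qed.

Lemma multiplierD u v : multiplier u -> multiplier v -> multiplier (u \+ v).
Proof.
move=> [mu [c uc] Hu] [mv [d vd] Hv]; split.
- exact: measurable_funD.
- by exists (c + d) => w /=; rewrite (le_trans (ler_normD _ _))// lerD.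
move=> h Gh; rewrite (_ : _ \* _ = (rfun u \* h) \+ (rfun v \* h)).
  by apply: fourier_nullD; [exact: Hu|exact: Hv].
by apply/funext => w /=; rewrite -mulrDl /rfun /= rmorphD.
Qed.

Lemma multiplierM u v : multiplier u -> multiplier v -> multiplier (u \* v).
Proof.
move=> [mu [c uc] Hu] [mv [d vd] Hv]; split.
- exact: measurable_funM.
- by exists (c * d) => w /=; rewrite normrM ler_pM.
move=> h Gh; rewrite (_ : _ \* _ = (rfun u \* (rfun v \* h))).
  exact/Hu/Hv.
by apply/funext => w /=; rewrite mulrA /rfun /= rmorphM.
Qed.

Lemma multiplierX u n : multiplier u -> multiplier (fun w => u w ^+ n).
Proof.
move=> Mu; elim: n => [|n IH].
  exact: (multiplier_cst 1).
rewrite (_ : (fun _ => _) = u \* (fun w => u w ^+ n)); first exact: multiplierM.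
by apply/funext => w; rewrite exprS.
Qed.

(** On the circle the real part of $z$ is $(z+z^{-1})/2$, and multiplying by a power of $z$ only
    shifts the coefficients. *)
Lemma multiplier_Re : multiplier (fun w => Re (val w)).
Proof.
have [mr _] := @cmeas_zvar R; split => //.
  exists 1 => w; rewrite -(@ler_pXn2r _ 2)// ?nnegrE// real_normK ?num_real//.
  by rewrite expr1n -(sqn_circle w) lerDl sqr_ge0.
move=> h Gh.
rewrite (_ : _ \* h = cst (2^-1)%:C \* ((zpow 1 \* h) \+ (zpow (-1) \* h))).
  by apply/fourier_nullZ/fourier_nullD; exact: fourier_null_zpow.
apply/funext => w; rewrite -cconj_zpow zpow1 /rfun /cconj /zvar /=.
by apply: complex_inj; rewrite !(cReM, cImM, cReD, cImD, cReJ, cImJ) /=; field.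
Qed.

Lemma multiplier_Im : multiplier (fun w => Im (val w)).
Proof.
have [_ mr] := @cmeas_zvar R; split => //.
  exists 1 => w; rewrite -(@ler_pXn2r _ 2)// ?nnegrE// real_normK ?num_real//.
  by rewrite expr1n -(sqn_circle w) lerDr sqr_ge0.
move=> h Gh.
rewrite (_ : _ \* h = cst (0 -i* 2^-1) \* ((zpow 1 \* h) \+ (cst (-1) \* (zpow (-1) \* h)))).
  by apply/fourier_nullZ/fourier_nullD; [|apply/fourier_nullZ]; exact: fourier_null_zpow.
apply/funext => w; rewrite -cconj_zpow zpow1 /rfun /cconj /zvar /=.
by apply: complex_inj; rewrite !(cReM, cImM, cReD, cImD, cReJ, cImJ) /=; field.
Qed.

Lemma integral_bounded_limit (u_ : nat -> circle R -> R) u k :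
  (forall n, measurable_fun setT (u_ n)) -> (forall n w, `|u_ n w| <= 1) ->
  (forall w, u_ ^~ w @ \oo --> u w) -> m.-integrable setT (EFin \o k) ->
  (forall n, \int[m]_w (u_ n w * k w) = 0) -> \int[m]_w (u w * k w) = 0.
Proof.
move=> mu_ u1 uu ik H.
have mk : measurable_fun setT k by apply/measurable_EFinP; exact: measurable_int ik.
have mu : measurable_fun setT u by apply: (measurable_fun_cvg mu_) => w _; exact: uu.
have ia : m.-integrable setT (EFin \o (fun w => `|k w|)) by exact: integrable_norm.
have I n : m.-integrable setT (EFin \o (fun w => u_ n w * k w)).
  apply: integrable_real_bound ia => [|w]; first exact: measurable_funM.
  by rewrite normrM ler_piMl.
have [|||||_ _] := @dominated_convergence _ _ _ m setT measurableT
  (fun n => EFin \o (fun w => u_ n w * k w)) (EFin \o (fun w => u w * k w))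
  (EFin \o (fun w => `|k w|)).
- by move=> n; apply/measurable_EFinP; exact: measurable_funM.
- by apply/measurable_EFinP; exact: measurable_funM.
- apply: aeW => w _; apply: cvg_EFin; first exact: nearW.
  by apply: cvgM; [exact: uu|exact: cvg_cst].
- exact: ia.
- by apply: aeW => w n _ /=; rewrite lee_fin normrM ler_piMl.
rewrite [X in X @ _ --> _ -> _](_ : _ = cst 0%E); last first.
  apply/funext => n /=; rewrite -[LHS]fineK; last exact: integrable_fin_num (I n).
  by congr EFin; exact: H.
move=> /cvg_lim => /(_ (@ereal_hausdorff R)); rewrite lim_cst// => E.
by rewrite /Rintegral -E.
Qed.

Lemma multiplier_lim (u_ : nat -> circle R -> R) u :
  (forall n, multiplier (u_ n)) -> (forall n w, `|u_ n w| <= 1) ->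
  (forall w, u_ ^~ w @ \oo --> u w) -> multiplier u.
Proof.
move=> Mu u1 uu.
have mu : measurable_fun setT u.
  by apply: (@measurable_fun_cvg _ _ _ _ u_) => [n|w _]; [have [] := Mu n|exact: uu].
have ub w : `|u w| <= 1.
  have c : (fun n => `|u_ n w|) @ \oo --> `|u w| by exact: cvg_norm (uu w).
  rewrite -(cvg_lim _ c)//.
  by apply: limr_le; [exact: (cvgP _ c)|exact: nearW].
split => //; first by exists 1.
move=> h Gh; have [Lh Hh] := Gh; split => [|n].
  by apply: L2M => //; exact: (Linfty_rfun mu ub).
have [i1 i2] := L2_cintegrableM Lh (L2_zpow n).
have E v : cintegral (rfun v \* h \* zpow n) =
    \int[m]_w (v w * Re ((h \* zpow n) w)) +i* \int[m]_w (v w * Im ((h \* zpow n) w)).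
  rewrite /cintegral; congr Complex; apply: eq_Rintegral => w _ /=;
  by rewrite -mulrA /rfun ?cReM ?cImM /= mul0r ?subr0 ?addr0.
have H k : cintegral (rfun (u_ k) \* h \* zpow n) = 0.
  by have [_ _ /(_ _ Gh)[_]] := Mu k; exact.
have mu_ k : measurable_fun setT (u_ k) by have [] := Mu k.
rewrite E; apply: complex_inj => /=.
  apply: (integral_bounded_limit mu_ u1 uu i1) => k.
  by have := congr1 Re (H k); rewrite E.
apply: (integral_bounded_limit mu_ u1 uu i2) => k.
by have := congr1 Im (H k); rewrite E.
Qed.

(** The affine function $x=1/2+(u-a)/d$ has values in $[0,1]$ and crosses $1/2$ where [u] crosses
    [a], so the step polynomials in $x$ converge to the indicator. The number [d] exceeds $2|u-a|$,
    and its added 1 keeps it positive. *)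
Lemma multiplier_lt u (a : R) : multiplier u ->
  multiplier (\1_[set w | u w < a]).
Proof.
move=> Mu; have [mu [c uc] _] := Mu.
pose d := 2 * (`|c| + `|a| + 1).
have d0 : 0 < d by rewrite mulr_gt0// ltr_wpDl// addr_ge0.
pose x w := 2^-1 + d^-1 * (u w + - a).
have Mx : multiplier x.
  rewrite (_ : x = cst 2^-1 \+ (cst d^-1 \* (u \+ cst (- a))))//.
  by do ?[exact: multiplier_cst | exact: Mu | apply: multiplierD | apply: multiplierM].
have x01 w : 0 <= x w <= 1.
  have : `|d^-1 * (u w - a)| <= 2^-1.
    rewrite normrM gtr0_norm ?invr_gt0// mulrC ler_pdivrMr// /d mulrA mulVf// mul1r.
    rewrite (le_trans (ler_normB _ _))//; have := uc w; have := ler_norm c; lra.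
  by rewrite ler_norml /x => /andP[? ?]; apply/andP; split; lra.
have xa w : (x w < 2^-1) = (u w < a).
  by rewrite /x -ltrBrDl subrr pmulr_rlt0 ?invr_gt0// subr_lt0.
apply: (@multiplier_lim (fun n w => step_approx n (x w))).
- move=> n; rewrite /step_approx.
  apply: multiplierX.
  rewrite (_ : (fun w => _) = cst 1 \+ (cst (-1) \* (fun w => x w ^+ n))).
    apply: multiplierD; first exact: multiplier_cst.
    by apply: multiplierM; [exact: multiplier_cst|exact: multiplierX].
  by apply/funext => w /=; rewrite mulN1r.
- move=> n w; have /andP[s0 s1] := step_itv n (x01 w).
  by rewrite ger0_norm.
- move=> w; have := step_cvg (x01 w); rewrite xa indicE.
  by case: (boolP (u w < a)) => h; [rewrite mem_set|rewrite memNset//; exact/negP].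
Qed.

(** Countable unions are treated through complements: indicators of finite intersections are
    products, and at each point they are eventually constant. The target [T] serves for the line as
    well as for the plane. *)
Lemma multiplier_sigma_algebra T (r : circle R -> T) :
  sigma_algebra setT [set U | multiplier \1_(r @^-1` U)].
Proof.
have MC U : multiplier \1_U -> multiplier (\1_(~` U)).
  move=> MU; rewrite (_ : \1_(~` U) = cst 1 \+ (cst (-1) \* \1_U)).
    apply: multiplierD; first exact: multiplier_cst.
    by apply: multiplierM => //; exact: multiplier_cst.
  apply/funext => w /=; rewrite !indicE in_setC mulN1r.
  by case: (w \in U) => /=; rewrite ?subrr ?subr0.
have MI U V : multiplier \1_U -> multiplier \1_V -> multiplier (\1_(U `&` V)).
  by move=> MU MV; rewrite indicI; exact: multiplierM.
split => /=.
- rewrite preimage_set0 indic0; exact: multiplier_cst.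
- by move=> A MA; rewrite setTD preimage_setC; exact: MC.
- move=> A MA; rewrite preimage_bigcup.
  pose B n := \big[setI/setT]_(k < n) ~` (r @^-1` A k).
  have MB n : multiplier \1_(B n).
    rewrite /B; elim/big_ind : _ => //; first by rewrite indicT; exact: multiplier_cst.
    by move=> k _; exact/MC/MA.
  rewrite -[X in \1_X]setCK; apply: MC; rewrite setC_bigcup.
  apply: (@multiplier_lim (fun n => \1_(B n))) => //.
    by move=> n w; rewrite indicE; case: (_ \in _); rewrite ?normr1 ?normr0.
  move=> w; apply: cvg_near_cst.
  have [wI|] := pselect ((\bigcap_k ~` (r @^-1` A k)) w).
    apply: nearW => n; rewrite !indicE !mem_set//.
    by rewrite /B; elim/big_ind : _ => // k _; exact: wI.
  move=> wI; have [k Ak] : exists k, A k (r w).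
    by apply: contrapT => H; apply: wI => k _ Akw; apply: H; exists k.
  exists k.+1 => // n /= kn; rewrite !indicE !memNset//.
  by rewrite /B (bigD1 (Ordinal kn)) //= => -[nA _]; exact: nA.
Qed.

Lemma multiplier_preimage_R (r : circle R -> R) U : multiplier r ->
  measurable U -> multiplier \1_(r @^-1` U).
Proof.
move=> Mr mU; have : (@RGenInftyO.G R).-sigma.-measurable U.
  by rewrite -RGenInftyO.measurableE.
apply: (smallest_sub (multiplier_sigma_algebra r)).
move=> _ [a ->] /=; rewrite (_ : _ @^-1` _ = [set w | r w < a]); first exact: multiplier_lt.
by apply/seteqP; split => w /=; rewrite in_itv.
Qed.

(** The product sigma-algebra of the plane is generated by preimages under the two projections, and
    these pull back to preimages under the real and imaginary parts of $z$. *)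
Lemma multiplier_indic (A : set (circle R)) : measurable A -> multiplier \1_A.
Proof.
move=> [B mB <-]; rewrite setTI.
suff : measurable `<=` [set B | multiplier \1_(@circle_coord R @^-1` B)] by apply.
apply: (smallest_sub (multiplier_sigma_algebra _)).
move=> _ [] [U mU <-] /=; rewrite setTI.
  exact: (multiplier_preimage_R multiplier_Re mU).
exact: (multiplier_preimage_R multiplier_Im mU).
Qed.

(** The coefficient of index 0 of $1_Af$ vanishes for every measurable $A$, so the real and
    imaginary parts integrate to 0 over every such set. *)
Theorem fourier_unique f : L2 f -> (forall n : int, inner f (zpow n) = 0) ->
  f = cst 0 %[ae m].
Proof.
move=> Lf Hf; have Gf : fourier_null f.
  split=> // n; rewrite -(Hf (- n)) /inner; congr cintegral.
  by rewrite cconj_zpow opprK.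
have [i1 i2] := L2_cintegrable Lf.
have key A : measurable A -> cintegral (rfun \1_A \* f) = 0.
  move=> mA; have [_ _ /(_ _ Gf)[_ /(_ 0)]] := multiplier_indic mA.
  by rewrite zpow0 => <-; congr cintegral; apply/funext => w /=; rewrite mulr1.
have real_case (k : circle R -> R) : m.-integrable setT (EFin \o k) ->
    (forall A, measurable A -> \int[m]_w (\1_A w * k w) = 0) ->
    (EFin \o k) = cst 0%E %[ae m].
  move=> ik H; apply: integral_ae_eq => // A _ mA.
  rewrite integral0 integral_mkcond.
  have ir : m.-integrable setT ((EFin \o k) \_ A) 
    by apply/(integrable_mkcond (EFin \o k) mA); apply: integrableS ik.
  rewrite -[LHS]fineK; last exact: integrable_fin_num ir.
  congr EFin; rewrite -(H A mA); congr fine; apply: eq_integral => w _.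
  by rewrite patchE indicE; case: (w \in A) => /=; rewrite ?mul1r ?mul0r.
have a1 : (EFin \o (Re \o f)) = cst 0%E %[ae m].
  apply: real_case => // A mA; have := congr1 Re (key A mA); rewrite /cintegral /= => <-.
  by apply: eq_Rintegral => w _; rewrite /rfun cReM /= mul0r subr0.
have a2 : (EFin \o (Im \o f)) = cst 0%E %[ae m].
  apply: real_case => // A mA; have := congr1 Im (key A mA); rewrite /cintegral /= => <-.
  by apply: eq_Rintegral => w _; rewrite /rfun cImM /= mul0r addr0.
apply: filterS2 a1 a2 => w + + I => /(_ I)[r1] /(_ I)[r2].
exact: complex_inj.
Qed.

End FourierUniqueness.

(** * Hardy and model spaces *)

Section Hardy.
Context {R : realType}.
Local Notation m := (circle_measure R).
Local Notation cfun := (circle R -> R[i]).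
Implicit Types (f g h u v : cfun) (S : set cfun).

(** [H2] is the complement of the negative powers, [H2perp] that of [H2], and a model space is the
    trace on [H2] of another one; linearity and closedness are thus proved once for all three. *)
Definition orthocomp S : set cfun :=
  [set f | L2 f /\ forall h, S h -> inner f h = 0].

Lemma orthocomp_subspace S : (forall h, S h -> L2 h) -> lin_subspace (orthocomp S).
Proof.
move=> SL; split.
- by move=> f [].
- split; first exact: L2_cst.
  move=> h /SL Lh; rewrite (_ : cst 0 = cst 0 \* h); first by rewrite innerZl// mul0r.
  by apply/funext => w /=; rewrite mul0r.
- move=> f g [Lf Hf] [Lg Hg]; split; first exact: L2D.
  by move=> h Sh; rewrite innerDl ?Hf ?Hg ?addr0//; exact: SL.
- move=> c f [Lf Hf]; split; first exact: L2Z.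
  by move=> h Sh; rewrite innerZl ?Hf ?mulr0//; exact: SL.
Qed.

Lemma orthocomp_closed S : (forall h, S h -> L2 h) -> L2closed (orthocomp S).
Proof.
move=> SL u g Hu Lg ug; split=> // h Sh.
apply: (@L2cvg_orth _ u) => //; last by move=> n; have [_ ->] := Hu n.
- by move=> n; have [] := Hu n.
- exact: SL.
Qed.

Lemma orthocomp_ae S f g : (forall h, S h -> L2 h) -> L2 g -> f = g %[ae m] ->
  orthocomp S f -> orthocomp S g.
Proof.
move=> SL Lg fg [Lf Hf]; split=> // h Sh; rewrite -(Hf _ Sh).
by apply: inner_ael => //; [exact: SL|exact: ae_eq_sym].
Qed.

Let zneg : set cfun := [set f | exists2 n : int, n < 0 & f = zpow n].

Let zneg_L2 h : zneg h -> L2 h.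
Proof. by move=> [n _ ->]; exact: L2_zpow. Qed.

Let H2_orthocomp : H2 = orthocomp zneg.
Proof.
apply/seteqP; split => f [Lf Hf]; split => //.
  by move=> _ [n n0 ->]; exact: Hf.
by move=> n n0; apply: Hf; exists n.
Qed.

Lemma H2_L2 f : H2 f -> L2 f. Proof. by case. Qed.

Lemma H2_lin_subspace : lin_subspace (H2 : set cfun).
Proof. by rewrite H2_orthocomp; exact: orthocomp_subspace. Qed.

Lemma H2_closed : L2closed (H2 : set cfun).
Proof. by rewrite H2_orthocomp; exact: orthocomp_closed. Qed.

Lemma H2_ae f g : L2 g -> f = g %[ae m] -> H2 f -> H2 g.
Proof. by move=> Lg fg; rewrite H2_orthocomp; exact: orthocomp_ae fg. Qed.

Lemma H2perp_subspace : lin_subspace (H2perp : set cfun).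
Proof. exact: (orthocomp_subspace H2_L2). Qed.

Lemma H2perp_closed : L2closed (H2perp : set cfun).
Proof. exact: (orthocomp_closed H2_L2). Qed.

Lemma H2_zpow (n : int) : 0 <= n -> H2 (zpow n : cfun).
Proof.
move=> n0; split; first exact: L2_zpow.
by move=> k k0; apply: inner_zpow; apply: contraTneq n0 => ->; rewrite -ltNge.
Qed.

Lemma Pplus_spec f : L2 f -> is_orth_proj H2 f (Pplus f).
Proof. by apply: proj_spec; [exact: H2_lin_subspace|exact: H2_closed]. Qed.

Lemma Pminus_spec f : L2 f -> is_orth_proj H2perp f (Pminus f).
Proof. by apply: proj_spec; [exact: H2perp_subspace|exact: H2perp_closed]. Qed.

(** The projection of [v] onto [H2] has no negative coefficients, and its other coefficients are
    those of [v]; by Fourier uniqueness it is null. *)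
Lemma H2perp_coef v : L2 v -> (forall n : int, 0 <= n -> inner v (zpow n) = 0) -> H2perp v.
Proof.
move=> Lv Hv; have [_ [Lp Hp] Ho] := Pplus_spec Lv.
have p0 : Pplus v = cst 0 %[ae m].
  apply: fourier_unique => // n; have [n0|n0] := ltP n 0; first exact: Hp.
  have := Ho _ (H2_zpow n0); rewrite innerBl ?Hv//; last exact: L2_zpow.
  by rewrite sub0r => /eqP; rewrite oppr_eq0 => /eqP.
split=> // h Hh; rewrite -(Ho _ Hh).
apply: inner_ael => //; [exact: L2B|exact: H2_L2|].
by apply: filterS p0 => w e1 /e1 e2; rewrite /= e2 subr0.
Qed.

Lemma H2perp_zpow (n : int) : n < 0 -> H2perp (zpow n : cfun).
Proof.
move=> n0; apply: H2perp_coef; first exact: L2_zpow.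
by move=> k k0; apply: inner_zpow; apply: contraTneq k0 => <-; rewrite -ltNge.
Qed.

Lemma H2_minus f : L2 f -> H2 (f \- Pminus f).
Proof.
move=> Lf; have [_ [Lq _] Ho] := Pminus_spec Lf; split; first exact: L2B.
by move=> n n0; apply: Ho; exact: H2perp_zpow.
Qed.

Lemma H2perp_conj u : H2 u -> H2perp (cconj (zvar \* u)).
Proof.
move=> [Lu Hu]; have Lzu : L2 (zvar \* u) by apply: L2M => //; exact: Linfty_zvar.
apply: H2perp_coef => [|n n0]; first exact: L2_conj.
(* The coefficient of index $n\ge0$ is the conjugate of the coefficient of [u] at $-n-1<0$. *)
rewrite -[n]opprK -cconj_zpow inner_cconj -zpow1 innerMr cconj_zpow -zpowD.
rewrite inner_conj ?Hu//; last exact: L2_zpow.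
  by apply: complex_inj; rewrite ?cReJ ?cImJ /= ?oppr0.
lia.
Qed.

(** Inner functions without analyticity, so that conjugates of inner functions qualify. *)
Definition unimodular u := Linfty u /\ \forall w \ae m, sqn (u w) = 1.

Lemma inner_function_unimodular u : inner_function u -> unimodular u.
Proof.
by move=> [[_ Lu] u1]; split=> //; apply: filterS u1 => w; exact: sqn_norm.
Qed.

Lemma unimodular_mulJ u : unimodular u -> \forall w \ae m, u w * cconj u w = 1.
Proof. by move=> [_]; apply: filterS => w; exact: mulcJ1. Qed.

Lemma unimodular_conj u : unimodular u -> unimodular (cconj u).
Proof.
move=> [Lu u1]; split; first exact: Linfty_conj.
by apply: filterS u1 => w; rewrite /cconj sqnJ.
Qed.

Lemma innerMM u f g : unimodular u -> L2 f -> L2 g ->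
  inner (u \* f) (u \* g) = inner f g.
Proof.
move=> Uu Lf Lg; have [Lu _] := Uu; rewrite innerMl; apply: inner_aer => //.
  by apply: L2M; [exact: Linfty_conj|exact: L2M].
apply: filterS (unimodular_mulJ Uu) => w E _ /=.
by rewrite mulrA [cconj _ _ * _]mulrC E mul1r.
Qed.

(** For $n<0$ the coefficient is $\langle f,\bar uz^n\rangle$, and $\bar uz^n=\overline{z\cdot
    z^{-n-1}u}$ is orthogonal to $H^2$ because $z^{-n-1}u\in H^2$. *)
Lemma H2M u f : Hinfty u -> H2 f -> H2 (u \* f).
Proof.
move=> [[Lu2 Hu] Lu] [Lf Hf]; split; first exact: L2M.
move=> n n0; rewrite innerMl -[zpow n]/(zpow n) -[n]opprK -cconj_zpow.
rewrite (_ : _ \* _ = cconj (zvar \* (zpow (- n - 1) \* u))).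
  rewrite inner_conj//.
    have H2zu : H2 (zpow (- n - 1) \* u).
      split; first by apply: L2M => //; exact: Linfty_zpow.
      move=> k k0; rewrite innerMl cconj_zpow -zpowD; apply: Hu; lia.
    have [_ ->] := H2perp_conj H2zu; last by [].
    by apply: complex_inj; rewrite ?cReJ ?cImJ /= ?oppr0.
  apply/L2_conj/L2M; first exact: Linfty_zvar.
  by apply: L2M => //; exact: Linfty_zpow.
apply/funext => w; rewrite /cconj /= -rmorphM /=; congr conjc.
by rewrite mulrA -zpow1 -[zpow 1 w * _]/((zpow 1 \* zpow (- n - 1)) w) -zpowD addrC subrK mulrC.
Qed.

End Hardy.

(** * Model spaces, their projections and conjugations *)

Section ModelSpace.
Context {R : realType}.
Local Notation m := (circle_measure R).
Local Notation cfun := (circle R -> R[i]).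
Local Notation Re := (@complex.Re R).
Local Notation Im := (@complex.Im R).
Implicit Types (f g h u v k a b t : cfun) (S : set cfun).

Lemma inner_Linfty t : inner_function t -> Linfty t.
Proof. by case=> -[]. Qed.

Lemma inner_Hinfty t : inner_function t -> Hinfty t.
Proof. by case. Qed.

Lemma inner_L2M t f : inner_function t -> L2 f -> L2 (t \* f).
Proof. by move=> It; exact/L2M/inner_Linfty. Qed.

Lemma inner_L2MJ t f : inner_function t -> L2 f -> L2 (cconj t \* f).
Proof. by move=> It; apply: L2M; exact/Linfty_conj/inner_Linfty. Qed.

Lemma inner_H2M t f : inner_function t -> H2 f -> H2 (t \* f).
Proof. by move=> It; exact/H2M/inner_Hinfty. Qed.

Lemma inner_mulJ t : inner_function t -> \forall w \ae m, t w * cconj t w = 1.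
Proof. by move=> It; exact/unimodular_mulJ/inner_function_unimodular. Qed.

Let mulH2 t : set cfun := [set g | exists2 h, H2 h & g = t \* h].

Let mulH2_L2 t h : inner_function t -> mulH2 t h -> L2 h.
Proof. by move=> It [k Hk ->]; exact/inner_L2M/H2_L2. Qed.

Let model_orthocomp t : model_space t = H2 `&` orthocomp (mulH2 t).
Proof.
apply/seteqP; split => f [Hf H]; split => //.
  by split; [exact: H2_L2|move=> _ [h Hh ->]; exact: H].
by case: H => _ H h Hh; apply: H; exists h.
Qed.

Lemma model_H2 t f : model_space t f -> H2 f. Proof. by case. Qed.

Lemma model_L2 t f : model_space t f -> L2 f. Proof. by move/model_H2/H2_L2. Qed.

Lemma model_subspace t : inner_function t -> lin_subspace (model_space t).
Proof.
move=> It; rewrite model_orthocomp.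
have [_ z1 D1 Z1] := @H2_lin_subspace R.
have [_ z2 D2 Z2] := orthocomp_subspace (fun h => @mulH2_L2 t h It).
split; first by move=> f [/H2_L2].
- by split.
- by move=> f g [? ?] [? ?]; split; [exact: D1|exact: D2].
- by move=> c f [? ?]; split; [exact: Z1|exact: Z2].
Qed.

Lemma model_closed t : inner_function t -> L2closed (model_space t).
Proof.
move=> It; rewrite model_orthocomp => u g Hu Lg ug; split.
  by apply: H2_closed ug => // n; have [] := Hu n.
by apply: (orthocomp_closed (fun h => @mulH2_L2 t h It)) ug => // n; have [] := Hu n.
Qed.

Lemma model_ae t f g : inner_function t -> L2 g -> f = g %[ae m] ->
  model_space t f -> model_space t g.
Proof.
move=> It Lg fg; rewrite model_orthocomp => -[H1 H2]; split; first exact: H2_ae fg H1.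
exact: (orthocomp_ae (fun h => @mulH2_L2 t h It)) fg H2.
Qed.

Lemma Pmodel_spec t f : inner_function t -> L2 f ->
  is_orth_proj (model_space t) f (Pmodel t f).
Proof.
by move=> It; apply: proj_spec; [exact: model_subspace|exact: model_closed].
Qed.

Lemma Pmodel_model t f : inner_function t -> L2 f -> model_space t (Pmodel t f).
Proof. by move=> It /(Pmodel_spec It)[]. Qed.

Lemma Pmodel_L2 t f : inner_function t -> L2 f -> L2 (Pmodel t f).
Proof. by move=> It /(Pmodel_model It)/model_L2. Qed.

Lemma Pmodel_orth t f k : inner_function t -> L2 f -> model_space t k ->
  inner (f \- Pmodel t f) k = 0.
Proof. by move=> It /(Pmodel_spec It)[_ _]; apply. Qed.

Lemma Pmodel_unique t f g : inner_function t -> L2 f -> model_space t g ->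
  (forall k, model_space t k -> inner (f \- g) k = 0) -> Pmodel t f = g %[ae m].
Proof.
move=> It Lf Kg H; apply: (is_orth_proj_unique (model_subspace It)).
  exact: Pmodel_spec.
by split.
Qed.

Lemma Pmodel_ae t f g : inner_function t -> L2 f -> L2 g -> f = g %[ae m] ->
  Pmodel t f = Pmodel t g.
Proof. by move=> It Lf Lg; apply: proj_ae => // h; exact: model_L2. Qed.

Lemma PmodelD t f g : inner_function t -> L2 f -> L2 g ->
  Pmodel t (f \+ g) = Pmodel t f \+ Pmodel t g %[ae m].
Proof.
move=> It Lf Lg; have [_ _ KD _] := model_subspace It.
apply: Pmodel_unique => //; [exact: L2D|by apply: KD; exact: Pmodel_model|].
move=> k Kk.
rewrite (_ : _ \- _ = (f \- Pmodel t f) \+ (g \- Pmodel t g)).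
  rewrite innerDl ?Pmodel_orth ?addr0//; try by apply: L2B => //; exact: Pmodel_L2.
  exact: model_L2 Kk.
by apply/funext => w /=; ring.
Qed.

Lemma PmodelB t f g : inner_function t -> L2 f -> L2 g ->
  Pmodel t (f \- g) = Pmodel t f \- Pmodel t g %[ae m].
Proof.
move=> It Lf Lg.
apply: Pmodel_unique => //; [exact: L2B| |].
  by apply: subspaceB; [exact: model_subspace|exact: Pmodel_model|exact: Pmodel_model].
move=> k Kk.
rewrite (_ : _ \- _ = (f \- Pmodel t f) \- (g \- Pmodel t g)).
  rewrite innerBl ?Pmodel_orth ?subrr//; try by apply: L2B => //; exact: Pmodel_L2.
  exact: model_L2 Kk.
by apply/funext => w /=; ring.
Qed.

Lemma inner_eq0_sym f g : L2 f -> L2 g -> inner f g = 0 -> inner g f = 0.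
Proof.
move=> Lf Lg H; rewrite inner_conj// H.
by apply: complex_inj; rewrite ?cReJ ?cImJ /= ?oppr0.
Qed.

Lemma nrm_Pmodel t f : inner_function t -> L2 f -> nrm (Pmodel t f) <= nrm f.
Proof.
move=> It Lf; have Lp := Pmodel_L2 It Lf; rewrite /nrm; apply: ler_wsqrtr.
have E : f = (f \- Pmodel t f) \+ Pmodel t f by apply/funext => w /=; rewrite subrK.
rewrite [X in _ <= nsq X]E nsqD//; last exact: L2B.
by rewrite Pmodel_orth ?mulr0 ?addr0 ?lerDr ?nsq_ge0//; exact: Pmodel_model.
Qed.

Lemma nrm_PmodelB t f g : inner_function t -> L2 f -> L2 g ->
  nrm (Pmodel t f \- Pmodel t g) <= nrm (f \- g).
Proof.
move=> It Lf Lg; have [Lpf Lpg] := (Pmodel_L2 It Lf, Pmodel_L2 It Lg).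
apply: le_trans (nrm_Pmodel It (L2B Lf Lg)); rewrite le_eqVlt.
apply/orP; left; apply/eqP/nrm_ae; [exact: L2B|exact/Pmodel_L2/L2B|].
exact/ae_eq_sym/PmodelB.
Qed.

(* [Pplus (a \* Pminus h)] differs from [a \* h] by the sum of an element of
   [H2perp] and of [a \* (h \- Pminus h)], which lies in [a H2]. *)
Lemma hankelt_Pminus a h : inner_function a -> L2 h ->
  hankelt a (Pminus h) = Pmodel a (a \* h) %[ae m].
Proof.
move=> Ia Lh; have Ua := inner_function_unimodular Ia.
have [_ [Lq Hq] Ho] := Pminus_spec Lh; set q := Pminus h in Lq Hq Ho *.
have Laq := inner_L2M Ia Lq.
have [_ Hp Hpo] := Pplus_spec Laq; rewrite /hankelt; set p := Pplus _ in Hp Hpo *.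
have Lp := H2_L2 Hp.
apply/ae_eq_sym/Pmodel_unique => //; first exact: inner_L2M.
  split=> // k Hk; have Lk := H2_L2 Hk.
  rewrite (_ : p = (a \* q) \- ((a \* q) \- p)); last first.
    by apply/funext => w /=; ring.
  rewrite innerBl//; [|exact: L2B|exact: inner_L2M].
  by rewrite innerMM// Hq// Hpo ?subrr//; exact: inner_H2M.
move=> k [Hk Kk]; have Lk := H2_L2 Hk.
rewrite (_ : (a \* h) \- p = (a \* (h \- q)) \+ ((a \* q) \- p)); last first.
  by apply/funext => w /=; ring.
rewrite innerDl//; [|exact/inner_L2M/L2B|exact: L2B].
rewrite Hpo// addr0; apply: inner_eq0_sym => //; first exact/inner_L2M/L2B.
by apply: Kk; exact: H2_minus.
Qed.

Lemma conjugationE t f : conjugation t f = t \* cconj (zvar \* f).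
Proof.
by apply/funext => w; rewrite /conjugation /cconj /= rmorphM /= mulrA.
Qed.

Lemma conjugation_swap t f g : inner (conjugation t f) g = inner (conjugation t g) f.
Proof.
rewrite !conjugationE; congr cintegral; apply/funext => w.
by rewrite /cconj /= !rmorphM /=; ring.
Qed.

Lemma conjugation_L2 t f : inner_function t -> L2 f -> L2 (conjugation t f).
Proof.
move=> It Lf; rewrite conjugationE; apply: inner_L2M => //.
by apply/L2_conj/L2M => //; exact: Linfty_zvar.
Qed.

(** The conjugation exchanges the two conditions defining $K_t$: the negative coefficients of $C_tf$
    are the products $\langle tz^{-n-1},f\rangle$, and orthogonality of $C_tf$ to $tH^2$ is that of
    $\overline{zf}$ to $H^2$. *)
Lemma conjugation_model t f : inner_function t -> model_space t f ->
  model_space t (conjugation t f).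
Proof.
move=> It [Hf Kf]; have Lf := H2_L2 Hf; have LC := conjugation_L2 It Lf.
have Lzf : L2 (zvar \* f) by apply: L2M => //; exact: Linfty_zvar.
split; first split=> // n n0.
  rewrite (_ : inner _ _ = inner (t \* zpow (- n - 1)) f).
    apply: inner_eq0_sym => //; first by apply: inner_L2M => //; exact: L2_zpow.
    by apply: Kf; apply: H2_zpow; lia.
  rewrite conjugationE /inner cconj_zpow; congr cintegral; apply/funext => w /=.
  by rewrite zpowD -(cconj_zpow 1) zpow1 /cconj /= rmorphM /=; ring.
move=> h Hh; rewrite conjugationE innerMM//; first last.
- exact: H2_L2.
- exact: L2_conj.
- exact: inner_function_unimodular.
by have [_] := H2perp_conj Hf; apply.
Qed.

Lemma conjugationB t f g :
  conjugation t f \- conjugation t g = conjugation t (f \- g).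
Proof.
rewrite !conjugationE; apply/funext => w; rewrite /cconj /=.
by rewrite mulrBr rmorphB /= mulrBr.
Qed.

Lemma nrm_conjugation t f : inner_function t -> L2 f -> nrm (conjugation t f) = nrm f.
Proof.
move=> It Lf; rewrite conjugationE; have [Lt t1] := inner_function_unimodular It.
have Lzf : L2 (zvar \* f) by apply: L2M => //; exact: Linfty_zvar.
rewrite nrm_unimod//; last exact: L2_conj.
rewrite nrm_conj nrm_unimod//; first exact: Linfty_zvar.
by apply: aeW => w; rewrite /zvar sqn_circle.
Qed.

Lemma conjugation_ae t f g : f = g %[ae m] -> conjugation t f = conjugation t g %[ae m].
Proof. by apply: filterS => w /[apply]; rewrite /conjugation => ->. Qed.

(** Since $\langle C_tf,g\rangle=\langle C_tg,f\rangle$ on all of $L^2$, a conjugation that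
    preserves $K_t$ also preserves its orthogonal complement. *)
Lemma Pmodel_conjugation t f : inner_function t -> L2 f ->
  Pmodel t (conjugation t f) = conjugation t (Pmodel t f) %[ae m].
Proof.
move=> It Lf; apply: Pmodel_unique => //; first exact: conjugation_L2.
  exact/conjugation_model/Pmodel_model.
move=> k Kk; have Lk := model_L2 Kk; have Lp := Pmodel_L2 It Lf.
rewrite conjugationB conjugation_swap; apply: inner_eq0_sym; first exact: L2B.
  exact: conjugation_L2.
by apply: Pmodel_orth => //; exact: conjugation_model.
Qed.

Lemma Linfty_conjugation t f : inner_function t -> Linfty f -> Linfty (conjugation t f).
Proof.
move=> It Lf; rewrite conjugationE; apply: LinftyM; first exact: inner_Linfty.
by apply/Linfty_conj/LinftyM => //; exact: Linfty_zvar.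
Qed.

(* [backward_shift t n] is the image of [t] under the [n]-th power of the backward
   shift; for [n > 0] these functions are bounded elements of the model space. *)
Fixpoint backward_shift t (n : nat) : cfun :=
  if n is n'.+1 then
    zpow (-1) \* (backward_shift t n' \- cst (inner (backward_shift t n') (zpow 0)))
  else t.

Lemma backward_shift_Hinfty t n : Hinfty t -> Hinfty (backward_shift t n).
Proof.
move=> Ht; elim: n => // n [[L2u Hu] Lu] /=; set c := inner _ _.
have Luc : Linfty (backward_shift t n \- cst c).
  rewrite (_ : _ \- _ = backward_shift t n \+ cst (- c)) //.
  by apply: LinftyD => //; exact: Linfty_cst.
have Lzu : Linfty (zpow (-1) \* (backward_shift t n \- cst c)).
  by apply: LinftyM => //; exact: Linfty_zpow.
split=> //; split; first exact: Linfty_L2.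
move=> k k0; rewrite innerMl cconj_zpow -zpowD.
rewrite innerBl//; [|exact: L2_cst|exact: L2_zpow].
have -> : cst c = cst c \* zpow 0 by rewrite zpow0; apply/funext => w /=; rewrite mulr1.
rewrite innerZl; [|exact: L2_zpow|exact: L2_zpow].
(* Removing the constant term matters only at index $-1$; below it, the index raised by one is still
   negative. *)
have [->|k1] := eqVneq k (-1).
  by rewrite (_ : - -1 + -1 = 0 :> int)// inner_zpow_diag mulr1 subrr.
rewrite Hu; last by lia.
by rewrite inner_zpow ?mulr0 ?subrr//; lia.
Qed.

(** This identifies the shift with the analytic part of $z^{-n}t$: each step multiplies the
    difference by $z^{-1}$ and adds a multiple of $z^{-1}$, and the result remains orthogonal to
    $H^2$. *)
Lemma backward_shift_H2perp t n : Hinfty t ->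
  H2perp (backward_shift t n \- (zpow (- n%:Z) \* t)).
Proof.
move=> Ht; have [[L2t _] Lt] := Ht.
elim: n => [|n IH].
  rewrite /= oppr0 zpow0 (_ : _ \- _ = cst 0); last first.
    by apply/funext => w /=; rewrite mul1r subrr.
  by have [_] := @H2perp_subspace R.
have [_ _ HD HZ] := @H2perp_subspace R.
rewrite /=; set c := inner _ _.
rewrite (_ : _ \- _ = (zpow (-1) \* (backward_shift t n \- (zpow (- n%:Z) \* t))) \+
   (cst (- c) \* zpow (-1))); last first.
  apply/funext => w /=; rewrite (_ : - n.+1%:Z = -1 + - n%:Z); last by lia.
  by rewrite zpowD /=; ring.
apply: HD; last by apply: HZ; exact: H2perp_zpow.
have [L H] := IH; split; first by apply: L2M => //; exact: Linfty_zpow.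
move=> h Hh; rewrite innerMl cconj_zpow; apply: H; apply: H2M => //.
by split; [exact: H2_zpow|exact: Linfty_zpow].
Qed.

(** Against $th$ the shift may be replaced by $z^{-n-1}t$, which leaves $\langle
    z^{-n-1},h\rangle=0$. *)
Lemma backward_shift_model t n : inner_function t ->
  model_space_infty t (backward_shift t n.+1).
Proof.
move=> It; have Ht := inner_Hinfty It; have [[L2t _] Lt] := Ht.
split; last exact: backward_shift_Hinfty.
have [[H2s Ls]] := backward_shift_Hinfty n.+1 Ht; split => //.
move=> h Hh; have Lh := H2_L2 Hh.
have [Lr Hr] := backward_shift_H2perp n.+1 Ht.
rewrite (_ : backward_shift t n.+1 = (backward_shift t n.+1 \- (zpow (- n.+1%:Z) \* t)) \+
    (t \* zpow (- n.+1%:Z))); last first.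
  by apply/funext => w /=; ring.
have Lz := @L2_zpow R (- n.+1%:Z).
rewrite innerDl//; [|exact: inner_L2M|exact: inner_L2M].
rewrite Hr; last exact: inner_H2M.
rewrite add0r innerMM//; last exact: inner_function_unimodular.
by apply: inner_eq0_sym => //; case: Hh => _; apply; lia.
Qed.

Lemma model_space_infty_subspace t : inner_function t -> lin_subspace (model_space_infty t).
Proof.
move=> It; have [KL K0 KD KZ] := model_subspace It; have [_ H0 HD HZ] := @H2_lin_subspace R.
split.
- by move=> f [/KL].
- by split=> //; split=> //; exact: Linfty_cst.
- move=> f g [Kf [Hf Lf]] [Kg [Hg Lg]]; split; first exact: KD.
  by split; [exact: HD|exact: LinftyD].
- move=> c f [Kf [Hf Lf]]; split; first exact: KZ.
  by split; [exact: HZ|apply: LinftyM => //; exact: Linfty_cst].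
Qed.

(** If [g] in $K_t$ is orthogonal to the shifts, then $\langle\bar tg,z^n\rangle=\langle
    g,tz^n\rangle=0$ for all $n$: for $n\ge0$ by definition of $K_t$, for $n<0$ because $tz^n$
    differs from a shift by an element orthogonal to $H^2$. *)
Lemma model_space_infty_dense t f : inner_function t -> model_space t f ->
  forall e : R, 0 < e -> exists2 h, model_space_infty t h & nrm (h \- f) < e.
Proof.
move=> It Kf; apply: (dense_of_orth (model_space_infty_subspace It)
  (model_subspace It) (model_closed It) _ Kf) => [h []//|].
move=> g [Hg Kg] H; have Ht := inner_Hinfty It.
have Ut := inner_function_unimodular It; have [[L2t _] Lt] := Ht.
have Lg := H2_L2 Hg; have Ltg := inner_L2MJ It Lg.
suff tg0 : cconj t \* g = cst 0 %[ae m].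
  apply: filterS2 tg0 (inner_mulJ It) => w e1 E I.
  by rewrite -[LHS]mul1r -E -mulrA [X in _ * X]e1//= mulr0.
apply: fourier_unique => // n; rewrite innerMl.
rewrite (_ : cconj (cconj t) = t); last by apply/funext => w; rewrite /cconj conjcK.
have [n0|n0] := leP 0 n; first by apply: Kg; exact: H2_zpow.
have -> : n = - `|n|%N.-1.+1%:Z by lia.
set k := `|n|%N.-1.
have [Lr Hr] := backward_shift_H2perp k.+1 Ht.
have [_ [Hs _]] := backward_shift_model k It.
have LHs := H2_L2 Hs.
rewrite (_ : t \* zpow _ = backward_shift t k.+1 \-
    (backward_shift t k.+1 \- (zpow (- k.+1%:Z) \* t))); last first.
  by apply/funext => w /=; ring.
rewrite innerBr// H; last exact: backward_shift_model.
by rewrite (inner_eq0_sym Lr Lg) ?subrr// Hr.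
Qed.

End ModelSpace.

(** * Truncated Toeplitz operators *)

Section Factorization.
Context {R : realType}.
Local Notation m := (circle_measure R).
Local Notation cfun := (circle R -> R[i]).
Variables (a b t : circle R -> R[i]).
Hypotheses (Ia : inner_function a) (Ib : inner_function b) (It : inner_function t).
Hypothesis tE : t = a \* b %[ae m].
Implicit Types (f g h k : cfun).

Lemma model_orth_mul k h : model_space a k -> H2 h -> inner (a \* h) k = 0.
Proof.
move=> [Hk Kk] Hh; apply: inner_eq0_sym; [exact: H2_L2|exact/inner_L2M/H2_L2|exact: Kk].
Qed.

Lemma inner_factorr f h : L2 f -> L2 h -> inner f (t \* h) = inner f (a \* (b \* h)).
Proof.
move=> Lf Lh; apply: inner_aer => //; [exact: inner_L2M|exact/inner_L2M/inner_L2M|].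
by apply: filterS tE => w e I; rewrite /= (e I) /= mulrA.
Qed.

Lemma model_factorl k : model_space a k -> model_space t k.
Proof.
move=> [Hk Kk]; split=> // h Hh; rewrite inner_factorr; try exact: H2_L2.
by apply: Kk; exact: inner_H2M.
Qed.

Lemma model_factorr k : model_space b k -> model_space t (a \* k).
Proof.
move=> [Hk Kk]; split=> [|h Hh]; first exact: inner_H2M.
rewrite inner_factorr; [|exact/inner_L2M/H2_L2|exact: H2_L2].
rewrite innerMM ?Kk//; [exact: inner_function_unimodular|exact: H2_L2|].
exact/inner_L2M/H2_L2.
Qed.

Lemma conj_model_H2perp k : model_space a k -> H2perp (cconj a \* k).
Proof.
move=> [Hk Kk]; split; first exact/inner_L2MJ/H2_L2.
by move=> h Hh; rewrite -innerMr; exact: Kk.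
Qed.

(** Take for $k_2$ the analytic part of $\bar ak$: the rest of $\bar ak$ is orthogonal to $H^2$,
    which puts $k-ak_2$ in $K_a$. *)
Lemma model_decomp k : model_space t k -> exists k1 k2,
  [/\ model_space a k1, model_space b k2 & k = k1 \+ (a \* k2) %[ae m]].
Proof.
move=> [Hk Kk]; have Lk := H2_L2 Hk.
have Lak := inner_L2MJ Ia Lk.
have [_ Hq Ho] := Pplus_spec Lak; set q := Pplus _ in Hq Ho *; have Lq := H2_L2 Hq.
have Haq := inner_H2M Ia Hq; have Laq := H2_L2 Haq.
exists (k \- (a \* q)), q; split.
- split=> [|h Hh]; first exact: (subspaceB H2_lin_subspace).
  have Lh := H2_L2 Hh.
  rewrite innerBl//; last exact: inner_L2M.
  rewrite innerMM//; last exact: inner_function_unimodular.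
  by rewrite innerMr -innerBl// Ho.
- split=> // h Hh; have Lh := H2_L2 Hh; have Lbh := inner_L2M Ib Lh.
  rewrite (_ : q = (cconj a \* k) \- ((cconj a \* k) \- q)); last first.
    by apply/funext => w /=; ring.
  rewrite innerBl//; last exact: L2B.
  rewrite Ho; last exact: inner_H2M.
  by rewrite -innerMr -inner_factorr// Kk// subrr.
by apply: aeW => w _ /=; rewrite subrK.
Qed.

(** Tested against $k=k_1+ak_2$, the cross terms vanish because $K_a$ is orthogonal to $aH^2$. *)
Lemma Pmodel_factor g : L2 g ->
  Pmodel t g = Pmodel a g \+ (a \* Pmodel b (cconj a \* g)) %[ae m].
Proof.
move=> Lg; have Lag := inner_L2MJ Ia Lg.
have K1 := Pmodel_model Ia Lg; have K2 := Pmodel_model Ib Lag.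
set p1 := Pmodel a g in K1 *; set p2 := Pmodel b _ in K2 *.
have L1 := model_L2 K1; have L2' := model_L2 K2.
have [_ _ KD _] := model_subspace It.
apply: Pmodel_unique => //.
  by apply: KD; [exact: model_factorl|exact: model_factorr].
move=> k Kk; have [k1 [k2 [Kk1 Kk2 kE]]] := model_decomp Kk.
have Lk := model_L2 Kk; have Lk1 := model_L2 Kk1; have Lk2 := model_L2 Kk2.
have Lap := inner_L2M Ia L2'.
have Lak2 := inner_L2M Ia Lk2.
rewrite (@inner_aer _ _ _ (k1 \+ (a \* k2)))//; [|exact/L2B/L2D|exact: L2D].
rewrite innerDr//; last exact/L2B/L2D.
rewrite (_ : g \- _ = (g \- p1) \- (a \* p2)); last by apply/funext => w /=; ring.
rewrite innerBl//; [|exact: L2B].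
rewrite Pmodel_orth// (model_orth_mul Kk1) ?subr0 ?add0r; last exact: model_H2 K2.
rewrite (_ : _ \- _ = (g \- (a \* p2)) \- p1); last by apply/funext => w /=; ring.
rewrite innerBl//; [|exact: L2B].
rewrite (_ : inner p1 _ = 0) ?subr0; last first.
  by have [_] := K1; apply; exact: model_H2 Kk2.
rewrite innerBl// innerMM//; last exact: inner_function_unimodular.
by rewrite innerMr -innerBl// Pmodel_orth.
Qed.

Section Components.
Variables (f f1 f2 : cfun).
Hypotheses (Lf : L2 f) (K1 : model_space a f1) (K2 : model_space b f2).
Hypothesis fE : f = f1 \+ (a \* f2) %[ae m].

Let L1 : L2 f1. Proof. exact: model_L2 K1. Qed.
Let L2' : L2 f2. Proof. exact: model_L2 K2. Qed.

Lemma Pmodel_component1 : Pmodel a f = f1 %[ae m].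
Proof.
have La2 := inner_L2M Ia L2'.
apply: Pmodel_unique => // k Kk; have Lk := model_L2 Kk.
rewrite (@inner_ael _ _ (a \* f2))//; [|exact: L2B|].
  by apply: model_orth_mul => //; exact: model_H2 K2.
by apply: filterS fE => w e I; rewrite /= (e I) /=; ring.
Qed.

Lemma Pmodel_component2 : Pmodel b (cconj a \* f) = f2 %[ae m].
Proof.
have Laf := inner_L2MJ Ia Lf; have La1 := inner_L2MJ Ia L1.
apply: Pmodel_unique => // k Kk; have Lk := model_L2 Kk.
rewrite (@inner_ael _ _ (cconj a \* f1))//; [|exact: L2B|].
  by have [_] := conj_model_H2perp K1; apply; exact: model_H2 Kk.
apply: filterS2 fE (inner_mulJ Ia) => w e E I; rewrite /= (e I) /=.
by rewrite mulrDr mulrA [cconj a w * a w]mulrC E mul1r addrK.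
Qed.

(** Since $t\bar a=b$ almost everywhere, $C_t$ carries the decomposition $K_a\oplus aK_b$ to
    $K_b\oplus bK_a$. *)
Lemma conjugation_components :
  conjugation t f = (b \* conjugation a f1) \+ conjugation b f2 %[ae m].
Proof.
apply: filterS3 fE tE (inner_mulJ Ia) => w e e' E I.
rewrite !conjugationE /= e'// /cconj /= e//= -!/(cconj _ _).
rewrite !rmorphM rmorphD rmorphM /= -/(cconj a w).
rewrite !mulrDr; congr (_ + _); first by ring.
transitivity (a w * cconj a w * (b w * (conjc (zvar w) * conjc (f2 w)))); first by ring.
by rewrite E mul1r.
Qed.

(** The definition chooses some decomposition of [f]; any two agree almost everywhere, as the
    components are recovered from [f] as $P_af$ and $P_b(\bar af)$. *)
Lemma conjugation2_components :
  conjugation2 a b f = conjugation a f1 \+ (a \* conjugation b f2) %[ae m].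
Proof.
rewrite /conjugation2; set X := [set u | _].
have [X1 X2 X3] : X (xget (cst 0, cst 0) X) by apply: (@xgetPex _ _ X); exists (f1, f2).
move: (xget _ _) X1 X2 X3 => [u1 u2] /= X1 X2 X3; clear X.
suff [e1 e2] : u1 = f1 %[ae m] /\ u2 = f2 %[ae m].
  by apply: filterS2 e1 e2 => w e1 e2 I; rewrite /= /conjugation (e1 I) e2.
have La1 := model_L2 X1; have La2 := model_L2 X2; have Lg := inner_L2M Ia La2.
split.
  apply: ae_eq_trans Pmodel_component1; apply: ae_eq_sym.
  apply: Pmodel_unique => // k Kk; have Lk := model_L2 Kk.
  rewrite (@inner_ael _ _ (a \* u2))//; [|exact: L2B|].
    by apply: model_orth_mul => //; exact: model_H2 X2.
  by apply: filterS X3 => w e I; rewrite /= (e I) /=; ring.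
apply: ae_eq_trans Pmodel_component2; apply: ae_eq_sym.
have Laf := inner_L2MJ Ia Lf; have La1' := inner_L2MJ Ia La1.
apply: Pmodel_unique => // k Kk; have Lk := model_L2 Kk.
rewrite (@inner_ael _ _ (cconj a \* u1))//; [|exact: L2B|].
  by have [_] := conj_model_H2perp X1; apply; exact: model_H2 Kk.
apply: filterS2 X3 (inner_mulJ Ia) => w e E I; rewrite /= (e I) /=.
by rewrite mulrDr mulrA [cconj a w * a w]mulrC E mul1r addrK.
Qed.

End Components.

(** Replacing the choice of components by projections makes values at different points
    comparable. *)
Lemma conjugation2E f : model_space t f -> conjugation2 a b f =
  conjugation a (Pmodel a f) \+ (a \* conjugation b (Pmodel b (cconj a \* f))) %[ae m].
Proof.
move=> Kf; have Lf := model_L2 Kf.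
have [f1 [f2 [K1 K2 fE]]] := model_decomp Kf.
apply: ae_eq_trans (conjugation2_components Lf K1 K2 fE) _.
have e1 := Pmodel_component1 Lf K1 K2 fE; have e2 := Pmodel_component2 Lf K1 K2 fE.
by apply: filterS2 e1 e2 => w e1 e2 I; rewrite /= /conjugation (e1 I) e2.
Qed.

Lemma model_components g1 g2 : model_space a g1 -> model_space b g2 ->
  model_space t (g1 \+ (a \* g2)).
Proof.
move=> K1 K2; have [_ _ KD _] := model_subspace It.
by apply: KD; [exact: model_factorl|exact: model_factorr].
Qed.

End Factorization.

(** * Bounded truncated Toeplitz operators and their adjoints *)

Section TruncatedToeplitz.
Context {R : realType}.
Local Notation m := (circle_measure R).
Local Notation cfun := (circle R -> R[i]).
Local Notation Re := (@complex.Re R).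
Implicit Types (a t phi f g h k : cfun).

Lemma model_infty_dom t phi f : L2 phi -> model_space_infty t f -> tto_dom t phi f.
Proof.
move=> Lp [Kf [_ Lf]]; split=> //.
rewrite (_ : _ \* _ = f \* phi); first exact: L2M.
by apply/funext => w /=; rewrite mulrC.
Qed.

Lemma tto_dom_dense t phi f : inner_function t -> L2 phi -> model_space t f ->
  forall e : R, 0 < e -> exists2 h, tto_dom t phi h & nrm (h \- f) < e.
Proof.
move=> It Lp Kf e e0; have [h Kh hf] := model_space_infty_dense It Kf e0.
by exists h => //; exact: model_infty_dom.
Qed.

Lemma tto_domB t phi f g : inner_function t -> tto_dom t phi f -> tto_dom t phi g ->
  tto_dom t phi (f \- g).
Proof.
move=> It [Kf Lf] [Kg Lg]; split; first exact: subspaceB (model_subspace It) Kf Kg.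
rewrite (_ : _ \* _ = (phi \* f) \- (phi \* g)); first exact: L2B.
by apply/funext => w /=; rewrite mulrBr.
Qed.

Lemma tto_boundedP t a phi : inner_function a -> tto_bounded t a phi <->
  exists2 c : R, 0 <= c & forall f, tto_dom t phi f -> nrm (Pmodel a (phi \* f)) <= c * nrm f.
Proof.
move=> Ia; split=> [[c H]|[c c0 H]].
  exists (Num.max c 0); first by rewrite le_max lexx orbT.
  move=> f Df; have [Kf Lf] := Df; have := H f Df.
  rewrite /tto_pre !cLnorm2; [|exact: model_L2 Kf|exact: Pmodel_L2].
  rewrite -EFinM lee_fin => /le_trans; apply.
  by rewrite ler_wpM2r ?nrm_ge0// le_max lexx.
exists c => f Df; have [Kf Lf] := Df.
rewrite /tto_pre !cLnorm2; [|exact: model_L2 Kf|exact: Pmodel_L2].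
by rewrite -EFinM lee_fin H.
Qed.

(* The adjoint is controlled by duality: for [h] in the dense space of bounded
   functions, [<P_t (conj phi f), h> = <f, P_a (phi h)>]. *)
Lemma tto_bounded_adjoint t a phi : inner_function a -> inner_function t -> L2 phi ->
  tto_bounded t a phi -> tto_bounded a t (cconj phi).
Proof.
move=> Ia It Lp /(tto_boundedP _ _ Ia)[c c0 H]; apply/tto_boundedP => //.
exists c => // f [Kf Lpf]; have Lf := model_L2 Kf.
have Kg := Pmodel_model It Lpf; set g := Pmodel t _ in Kg *; have Lg := model_L2 Kg.
have [->|g0] := eqVneq (nrm g) 0; first by rewrite mulr_ge0// nrm_ge0.
have {}g0 : 0 < nrm g by rewrite lt_def g0 nrm_ge0.
suff key : nsq g <= c * nrm f * nrm g.
  by rewrite -(ler_pM2r g0) -expr2 nrm_sqr.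
have s0 : 0 < c * nrm f + nrm g by rewrite ltr_wpDl// mulr_ge0// nrm_ge0.
suff bound (e : R) : 0 < e -> nsq g <= c * nrm f * nrm g + (c * nrm f + nrm g) * e.
  apply/ler_addgt0Pr => e e0; have := bound (e / (c * nrm f + nrm g)) (divr_gt0 e0 s0).
  by rewrite mulrCA mulfV ?mulr1// gt_eqF.
(* The product of [phi] and [g] may fail to be square integrable, so duality is applied to a bounded
   [h] within [e] of [g]. *)
move=> e0; have [h Kh hg] := model_space_infty_dense It Kg e0.
have Dh := model_infty_dom Lp Kh; have [Kh' Lph] := Dh; have Lh := model_L2 Kh'.
have gh : inner g h = inner f (Pmodel a (phi \* h)).
  have -> : inner g h = inner (cconj phi \* f) h.
    have := Pmodel_orth It Lpf Kh'; rewrite innerBl// => /eqP.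
    by rewrite subr_eq0 => /eqP ->.
  rewrite -innerMr; have := Pmodel_orth Ia Lph Kf.
  have Lq := Pmodel_L2 Ia Lph.
  move=> /(inner_eq0_sym (L2B Lph Lq) Lf); rewrite innerBr// => /eqP.
  by rewrite subr_eq0 => /eqP.
have -> : nsq g = Re (inner g h) + Re (inner g (g \- h)).
  rewrite /nsq -cReD -innerDr//; last exact: L2B.
  by congr (Re (inner _ _)); apply/funext => w /=; ring.
have i1 : Re (inner g h) <= c * nrm f * (nrm g + e).
  rewrite gh; apply: le_trans (Re_inner_le Lf (Pmodel_L2 Ia Lph)) _.
  rewrite mulrC [c * _]mulrC -mulrA.
  rewrite [X in X <= _]mulrC; apply: ler_wpM2l; first exact: nrm_ge0.
  apply: le_trans (H _ Dh) _; apply: ler_wpM2l => //.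
  have := nrmD (L2B Lh Lg) Lg; rewrite (_ : (h \- g) \+ g = h); last first.
    by apply/funext => w /=; rewrite subrK.
  by move=> /le_trans; apply; rewrite addrC lerD2l ltW.
have i2 : Re (inner g (g \- h)) <= nrm g * e.
  apply: le_trans (Re_inner_le Lg (L2B Lg Lh)) _.
  by rewrite ler_wpM2l ?nrm_ge0// nrm_distC ltW.
by apply: le_trans (lerD i1 i2) _; rewrite mulrDl mulrDr addrA.
Qed.

Section BoundedTTO.
Variables (a t phi : circle R -> R[i]).
Hypotheses (Ia : inner_function a) (It : inner_function t).
Hypotheses (Lphi : L2 phi) (Ab : tto_bounded t a phi).

Let DT h : tto_dom t phi h -> L2 h /\ L2 (tto_pre a phi h).
Proof. by move=> [Kh Lh]; split; [exact: model_L2 Kh|exact: Pmodel_L2]. Qed.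

Let lip_pre (c : R) :
  (forall f, tto_dom t phi f -> nrm (Pmodel a (phi \* f)) <= c * nrm f) ->
  forall h k, tto_dom t phi h -> tto_dom t phi k ->
    nrm (tto_pre a phi h \- tto_pre a phi k) <= c * nrm (h \- k).
Proof.
move=> H h k Dh Dk; have [_ Lh] := Dh; have [_ Lk] := Dk.
have Dhk := tto_domB It Dh Dk; have [_ Lhk] := Dhk.
apply: le_trans (H _ Dhk); rewrite le_eqVlt; apply/orP; left; apply/eqP/nrm_ae.
- by apply: L2B; exact: Pmodel_L2.
- exact: Pmodel_L2.
- rewrite (_ : phi \* (h \- k) = (phi \* h) \- (phi \* k)).
    exact/ae_eq_sym/PmodelB.
  by apply/funext => w /=; rewrite mulrBr.
Qed.

Lemma tto_spec f : model_space t f -> model_space a (tto t a phi f) /\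
  is_cont_ext (tto_dom t phi) (tto_pre a phi) f (tto t a phi f).
Proof.
move=> Kf; have [c c0 H] := (tto_boundedP t phi Ia).1 Ab.
apply: (@xgetPex _ (cst 0) [set g | model_space a g /\
  is_cont_ext (tto_dom t phi) (tto_pre a phi) f g]).
have [g [Lg [u uD ug] gP]] := cont_ext_exists c0 DT (lip_pre H) (model_L2 Kf)
  (tto_dom_dense It Lphi Kf).
exists g; split=> //; apply: (model_closed Ia _ Lg ug) => n.
by have [_ L] := uD n; exact: Pmodel_model.
Qed.

Lemma tto_model f : model_space t f -> model_space a (tto t a phi f).
Proof. by move/tto_spec => []. Qed.

Lemma tto_lip : exists2 c : R, 0 <= c & forall f g, model_space t f -> model_space t g ->
  nrm (tto t a phi f \- tto t a phi g) <= c * nrm (f \- g).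
Proof.
have [c c0 H] := (tto_boundedP t phi Ia).1 Ab; exists c => // f g Kf Kg.
have [K1 E1] := tto_spec Kf; have [K2 E2] := tto_spec Kg.
by apply: (cont_ext_lip c0 DT (lip_pre H) _ _ _ _ E1 E2); apply: model_L2; eassumption.
Qed.

(** Both sides are values at [f] of the extension by continuity, so their distance is at most [c]
    times $\|f-f\|$. *)
Lemma tto_domE f : tto_dom t phi f -> tto t a phi f = Pmodel a (phi \* f) %[ae m].
Proof.
move=> Df; have [Kf Lf] := Df; have [c c0 H] := (tto_boundedP t phi Ia).1 Ab.
have [K1 E1] := tto_spec Kf; have Lf' := model_L2 Kf.
have E2 := cont_ext_self c0 DT (lip_pre H) Df.
have Lp := Pmodel_L2 Ia Lf.
apply: nrmB_eq0 => //; first exact: model_L2 K1.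
have := cont_ext_lip c0 DT (lip_pre H) Lf' Lf' (model_L2 K1) Lp E1 E2.
rewrite (_ : f \- f = cst 0); last by apply/funext => w /=; rewrite subrr.
by rewrite nrm_cst0 mulr0 => h0; apply/eqP; rewrite eq_le h0 nrm_ge0.
Qed.

End BoundedTTO.

End TruncatedToeplitz.

(** * Lipschitz maps and equality by continuous extension *)

Section EqContExt.
Context {R : realType}.
Local Notation m := (circle_measure R).
Local Notation cfun := (circle R -> R[i]).
Implicit Types (K D : set cfun) (T S : cfun -> cfun).

(** Lipschitz bounds treat linear and antilinear maps alike and do not require chosen
    representatives to be additive. *)
Definition lip_maps K K' T : Prop :=
  (forall f, K f -> K' (T f)) /\
  exists2 c : R, 0 <= c & forall f g, K f -> K g -> nrm (T f \- T g) <= c * nrm (f \- g).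

Lemma lip_maps_comp K K' K'' S T : lip_maps K K' S -> lip_maps K' K'' T ->
  lip_maps K K'' (fun f => T (S f)).
Proof.
move=> [KS [c c0 cS]] [KT [d d0 dT]]; split; first by move=> f /KS /KT.
exists (d * c); first exact: mulr_ge0.
move=> f g Kf Kg; apply: le_trans (dT _ _ (KS _ Kf) (KS _ Kg)) _.
by rewrite -mulrA ler_wpM2l// cS.
Qed.

Lemma lip_mapsW K K' K'' T : (forall f, K' f -> K'' f) -> lip_maps K K' T -> lip_maps K K'' T.
Proof. by move=> KK [KT H]; split=> // f /KT /KK. Qed.

Lemma lip_mapsB K S T : lip_maps K L2 S -> lip_maps K L2 T ->
  lip_maps K L2 (fun f => S f \- T f).
Proof.
move=> [KS [c c0 cS]] [KT [d d0 dT]].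
split; first by move=> f Kf; apply: L2B; [exact: KS|exact: KT].
exists (c + d); first exact: addr_ge0.
move=> f g Kf Kg.
have [LSf LSg] := (KS _ Kf, KS _ Kg); have [LTf LTg] := (KT _ Kf, KT _ Kg).
rewrite (_ : _ \- _ = (S f \- S g) \+ (T g \- T f)); last first.
  by apply/funext => w /=; ring.
apply: le_trans (nrmD (L2B LSf LSg) (L2B LTg LTf)) _.
by rewrite (nrm_distC (T g) (T f)) mulrDl; apply: lerD; [exact: cS|exact: dT].
Qed.

Lemma lip_maps_restrict K0 K K' T : (forall f, K0 f -> K f) -> lip_maps K K' T ->
  lip_maps K0 K' T.
Proof.
by move=> KK [KT [c c0 H]]; split=> [f /KK/KT//|]; exists c => // f g /KK Kf /KK; exact: H.
Qed.

(** All continuity is read off [T1], which is Lipschitz on the whole of [K]; the values of [T2] on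
    [D] inherit it by agreement. *)
Lemma eq_cont_extI K D T1 T2 : (forall f, K f -> L2 f) -> (forall f, D f -> K f) ->
  (forall f, K f -> forall e : R, 0 < e -> exists2 h, D h & nrm (h \- f) < e) ->
  lip_maps K L2 T1 -> (forall f, D f -> L2 (T2 f)) ->
  (forall f, D f -> T1 f = T2 f %[ae m]) -> eq_cont_ext K D T1 T2.
Proof.
move=> KL DK Dd [KT [c c0 cT]] LT2 E; split=> // f Kf.
have p0 : 0 < c + 1 by rewrite ltr_wpDl.
apply/cont_extP; [by move=> h Dh; split; [exact/KL/DK|exact: LT2]|exact: KL|exact: KT|].
split; first exact: Dd.
move=> e e0; exists (e / (c + 1)); first by rewrite divr_gt0.
move=> h Dh; have Kh := DK _ Dh; rewrite ltr_pdivlMr// => hf.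
rewrite (@nrm_ae _ _ (T1 h \- T1 f)); first last.
- by apply: filterS (E _ Dh) => w e1 I; rewrite /= e1.
- by apply: L2B; exact: KT.
- by apply: L2B; [exact: LT2|exact: KT].
apply: le_lt_trans (cT _ _ Kh Kf) _; apply: le_lt_trans hf.
by rewrite mulrC ler_wpM2l ?nrm_ge0// lerDl.
Qed.

End EqContExt.

Section Maps.
Context {R : realType}.
Local Notation m := (circle_measure R).
Local Notation cfun := (circle R -> R[i]).
Implicit Types (f g phi : cfun).
Variables (a b t : circle R -> R[i]).
Hypotheses (Ia : inner_function a) (Ib : inner_function b) (It : inner_function t).
Hypothesis tE : t = a \* b %[ae m].

Lemma lip_conjugation : lip_maps (model_space t) (model_space t) (conjugation t).
Proof.
split; first by move=> f; exact: conjugation_model.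
exists 1 => // f g Kf Kg; rewrite conjugationB nrm_conjugation ?mul1r//.
by apply: L2B; apply: model_L2; eassumption.
Qed.

Lemma lip_Pmodel : lip_maps L2 (model_space t) (Pmodel t).
Proof.
split; first by move=> f; exact: Pmodel_model.
by exists 1 => // f g Lf Lg; rewrite mul1r nrm_PmodelB.
Qed.

Lemma lip_mul : lip_maps L2 L2 (fun f : cfun => t \* f).
Proof.
split; first by move=> f; exact: inner_L2M.
exists 1 => // f g Lf Lg.
rewrite (_ : (t \* f) \- (t \* g) = t \* (f \- g)); last first.
  by apply/funext => w /=; rewrite mulrBr.
have [Lt t1] := inner_function_unimodular It.
by rewrite mul1r nrm_unimod//; exact: L2B.
Qed.

Lemma lip_mulJ : lip_maps L2 L2 (fun f : cfun => cconj t \* f).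
Proof.
split; first by move=> f; exact: inner_L2MJ.
exists 1 => // f g Lf Lg.
rewrite (_ : (cconj t \* f) \- (cconj t \* g) = cconj t \* (f \- g)); last first.
  by apply/funext => w /=; rewrite mulrBr.
have [Lt t1] := unimodular_conj (inner_function_unimodular It).
by rewrite mul1r nrm_unimod//; exact: L2B.
Qed.

Lemma lip_tto phi : L2 phi -> tto_bounded t a phi ->
  lip_maps (model_space t) (model_space a) (tto t a phi).
Proof.
move=> Lp Ab; split; first by move=> f; exact: tto_model.
exact: tto_lip.
Qed.

Lemma conjugation2_model f : model_space t f -> model_space t (conjugation2 a b f).
Proof.
move=> Kf; have Lf := model_L2 Kf; have [f1 [f2 [K1 K2 fE]]] := model_decomp Ia Ib It tE Kf.
rewrite /conjugation2; set X := [set u | _].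
have [X1 X2 X3] : X (xget (cst 0, cst 0) X) by apply: (@xgetPex _ _ X); exists (f1, f2).
by apply: (model_components Ia Ib It tE); exact: conjugation_model.
Qed.

Lemma lip_conjugation2 : lip_maps (model_space t) (model_space t) (conjugation2 a b).
Proof.
split; first by move=> f; exact: conjugation2_model.
exists 2 => // f g Kf Kg; have [Lf Lg] := (model_L2 Kf, model_L2 Kg).
have L2c h : model_space t h -> L2 (conjugation2 a b h).
  by move/conjugation2_model/model_L2.
have LA h : L2 h -> L2 (conjugation a (Pmodel a h)).
  by move=> Lh; apply: conjugation_L2 => //; exact: Pmodel_L2.
have LB h : L2 h -> L2 (conjugation b (Pmodel b (cconj a \* h))).
  by move=> Lh; apply: conjugation_L2 => //; apply: Pmodel_L2 => //; exact: inner_L2MJ.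
pose A h := conjugation a (Pmodel a h).
pose B h := a \* conjugation b (Pmodel b (cconj a \* h)).
(* Each of the two components is 1-Lipschitz, whence the constant 2. *)
rewrite (@nrm_ae _ _ ((A f \- A g) \+ (B f \- B g))); first last.
- apply: filterS2 (conjugation2E Ia Ib It tE Kf) (conjugation2E Ia Ib It tE Kg) => w e1 e2 I.
  by rewrite /= (e1 I) (e2 I) /= /A /B /=; ring.
- by apply: L2D; apply: L2B; do ?[exact: LA|apply: inner_L2M => //; exact: LB].
- by apply: L2B; exact: L2c.
apply: le_trans (nrmD _ _) _.
- by apply: L2B; exact: LA.
- by apply: L2B; apply: inner_L2M => //; exact: LB.
rewrite mulr_natl mulr2n; apply: lerD.
  rewrite /A conjugationB nrm_conjugation//; first exact: nrm_PmodelB.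
  by apply: L2B; exact: Pmodel_L2.
rewrite (_ : B f \- B g = a \* (conjugation b (Pmodel b (cconj a \* f)) \-
    conjugation b (Pmodel b (cconj a \* g)))); last first.
  by apply/funext => w; rewrite /B /= -mulrBr.
have [La a1] := inner_function_unimodular Ia.
rewrite nrm_unimod//; last by apply: L2B; exact: LB.
have [Laf Lag] := (inner_L2MJ Ia Lf, inner_L2MJ Ia Lg).
rewrite conjugationB nrm_conjugation//; last by apply: L2B; exact: Pmodel_L2.
apply: le_trans (nrm_PmodelB Ib Laf Lag) _.
rewrite (_ : (cconj a \* f) \- (cconj a \* g) = cconj a \* (f \- g)); last first.
  by apply/funext => w /=; rewrite mulrBr.
have [LaJ aJ1] := unimodular_conj (inner_function_unimodular Ia).
by rewrite nrm_unimod//; exact: L2B.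
Qed.

Lemma model_sum_infty_model f : model_sum_infty a b f -> model_space t f.
Proof.
move=> [Lf [f1 [f2 [[K1 _] [K2 _] fE]]]].
by apply: model_ae (ae_eq_sym fE) (model_components Ia Ib It tE K1 K2).
Qed.

Lemma model_sum_infty_dense f : model_space t f ->
  forall e : R, 0 < e -> exists2 h, model_sum_infty a b h & nrm (h \- f) < e.
Proof.
move=> Kf e e0; have Lf := model_L2 Kf.
have [f1 [f2 [K1 K2 fE]]] := model_decomp Ia Ib It tE Kf.
have e2 : 0 < e / 2 by rewrite divr_gt0.
have [h1 Kh1 d1] := model_space_infty_dense Ia K1 e2.
have [h2 Kh2 d2] := model_space_infty_dense Ib K2 e2.
have [Lf1 Lf2] := (model_L2 K1, model_L2 K2).
have [Lh1 Lh2] := (model_L2 Kh1.1, model_L2 Kh2.1).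
have Lah := inner_L2M Ia Lh2.
exists (h1 \+ (a \* h2)).
  by split; [exact: L2D|exists h1, h2; split=> //; exact: ae_eq_refl].
rewrite (@nrm_ae _ _ ((h1 \- f1) \+ (a \* (h2 \- f2)))); first last.
- by apply: filterS fE => w E I; rewrite /= E//=; ring.
- by apply: L2D; [exact: L2B|exact/inner_L2M/L2B].
- by apply: L2B => //; exact: L2D.
apply: le_lt_trans (nrmD (L2B Lh1 Lf1) (inner_L2M Ia (L2B Lh2 Lf2))) _.
have [La a1] := inner_function_unimodular Ia.
rewrite nrm_unimod//; last exact: L2B.
by rewrite (splitr e) ltrD.
Qed.

End Maps.

(** * The three identities on the dense subspaces *)

Section Identities.
Context {R : realType}.
Local Notation m := (circle_measure R).
Local Notation cfun := (circle R -> R[i]).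
Variables (a b t phi : circle R -> R[i]).
Hypotheses (Ia : inner_function a) (Ib : inner_function b) (It : inner_function t).
Hypothesis tE : t = a \* b %[ae m].
Hypotheses (Lphi : L2 phi) (Ab : tto_bounded t a phi).
Implicit Types (f g h u : cfun).

Let LphiJ : L2 (cconj phi). Proof. exact: L2_conj. Qed.
Let AbJ : tto_bounded a t (cconj phi). Proof. exact: tto_bounded_adjoint. Qed.

Lemma L2_Linfty phi' u : L2 phi' -> Linfty u -> L2 (phi' \* u).
Proof.
move=> Lp Lu; rewrite (_ : _ \* _ = u \* phi'); first exact: L2M.
by apply/funext => w /=; rewrite mulrC.
Qed.

Lemma Linfty_model_ae t' f g : model_space t' g -> Linfty f -> g = f %[ae m] -> Linfty g.
Proof.
move=> Kg Lf gf; apply: (Linfty_ae _ (ae_eq_sym gf) Lf).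
exact: (L2_cmeas (model_L2 Kg)).
Qed.

(* The commutation of [C_t] with [P_t] turns [C_t (A f)], where [A] has symbol
   [conj phi], into the projection of [phi C_t f]. *)
Lemma conjugation_tto u : model_space a u -> Linfty u ->
  conjugation t (tto a t (cconj phi) u) = Pmodel t (phi \* conjugation t u) %[ae m].
Proof.
move=> Ku Lu; have Lpu := L2_Linfty LphiJ Lu.
have Du : tto_dom a (cconj phi) u by [].
apply: ae_eq_trans (conjugation_ae t (tto_domE It Ia LphiJ AbJ Du)) _.
apply: ae_eq_trans (ae_eq_sym (Pmodel_conjugation It Lpu)) _.
rewrite (_ : conjugation t (cconj phi \* u) = phi \* conjugation t u).
  exact: ae_eq_refl.
apply/funext => w; rewrite !conjugationE /cconj /= !rmorphM /= conjcK; ring.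
Qed.

Lemma tto_Linfty u : model_space t u -> Linfty u ->
  tto t a phi u = Pmodel a (phi \* u) %[ae m].
Proof.
move=> Ku Lu; have Lpu := L2_Linfty Lphi Lu.
by apply: (tto_domE Ia It Lphi Ab).
Qed.

(** Projections do not preserve boundedness in general; here they coincide almost everywhere with
    the bounded components that [model_sum_infty] provides. *)
Lemma model_sum_inftyP f : model_sum_infty a b f ->
  [/\ model_space t f, Linfty f,
      model_space a (Pmodel a f) /\ Linfty (Pmodel a f),
      model_space b (Pmodel b (cconj a \* f)) /\ Linfty (Pmodel b (cconj a \* f)) &
      f = Pmodel a f \+ (a \* Pmodel b (cconj a \* f)) %[ae m]].
Proof.
move=> Df; have [Lf [f1 [f2 [[K1 [_ L1]] [K2 [_ L2']] fE]]]] := Df.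
have e1 := Pmodel_component1 Ia Lf K1 K2 fE.
have e2 := Pmodel_component2 Ia Ib Lf K1 K2 fE.
have K1' := Pmodel_model Ia Lf; have K2' := Pmodel_model Ib (inner_L2MJ Ia Lf).
have Kf := model_sum_infty_model Ia Ib It tE Df.
split=> //.
- apply: (Linfty_model_ae Kf _ fE); apply: LinftyD => //.
  by apply: LinftyM => //; exact: inner_Linfty.
- by split=> //; exact: (Linfty_model_ae K1' L1 e1).
- by split=> //; exact: (Linfty_model_ae K2' L2' e2).
- by apply: filterS3 fE e1 e2 => w e e1 e2 I; rewrite (e I) /= (e1 I) e2.
Qed.

Section Sum.
Variables (f u1 u2 : cfun).
Hypotheses (Kf : model_space t f) (Lf : Linfty f).
Hypotheses (K1 : model_space a u1) (L1 : Linfty u1).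
Hypotheses (K2 : model_space b u2) (L2u : Linfty u2).
Hypothesis fE : f = u1 \+ (a \* u2) %[ae m].

(** Every term is a projection of multiples of [X] and [Y], because $\varphi C_tf=bX+Y$ and $\varphi
    C_tu_1=bX$. *)
Let X := phi \* conjugation a u1.
Let Y := phi \* conjugation b u2.

Let LC1 : Linfty (conjugation a u1). Proof. exact: Linfty_conjugation. Qed.
Let LC2 : Linfty (conjugation b u2). Proof. exact: Linfty_conjugation. Qed.
Let LCf : Linfty (conjugation t f). Proof. exact: Linfty_conjugation. Qed.
Let LC1t : Linfty (conjugation t u1). Proof. exact: Linfty_conjugation. Qed.
Let LX : L2 X. Proof. exact: L2_Linfty. Qed.
Let LY : L2 Y. Proof. exact: L2_Linfty. Qed.

Let CfE : conjugation t f = (b \* conjugation a u1) \+ conjugation b u2 %[ae m].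
Proof. exact: (conjugation_components Ia tE fE). Qed.

Let phiCfE : phi \* conjugation t f = (b \* X) \+ Y %[ae m].
Proof. by apply: filterS CfE => w e I; rewrite /= (e I) /X /Y /=; ring. Qed.

Let Ct1E : phi \* conjugation t u1 = b \* X %[ae m].
Proof.
by apply: filterS tE => w e I; rewrite /X !conjugationE /= (e I) /=; ring.
Qed.

Lemma tto_conjugation : 
  tto t a phi (conjugation t f) = Pmodel a (b \* X) \+ Pmodel a Y %[ae m].
Proof.
apply: ae_eq_trans (tto_Linfty (conjugation_model It Kf) LCf) _.
rewrite (Pmodel_ae Ia _ _ phiCfE); [|exact: L2_Linfty|].
  by apply: PmodelD => //; exact: inner_L2M.
by apply: L2D => //; exact: inner_L2M.
Qed.

Lemma conjugation_tto1 :
  conjugation t (tto a t (cconj phi) u1) = Pmodel t (b \* X) %[ae m].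
Proof.
apply: ae_eq_trans (conjugation_tto K1 L1) _.
rewrite (Pmodel_ae It _ _ Ct1E); [exact: ae_eq_refl|exact: L2_Linfty|exact: inner_L2M].
Qed.

Lemma hankel_conj_symbol c h g : inner_function c -> L2 g -> L2 h -> c \* g = h %[ae m] ->
  hankelt c (Pminus g) = Pmodel c h %[ae m].
Proof.
move=> Ic Lg Lh e; rewrite -(Pmodel_ae Ic _ Lh e); last exact: inner_L2M.
exact: hankelt_Pminus.
Qed.

(** The left side is $P_a(bX)+P_aY-P_t(bX)$, where $P_t(bX)=P_a(bX)+aP_b(\bar abX)$. On the right
    the factor $\bar a$ cancels, leaving $P_aY$, and $b\bar t\varphi C_tu_1=\bar abX$. *)
Lemma tto_hankel_identity1 :
  tto t a phi (conjugation t f) \- conjugation t (tto a t (cconj phi) u1) =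
  hankelt a (hankel (cconj a \* phi) (conjugation b u2)) \-
    a \* hankelt b (hankel (cconj t \* phi) (conjugation t u1)) %[ae m].
Proof.
have LbX := inner_L2M Ib LX; have LabX := inner_L2MJ Ia LbX.
have h1 : hankelt a (hankel (cconj a \* phi) (conjugation b u2)) = Pmodel a Y %[ae m].
  apply: hankel_conj_symbol => //.
    by apply: L2_Linfty => //; exact: inner_L2MJ.
  by apply: filterS (inner_mulJ Ia) => w E I; rewrite /Y /= !mulrA E mul1r.
have h2 : hankelt b (hankel (cconj t \* phi) (conjugation t u1)) =
    Pmodel b (cconj a \* (b \* X)) %[ae m].
  apply: hankel_conj_symbol => //.
    by apply: L2_Linfty => //; exact: inner_L2MJ.
  apply: filterS3 tE Ct1E (inner_mulJ Ib) => w e1 e2 E I.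
  rewrite /= -mulrA [phi w * _]e2//= /cconj e1//= rmorphM -!/(cconj _ _).
  transitivity (b w * cconj b w * (cconj a w * (b w * X w))); last by rewrite E mul1r.
  by rewrite /cconj; ring.
have h3 := Pmodel_factor Ia Ib It tE LbX.
have g1 := tto_conjugation; have g2 := conjugation_tto1.
move: h1 h2 h3 g1 g2 => h1 h2 h3 g1 g2.
apply: filterS2 (filterI h1 (filterI h2 h3)) (filterI g1 g2).
move=> w [e1 [e2 e3]] [e4 e5] I; rewrite /= (e1 I) (e2 I) (e4 I) (e5 I) (e3 I) /=; ring.
Qed.

(** With $g=\bar\varphi u_1$, the conjugations turn $P_ag$ and $P_b(\bar ag)$ into $P_aX$ and
    $P_b(bX)$, so the left side is $P_a(aY)-aP_b(bX)$. The right side $P_a(abX)+P_a(aY)-P_t(abX)$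
    equals this by [Pmodel_factor]. *)
Lemma tto_hankel_identity2 :
  tto t a phi (conjugation2 a b f) \-
    conjugation2 a b (tto a t (cconj phi) u1) =
  hankelt a (hankel phi (conjugation t f)) \-
    hankelt t (hankel phi (conjugation a u1)) %[ae m].
Proof.
have Lf2 := Linfty_L2 Lf.
have LbX := inner_L2M Ib LX; have LabX := inner_L2M Ia LbX.
have LaX := inner_L2M Ia LX; have LaY := inner_L2M Ia LY.
have h1 : hankelt a (hankel phi (conjugation t f)) =
    Pmodel a (a \* (b \* X)) \+ Pmodel a (a \* Y) %[ae m].
  apply: ae_eq_trans (PmodelD Ia LabX LaY); apply: hankel_conj_symbol => //.
  - exact: L2_Linfty.
  - exact: L2D.
  - by apply: filterS phiCfE => w e I; rewrite /= [phi w * _](e I) /=; ring.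
have h2 : hankelt t (hankel phi (conjugation a u1)) = Pmodel t (a \* (b \* X)) %[ae m].
  apply: hankel_conj_symbol => //.
  by apply: filterS tE => w e I; rewrite /= (e I) /X /=; ring.
have h3 := Pmodel_factor Ia Ib It tE LabX.
have h4 : Pmodel b (cconj a \* (a \* (b \* X))) = Pmodel b (b \* X).
  apply: Pmodel_ae => //; first exact: inner_L2MJ.
  by apply: filterS (inner_mulJ Ia) => w E I; rewrite /= mulrA [cconj a w * _]mulrC E mul1r.
have c2 := conjugation2_components Ia Ib Lf2 K1 K2 fE.
have Kc := conjugation2_model Ia Ib It tE Kf.
have Lc : Linfty (conjugation2 a b f).
  apply: (Linfty_model_ae Kc _ c2); apply: LinftyD => //.
  by apply: LinftyM => //; exact: inner_Linfty.
have g1 : tto t a phi (conjugation2 a b f) = Pmodel a X \+ Pmodel a (a \* Y) %[ae m].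
  apply: ae_eq_trans (tto_Linfty Kc Lc) _.
  apply: ae_eq_trans (PmodelD Ia LX LaY).
  rewrite (@Pmodel_ae _ a _ (X \+ (a \* Y)) Ia (L2_Linfty Lphi Lc) (L2D LX LaY)).
    exact: ae_eq_refl.
  by apply: filterS c2 => w e I; rewrite /= (e I) /X /Y /=; ring.
pose g := cconj phi \* u1.
have Lg : L2 g by exact: L2_Linfty.
have Lag := inner_L2MJ Ia Lg.
have Du : tto_dom a (cconj phi) u1 by [].
have Ku := tto_model It Ia LphiJ AbJ K1.
have uE : tto a t (cconj phi) u1 = Pmodel a g \+ (a \* Pmodel b (cconj a \* g)) %[ae m].
  apply: ae_eq_trans (tto_domE It Ia LphiJ AbJ Du) _; exact: Pmodel_factor.
have g2 := conjugation2_components Ia Ib (model_L2 Ku)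
  (Pmodel_model Ia Lg) (Pmodel_model Ib Lag) uE.
have g3 : conjugation a (Pmodel a g) = Pmodel a X %[ae m].
  apply: ae_eq_trans (ae_eq_sym (Pmodel_conjugation Ia Lg)) _.
  rewrite (_ : conjugation a g = X); first exact: ae_eq_refl.
  by apply/funext => w; rewrite /X !conjugationE /cconj /= !rmorphM /= conjcK; ring.
have g4 : conjugation b (Pmodel b (cconj a \* g)) = Pmodel b (b \* X) %[ae m].
  apply: ae_eq_trans (ae_eq_sym (Pmodel_conjugation Ib Lag)) _.
  rewrite (_ : conjugation b (cconj a \* g) = b \* X); first exact: ae_eq_refl.
  by apply/funext => w; rewrite /X !conjugationE /cconj /= !rmorphM /= !conjcK; ring.
rewrite h4 in h3.
apply: filterS2 (filterI h1 (filterI h2 h3)) (filterI (filterI g1 g2) (filterI g3 g4)).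
move=> w [e1 [e2 e3]] [[e4 e5] [e6 e7]] I.
by rewrite /= (e1 I) (e2 I) (e4 I) (e5 I) /= (e6 I) (e7 I) (e3 I) /=; ring.
Qed.

End Sum.

(** Here [f] is split along $K_b\oplus bK_a$, and $X=\varphi C_av_2$, $Y=\varphi C_bv_1$. By
    $P_t(bZ)=P_b(bZ)+bP_aZ$ for $Z=X$ and $Z=aY$, both sides equal $bP_a(aY)-P_b(bX)$. *)
Lemma tto_hankel_identity3 f v1 v2 :
  model_space t f -> Linfty f -> model_space b v1 -> Linfty v1 ->
  model_space a v2 -> Linfty v2 -> f = v1 \+ (b \* v2) %[ae m] ->
  b \* tto t a phi (conjugation t f) \- conjugation t (tto a t (cconj phi) v2) =
  hankelt t (hankel phi (conjugation b v1)) \-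
    hankelt b (hankel phi (conjugation t f)) %[ae m].
Proof.
move=> Kf Lf K1 L1 K2 L2v fE.
have tE' : t = b \* a %[ae m] by apply: filterS tE => w e I; rewrite (e I) /= mulrC.
pose X := phi \* conjugation a v2; pose Y := phi \* conjugation b v1.
have LX : L2 X by apply: L2_Linfty => //; exact: Linfty_conjugation.
have LY : L2 Y by apply: L2_Linfty => //; exact: Linfty_conjugation.
have LCf : Linfty (conjugation t f) by exact: Linfty_conjugation.
have LC2 : Linfty (conjugation t v2) by exact: Linfty_conjugation.
have LaY := inner_L2M Ia LY; have LbX := inner_L2M Ib LX; have LbaY := inner_L2M Ib LaY.
have CfE := conjugation_components Ib tE' fE.
have pE : phi \* conjugation t f = (a \* Y) \+ X %[ae m].
  by apply: filterS CfE => w e I; rewrite /= (e I) /X /Y /=; ring.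
have g1 : tto t a phi (conjugation t f) = Pmodel a (a \* Y) \+ Pmodel a X %[ae m].
  apply: ae_eq_trans (tto_Linfty (conjugation_model It Kf) LCf) _.
  by rewrite (Pmodel_ae Ia _ _ pE); [exact: PmodelD|exact: L2_Linfty|exact: L2D].
have g2 : conjugation t (tto a t (cconj phi) v2) = Pmodel t (b \* X) %[ae m].
  apply: ae_eq_trans (conjugation_tto K2 L2v) _.
  rewrite (@Pmodel_ae _ t _ (b \* X))//; [exact: ae_eq_refl|exact: L2_Linfty|].
  by apply: filterS tE => w e I; rewrite /X !conjugationE /= (e I) /=; ring.
have h1 : hankelt t (hankel phi (conjugation b v1)) = Pmodel t (b \* (a \* Y)) %[ae m].
  apply: hankel_conj_symbol => //.
  by apply: filterS tE => w e I; rewrite /= (e I) /Y /=; ring.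
have h2 : hankelt b (hankel phi (conjugation t f)) =
    Pmodel b (b \* (a \* Y)) \+ Pmodel b (b \* X) %[ae m].
  apply: ae_eq_trans (PmodelD Ib LbaY LbX); apply: hankel_conj_symbol => //.
  - exact: L2_Linfty.
  - exact: L2D.
  - by apply: filterS pE => w e I; rewrite /= [phi w * _](e I) /=; ring.
have key Z : L2 Z -> Pmodel t (b \* Z) = Pmodel b (b \* Z) \+ (b \* Pmodel a Z) %[ae m].
  move=> LZ; have LbZ := inner_L2M Ib LZ.
  rewrite (@Pmodel_ae _ a Z (cconj b \* (b \* Z)))//; first exact: Pmodel_factor.
    exact: inner_L2MJ.
  by apply: filterS (inner_mulJ Ib) => w E I; rewrite /= mulrA [cconj b w * _]mulrC E mul1r.
apply: filterS2 (filterI h1 h2) (filterI (filterI g1 g2) (filterI (key _ LX) (key _ LaY))).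
move=> w [e1 e2] [[e3 e4] [e5 e6]] I.
by rewrite /= (e1 I) (e2 I) (e3 I) /= (e4 I) (e5 I) (e6 I) /=; ring.
Qed.

Lemma hankel_domP psi u : L2 psi -> H2 u -> Linfty u -> hankel_dom psi u.
Proof. by move=> Lp Hu Lu; split=> //; exact: L2_Linfty. Qed.

Lemma hankelt_L2 c psi u : inner_function c -> L2 psi -> Linfty u ->
  L2 (hankelt c (hankel psi u)).
Proof.
move=> Ic Lp Lu; have [_ [Lq _] _] := Pminus_spec (L2_Linfty Lp Lu).
by have [_ /H2_L2] := Pplus_spec (inner_L2M Ic Lq).
Qed.

End Identities.

(** The equality can fail only where [alpha] vanishes, a null set since $|\alpha|=1$ almost
    everywhere. *)
Lemma quotK (R : realType) (theta alpha : circle R -> R[i]) : inner_function alpha ->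
  theta = alpha \* quot theta alpha %[ae circle_measure R].
Proof.
move=> Ia; have [_ a1] := inner_function_unimodular Ia.
apply: filterS a1 => w e _; rewrite /quot /= mulrC divfK//.
by apply/eqP => a0; move: e; rewrite a0 /sqn /= expr0n addr0 => /eqP; rewrite eq_sym oner_eq0.
Qed.

(** Outside $L^2$ the projection in [hankel] takes the default value 0; the clauses on [hankel_dom]
    exclude this on the dense subspaces. *)
Theorem theorem7p2 (R : realType) (alpha theta phi : circle R -> R[i])
  (inner_alpha : inner_function alpha) (inner_theta : inner_function theta)
  (nonconst_alpha : nonconstant alpha) (nonconst_theta : nonconstant theta)
  (le_alpha_theta : inner_le alpha theta)
  (phi_L2 : L2 phi) (A_bounded : tto_bounded theta alpha phi) :
  let beta := quot theta alpha in
  [/\ (forall f, model_sum_infty alpha beta f ->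
         hankel_dom (cconj alpha \* phi)
           (conjugation beta (Pmodel beta (cconj alpha \* f))) /\
         hankel_dom (cconj theta \* phi) (conjugation theta (Pmodel alpha f))) /\
      eq_cont_ext (model_space theta) (model_sum_infty alpha beta)
        (fun f => tto theta alpha phi (conjugation theta f) \-
           conjugation theta (tto alpha theta (cconj phi) (Pmodel alpha f)))
        (fun f => hankelt alpha (hankel (cconj alpha \* phi)
             (conjugation beta (Pmodel beta (cconj alpha \* f)))) \-
           alpha \* hankelt beta (hankel (cconj theta \* phi)
             (conjugation theta (Pmodel alpha f)))),
      (forall f, model_sum_infty alpha beta f ->
         hankel_dom phi (conjugation theta f) /\
         hankel_dom phi (conjugation alpha (Pmodel alpha f))) /\
      eq_cont_ext (model_space theta) (model_sum_infty alpha beta)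
        (fun f => tto theta alpha phi (conjugation2 alpha beta f) \-
           conjugation2 alpha beta
             (tto alpha theta (cconj phi) (Pmodel alpha f)))
        (fun f => hankelt alpha (hankel phi (conjugation theta f)) \-
           hankelt theta (hankel phi (conjugation alpha (Pmodel alpha f)))) &
      (forall f, model_sum_infty beta alpha f ->
         hankel_dom phi (conjugation beta (Pmodel beta f)) /\
         hankel_dom phi (conjugation theta f)) /\
      eq_cont_ext (model_space theta) (model_sum_infty beta alpha)
        (fun f => beta \* tto theta alpha phi (conjugation theta f) \-
           conjugation theta
             (tto alpha theta (cconj phi) (Pmodel alpha (cconj beta \* f))))
        (fun f => hankelt theta (hankel phi (conjugation beta (Pmodel beta f))) \-
           hankelt beta (hankel phi (conjugation theta f)))].
Proof.
move=> beta.
have Ia := inner_alpha; have It := inner_theta; have Ib : inner_function beta := le_alpha_theta.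
have tE : theta = alpha \* beta %[ae circle_measure R] := quotK theta Ia.
have tE' : theta = beta \* alpha %[ae circle_measure R].
  by apply: filterS tE => w e I; rewrite e//= mulrC.
have phiJ_L2 : L2 (cconj phi) := L2_conj phi_L2.
have AJ_bounded := tto_bounded_adjoint Ia It phi_L2 A_bounded.
have aphi_L2 := inner_L2MJ Ia phi_L2; have tphi_L2 := inner_L2MJ It phi_L2.
(* The left-hand sides of the first and third equalities are built from these two maps by isometries
   and projections. *)
pose tto_C f := tto theta alpha phi (conjugation theta f).
pose C_tto f := conjugation theta (tto alpha theta (cconj phi) f).
have lip_tto_C : lip_maps (model_space theta) L2 tto_C.
  apply: (lip_mapsW (@model_L2 _ alpha)).
  exact: lip_maps_comp (lip_conjugation It) (lip_tto Ia It phi_L2 A_bounded).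
have lip_C_tto : lip_maps (model_space alpha) L2 C_tto.
  apply: (lip_mapsW (@model_L2 _ theta)).
  exact: lip_maps_comp (lip_tto It Ia phiJ_L2 AJ_bounded) (lip_conjugation It).
have lip_Pa : lip_maps (model_space theta) (model_space alpha) (Pmodel alpha).
  exact: lip_maps_restrict (@model_L2 _ theta) (lip_Pmodel Ia).
(* The first two equalities use the factorization of [theta] as [alpha] times [beta], the third the
   opposite order. *)
have dom12 := model_sum_inftyP Ia Ib It tE.
have dom3 := model_sum_inftyP Ib Ia It tE'.
split; split.
- move=> f /dom12[Kf Lf [K1 L1] [K2 L2f] fE]; split; apply: hankel_domP => //.
  + by apply: (@model_H2 _ beta); exact: conjugation_model.
  + exact: Linfty_conjugation.
  + apply: (@model_H2 _ theta); apply: conjugation_model => //.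
    exact: (model_factorl Ia Ib It tE K1).
  + exact: Linfty_conjugation.
- apply: eq_cont_extI; [exact: model_L2|exact: (model_sum_infty_model Ia Ib It tE)|
    exact: (model_sum_infty_dense Ia Ib It tE)| | |].
  + by apply: lip_mapsB => //; exact: lip_maps_comp lip_Pa lip_C_tto.
  + move=> f /dom12[Kf Lf [K1 L1] [K2 L2f] fE]; apply: L2B.
      by apply: hankelt_L2 => //; exact: Linfty_conjugation.
    by apply: inner_L2M => //; apply: hankelt_L2 => //; exact: Linfty_conjugation.
  + by move=> f /dom12[Kf Lf [K1 L1] [K2 L2f] fE]; exact: tto_hankel_identity1.
- move=> f /dom12[Kf Lf [K1 L1] [K2 L2f] fE]; split; apply: hankel_domP => //.
  + by apply: (@model_H2 _ theta); exact: conjugation_model.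
  + exact: Linfty_conjugation.
  + by apply: (@model_H2 _ alpha); exact: conjugation_model.
  + exact: Linfty_conjugation.
- have lip_C2 := lip_conjugation2 Ia Ib It tE.
  apply: eq_cont_extI; [exact: model_L2|exact: (model_sum_infty_model Ia Ib It tE)|
    exact: (model_sum_infty_dense Ia Ib It tE)| | |].
  + apply: lip_mapsB.
      apply: (lip_mapsW (@model_L2 _ alpha)).
      exact: lip_maps_comp lip_C2 (lip_tto Ia It phi_L2 A_bounded).
    apply: (lip_mapsW (@model_L2 _ theta)); 
    exact: lip_maps_comp lip_Pa (lip_maps_comp (lip_tto It Ia phiJ_L2 AJ_bounded) lip_C2).
  + move=> f /dom12[Kf Lf [K1 L1] [K2 L2f] fE]; apply: L2B.
      by apply: hankelt_L2 => //; exact: Linfty_conjugation.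
    by apply: hankelt_L2 => //; exact: Linfty_conjugation.
  + by move=> f /dom12[Kf Lf [K1 L1] [K2 L2f] fE]; exact: tto_hankel_identity2 fE.
- move=> f /dom3[Kf Lf [K1 L1] [K2 L2f] fE]; split; apply: hankel_domP => //.
  + by apply: (@model_H2 _ beta); exact: conjugation_model.
  + exact: Linfty_conjugation.
  + by apply: (@model_H2 _ theta); exact: conjugation_model.
  + exact: Linfty_conjugation.
- apply: eq_cont_extI; [exact: model_L2|exact: (model_sum_infty_model Ib Ia It tE')|
    exact: (model_sum_infty_dense Ib Ia It tE')| | |].
  + apply: lip_mapsB; first exact: lip_maps_comp lip_tto_C (lip_mul Ib).
    exact: lip_maps_comp (lip_maps_restrict (@model_L2 _ theta)
      (lip_maps_comp (lip_mulJ Ib) (lip_Pmodel Ia))) lip_C_tto.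
  + move=> f /dom3[Kf Lf [K1 L1] [K2 L2f] fE]; apply: L2B.
      by apply: hankelt_L2 => //; exact: Linfty_conjugation.
    by apply: hankelt_L2 => //; exact: Linfty_conjugation.
  + by move=> f /dom3[Kf Lf [K1 L1] [K2 L2f] fE]; exact: tto_hankel_identity3.
Qed.
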